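(* Let $R$ be a (commutative) noetherian domain. Then the following conditions are equivalent: (a) The class $\mathcal{CA}$ of all contraadjusted $R$-modules is enveloping. (b) The class $\mathcal{VF}$ of all very flat $R$-modules is covering. (c) The spectrum $\operatorname{Spec}(R)$ is finite (and the Krull dimension of $R$ is at most $1$). (d) Each flat $R$-module is very flat.
   Context: All rings are commutative with unit. For $r \in R$, $R[r^{-1}]$ denotes the localization of $R$ at the multiplicative set $\{1, r, r^2, \dots\}$ (viewed as an $R$-module). An $R$-module $C$ is contraadjusted if $\operatorname{Ext}^1_R(R[r^{-1}], C) = 0$ for all $r \in R$; $\mathcal{CA}$ is the class of all contraadjusted modules. An $R$-module $M$ is very flat if $\operatorname{Ext}^1_R(M,C) = 0$ for every contraadjusted module $C$; $\mathcal{VF}$ is the class of all very flat modules. A class of modules $\mathcal A$ is precovering if for each module $M$ there is a homomorphism $f: A \to M$ with $A \in \mathcal A$ (an $\mathcal A$-precover of $M$) such that each homomorphism $f': A' \to M$ with $A' \in \mathcal A$ factors as $f' = fg$ for some $g: A' \to A$. An $\mathcal A$-precover $f: A \to M$ is an $\mathcal A$-cover if each $g: A \to A$ with $f = fg$ is an automorphism. $\mathcal A$ is covering if each module has an $\mathcal A$-cover. Dually, a homomorphism $f: M \to B$ with $B \in \mathcal B$ is a $\mathcal B$-preenvelope of $M$ if each homomorphism $f': M \to B'$ with $B' \in \mathcal B$ factors as $f' = gf$ for some $g: B \to B'$; it is a $\mathcal B$-envelope if moreover each $g: B \to B$ with $f = gf$ is an automorphism. $\mathcal B$ is enveloping if each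 module has a $\mathcal B$-envelope. *)

(* Defs.v *)
From HB Require Import structures.
From mathcomp Require Import all_boot all_order all_algebra.
From mathcomp Require Import boolp classical_sets functions cardinality.
From mathcomp Require Import freeg ring.

Set Implicit Arguments.
Unset Strict Implicit.
Unset Printing Implicit Defensive.

Import GRing.Theory.
Local Open Scope ring_scope.
Local Open Scope classical_set_scope.
Local Open Scope quotient_scope.

Definition is_ideal (R : comNzRingType) (I : set R) : Prop :=
  [/\ I 0, forall x y, I x -> I y -> I (x + y) & forall a x, I x -> I (a * x)].

Definition noetherian (R : comNzRingType) : Prop :=
  forall I : set R, is_ideal I ->
    exists s : seq R, I = smallest (@is_ideal R) [set` s].

(* [idealr_closed] includes [1 \notin P]. *)
Definition Spec (R : comNzRingType) : set (set R) :=
  [set P : set R | idealr_closed (mem P) /\ prime_idealr_closed (mem P)].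
Arguments Spec R : clear implicits.

(* Every chain P 0 < ... < P m of primes has length m <= n. *)
Definition krull_dim_le (R : comNzRingType) (n : nat) : Prop :=
  forall (m : nat) (P : nat -> set R),
    (forall i, (i <= m)%N -> Spec R (P i)) ->
    (forall i, (i < m)%N -> P i `<` P i.+1) ->
    (m <= n)%N.

Section Localization.
Variables (R : comNzRingType) (r : R).

(* (a, n) represents the fraction a / r ^+ n. *)
Definition loc_equiv (x y : R * nat) : bool :=
  `[< exists k, r ^+ k * (x.1 * r ^+ y.2) = r ^+ k * (y.1 * r ^+ x.2) >].

Lemma loc_equiv_refl : reflexive loc_equiv.
Proof. by move=> x; apply/asboolP; exists 0%N. Qed.

Lemma loc_equiv_sym : symmetric loc_equiv.
Proof. by move=> x y; apply/asboolP/asboolP => -[k e]; exists k. Qed.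

Lemma loc_equiv_trans : transitive loc_equiv.
Proof.
move=> y x z /asboolP[k exy] /asboolP[l eyz]; apply/asboolP.
exists (k + l + y.2)%N; rewrite !exprD.
transitivity (r ^+ l * r ^+ z.2 * (r ^+ k * (x.1 * r ^+ y.2))); first by ring.
rewrite exy.
transitivity (r ^+ k * r ^+ x.2 * (r ^+ l * (y.1 * r ^+ z.2))); first by ring.
by rewrite eyz; ring.
Qed.

Canonical loc_equiv_equiv :=
  EquivRel loc_equiv loc_equiv_refl loc_equiv_sym loc_equiv_trans.
Canonical loc_equiv_encModRel := defaultEncModRel loc_equiv.

Definition loc := {eq_quot loc_equiv}.
HB.instance Definition _ : EqQuotient (R * nat)%type loc_equiv loc :=
  EqQuotient.on loc.
HB.instance Definition _ := Choice.on loc.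

Definition frac (a : R) (n : nat) : loc := \pi_loc (a, n).

Lemma fracP a n b m :
  frac a n = frac b m <->
  exists k, r ^+ k * (a * r ^+ m) = r ^+ k * (b * r ^+ n).
Proof.
split=> [/eqP|e]; first by rewrite eqmodE => /asboolP.
by apply/eqP; rewrite eqmodE; apply/asboolP.
Qed.

Lemma frac_surj (x : loc) : exists a n, x = frac a n.
Proof. by exists (repr x).1, (repr x).2; rewrite /frac -surjective_pairing reprK. Qed.

Lemma frac_repr a n : frac (repr (frac a n)).1 (repr (frac a n)).2 = frac a n.
Proof. by rewrite {1}/frac -surjective_pairing reprK. Qed.

Definition loc_add (x y : loc) : loc :=
  frac ((repr x).1 * r ^+ (repr y).2 + (repr y).1 * r ^+ (repr x).2)
       ((repr x).2 + (repr y).2).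
Definition loc_opp (x : loc) : loc := frac (- (repr x).1) (repr x).2.
Definition loc_scale (c : R) (x : loc) : loc := frac (c * (repr x).1) (repr x).2.

Lemma loc_addE a n b m :
  loc_add (frac a n) (frac b m) = frac (a * r ^+ m + b * r ^+ n) (n + m).
Proof.
have /fracP[k ea] := frac_repr a n; have /fracP[l eb] := frac_repr b m.
rewrite /loc_add; move: (repr (frac a n)) (repr (frac b m)) ea eb => [a' n'] [b' m'] /= ea eb.
apply/fracP; exists (k + l)%N; rewrite !exprD.
transitivity (r ^+ l * r ^+ m' * r ^+ m * (r ^+ k * (a' * r ^+ n)) +
   r ^+ k * r ^+ n * r ^+ n' * (r ^+ l * (b' * r ^+ m))); first by ring.
by rewrite ea eb; ring.
Qed.

Lemma loc_oppE a n : loc_opp (frac a n) = frac (- a) n.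
Proof.
have /fracP[k ea] := frac_repr a n; apply/fracP; exists k.
by rewrite !mulNr !mulrN ea.
Qed.

Lemma loc_scaleE c a n : loc_scale c (frac a n) = frac (c * a) n.
Proof.
have /fracP[k ea] := frac_repr a n; apply/fracP; exists k.
by rewrite -!mulrA !(mulrCA _ c) ea.
Qed.

Lemma frac_eq a n b m : a * r ^+ m = b * r ^+ n -> frac a n = frac b m.
Proof. by move=> e; apply/fracP; exists 0%N; rewrite e. Qed.

Lemma loc_addA : associative loc_add.
Proof.
move=> x y z; have [a [n ->]] := frac_surj x.
have [b [m ->]] := frac_surj y; have [c [p ->]] := frac_surj z.
by rewrite !loc_addE; apply: frac_eq; rewrite !exprD; ring.
Qed.

Lemma loc_addC : commutative loc_add.
Proof.
move=> x y; have [a [n ->]] := frac_surj x; have [b [m ->]] := frac_surj y.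
by rewrite !loc_addE; apply: frac_eq; rewrite !exprD; ring.
Qed.

Lemma loc_add0 : left_id (frac 0 0) loc_add.
Proof.
move=> x; have [a [n ->]] := frac_surj x.
by rewrite !loc_addE; apply: frac_eq; rewrite !exprD; ring.
Qed.

Lemma loc_addN : left_inverse (frac 0 0) loc_opp loc_add.
Proof.
move=> x; have [a [n ->]] := frac_surj x.
by rewrite loc_oppE !loc_addE; apply: frac_eq; rewrite !exprD; ring.
Qed.

HB.instance Definition _ :=
  GRing.isZmodule.Build loc loc_addA loc_addC loc_add0 loc_addN.

Lemma fracD a n b m :
  frac a n + frac b m = frac (a * r ^+ m + b * r ^+ n) (n + m).
Proof. exact: loc_addE. Qed.

Lemma loc_scaleA c d x : loc_scale c (loc_scale d x) = loc_scale (c * d) x.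
Proof.
by have [a [n ->]] := frac_surj x; rewrite !loc_scaleE mulrA.
Qed.

Lemma loc_scale1 : left_id 1 loc_scale.
Proof. by move=> x; have [a [n ->]] := frac_surj x; rewrite loc_scaleE mul1r. Qed.

Lemma loc_scaleDr : right_distributive loc_scale +%R.
Proof.
move=> c x y; have [a [n ->]] := frac_surj x; have [b [m ->]] := frac_surj y.
by rewrite fracD !loc_scaleE fracD; apply: frac_eq; ring.
Qed.

Lemma loc_scaleDl x : {morph loc_scale^~ x : c d / c + d}.
Proof.
move=> c d; have [a [n ->]] := frac_surj x.
by rewrite !loc_scaleE fracD; apply: frac_eq; rewrite !exprD; ring.
Qed.

HB.instance Definition _ := GRing.Zmodule_isLmodule.Build R loc
  loc_scaleA loc_scale1 loc_scaleDr loc_scaleDl.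

Lemma fracZ c a n : c *: frac a n = frac (c * a) n.
Proof. exact: loc_scaleE. Qed.

End Localization.

Section QuotientModule.
Variables (R : nzRingType) (V : lmodType R) (G : set V).

Definition submodule (S : set V) : Prop := submod_closed (mem S).

Definition span : {pred V} := fun x => `[< smallest submodule G x >].

Lemma span_submod : submod_closed span.
Proof.
split=> [|a x y /asboolP xS /asboolP yS].
  by apply/asboolP => S [[S0 _] _]; apply: set_mem.
apply/asboolP => S [[S0 SD] GS].
by apply/set_mem/SD; apply/mem_set; [apply: xS|apply: yS].
Qed.

HB.instance Definition _ := GRing.isSubmodClosed.Build R V span span_submod.

Lemma span_incl x : G x -> x \in span.
Proof. by move=> Gx; apply/asboolP => S [_]; apply. Qed.

Definition quotmod := Quotient.quot span.
HB.instance Definition _ := GRing.Zmodule.on quotmod.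
HB.instance Definition _ := EqQuotient.on quotmod.

Definition quotmod_pi (x : V) : quotmod := \pi_quotmod x.

Lemma quotmod_piP x y : quotmod_pi x = quotmod_pi y <-> x - y \in span.
Proof. by rewrite Quotient.idealrBE; split=> /eqP. Qed.

Lemma quotmod_piD : {morph quotmod_pi : x y / x + y}.
Proof. by move=> x y; rewrite /quotmod_pi raddfD. Qed.

Lemma quotmod_repr x : quotmod_pi (repr x) = x.
Proof. exact: reprK. Qed.

Lemma quotmod_surj (x : quotmod) : exists v, x = quotmod_pi v.
Proof. by exists (repr x); rewrite quotmod_repr. Qed.

Definition quotmod_scale (a : R) (x : quotmod) : quotmod :=
  quotmod_pi (a *: repr x).

Lemma quotmod_scaleE a v : quotmod_scale a (quotmod_pi v) = quotmod_pi (a *: v).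
Proof.
apply/quotmod_piP; rewrite -scalerBr rpredZ //.
by apply/quotmod_piP; rewrite quotmod_repr.
Qed.

Lemma quotmod_scaleA a b x :
  quotmod_scale a (quotmod_scale b x) = quotmod_scale (a * b) x.
Proof. by have [v ->] := quotmod_surj x; rewrite !quotmod_scaleE scalerA. Qed.

Lemma quotmod_scale1 : left_id 1 quotmod_scale.
Proof. by move=> x; have [v ->] := quotmod_surj x; rewrite quotmod_scaleE scale1r. Qed.

Lemma quotmod_scaleDr : right_distributive quotmod_scale +%R.
Proof.
move=> a x y; have [v ->] := quotmod_surj x; have [w ->] := quotmod_surj y.
by rewrite -quotmod_piD !quotmod_scaleE scalerDr quotmod_piD.
Qed.

Lemma quotmod_scaleDl x : {morph quotmod_scale^~ x : a b / a + b}.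
Proof.
move=> a b; have [v ->] := quotmod_surj x.
by rewrite !quotmod_scaleE scalerDl quotmod_piD.
Qed.

HB.instance Definition _ := GRing.Zmodule_isLmodule.Build R quotmod
  quotmod_scaleA quotmod_scale1 quotmod_scaleDr quotmod_scaleDl.

Lemma quotmod_pi_is_linear : linear quotmod_pi.
Proof. by move=> a x y; rewrite quotmod_piD -[RHS]/(quotmod_scale a _ + _) quotmod_scaleE. Qed.

HB.instance Definition _ :=
  GRing.isLinear.Build R V quotmod _ quotmod_pi quotmod_pi_is_linear.

Lemma span_ker (W : lmodType R) (f : {linear V -> W}) :
  (forall x, G x -> f x = 0) -> forall x, x \in span -> f x = 0.
Proof.
move=> f0 x /asboolP /(_ [set y | f y = 0]); apply; split=> //; split=> [|a u v].
  by rewrite inE /= linear0.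
by rewrite !inE /= => fu fv; rewrite linearP fu fv scaler0 addr0.
Qed.

End QuotientModule.

Section FreegLift.
Variables (R : nzRingType) (K : choiceType) (M : lmodType R) (f : K -> M).

HB.instance Definition _ := GRing.isZmodMorphism.Build {freeg K / R} M
  (fglift f) (lift_is_additive f).

Lemma fglift_is_linear : linear (fglift f : {freeg K / R} -> M).
Proof.
move=> a D E; rewrite raddfD; congr (_ + _).
have -> : fglift f D = \sum_(x <- dom D) coeff x D *: f x.
  by rewrite -[in LHS](freeg_sumE D) raddf_sum; apply: eq_bigr => x _; rewrite /= liftU.
have -> : a *: D = \sum_(x <- dom D) << a * coeff x D *g x >> by [].
by rewrite scaler_sumr raddf_sum; apply: eq_bigr => x _; rewrite /= liftU scalerA.
Qed.

HB.instance Definition _ := GRing.isLinear.Build R {freeg K / R} M _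
  (fglift f) fglift_is_linear.

Lemma fglift1 k : fglift f << k >> = f k.
Proof. by rewrite liftU scale1r. Qed.

Lemma freeg_linear_ext (g h : {linear {freeg K / R} -> M}) :
  (forall k, g << k >> = h << k >>) -> g =1 h.
Proof.
move=> e D; rewrite -(freeg_sumE D) !linear_sum; apply: eq_bigr => k _.
have -> : << coeff k D *g k >> = coeff k D *: << k >> :> {freeg K / R}.
  by apply/eqP/freeg_eqP => x; rewrite coeffZ !coeffU mul1r.
by rewrite /= !linearZ /= e.
Qed.

End FreegLift.

Section Tensor.
Variable R : comNzRingType.

Definition bilinear_map (M N V : lmodType R) (b : M -> N -> V) : Prop :=
  (forall n, linear (b^~ n)) /\ (forall m, linear (b m)).

(* M (x) N is the free module on M * N modulo the bilinearity relations. *)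
Definition bilin_rel (M N : lmodType R) : set {freeg (M * N) / R} :=
  [set t | (exists a m m' n,
              t = << (a *: m + m', n) >> - (a *: << (m, n) >> + << (m', n) >>)) \/
           (exists a m n n',
              t = << (m, a *: n + n') >> - (a *: << (m, n) >> + << (m, n') >>))].

Definition tensor (M N : lmodType R) : lmodType R := quotmod (@bilin_rel M N).

Definition tens (M N : lmodType R) (m : M) (n : N) : tensor M N :=
  quotmod_pi (@bilin_rel M N) << (m, n) >>.

Lemma tens_bilinear (M N : lmodType R) : bilinear_map (@tens M N).
Proof.
split=> [n a m m'|m a n n']; rewrite /tens -linearP; apply/quotmod_piP/span_incl.
  by left; exists a, m, m', n.
by right; exists a, m, n, n'.
Qed.

Definition tensor_lift (M N V : lmodType R) (b : M -> N -> V) (x : tensor M N) : V :=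
  fglift (fun p : M * N => b p.1 p.2) (repr x).

Section Lift.
Variables (M N V : lmodType R) (b : M -> N -> V).
Hypothesis bB : bilinear_map b.

Lemma tensor_lift_pi t :
  tensor_lift b (quotmod_pi (@bilin_rel M N) t) =
  fglift (fun p : M * N => b p.1 p.2) t.
Proof.
apply/eqP; rewrite -subr_eq0 /tensor_lift -linearB; apply/eqP.
apply: (@span_ker _ _ (@bilin_rel M N)); last first.
  by apply/quotmod_piP; rewrite quotmod_repr.
case: bB => bl br _ [[a [m [m' [n ->]]]]|[a [m [n [n' ->]]]]].
  by rewrite linearB linearP /= !liftU !scale1r /= bl subrr.
by rewrite linearB linearP /= !liftU !scale1r /= br subrr.
Qed.

Lemma tensor_lift_tens m n : tensor_lift b (tens m n) = b m n.
Proof. by rewrite tensor_lift_pi fglift1. Qed.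

Lemma tensor_lift_linear : linear (tensor_lift b).
Proof.
move=> a x y; have [t ->] := quotmod_surj x; have [u ->] := quotmod_surj y.
by rewrite -linearP !tensor_lift_pi linearP.
Qed.

End Lift.

Lemma tensor_linear_ext (M N V : lmodType R) (g h : {linear tensor M N -> V}) :
  (forall m n, g (tens m n) = h (tens m n)) -> g =1 h.
Proof.
move=> e x; have [t ->] := quotmod_surj x.
by apply: (freeg_linear_ext (g := g \o quotmod_pi _) (h := h \o quotmod_pi _))
  => -[m n]; apply: e.
Qed.

(* id_M (x) f *)
Definition tensor_map (M A B : lmodType R) (f : {linear A -> B}) :
    tensor M A -> tensor M B :=
  tensor_lift (fun m a => tens m (f a)).

Lemma tensor_map_bilinear (M A B : lmodType R) (f : {linear A -> B}) :
  bilinear_map (fun (m : M) a => tens m (f a)).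
Proof.
have [tl tr] := tens_bilinear M B.
by split=> [a c m m'|m c a a']; rewrite ?linearP; [apply: tl|apply: tr].
Qed.

Lemma tensor_map_linear (M A B : lmodType R) (f : {linear A -> B}) :
  linear (tensor_map f : tensor M A -> tensor M B).
Proof. exact/tensor_lift_linear/tensor_map_bilinear. Qed.

HB.instance Definition _ (M A B : lmodType R) (f : {linear A -> B}) :=
  GRing.isLinear.Build R (tensor M A) (tensor M B) _ (@tensor_map M A B f)
    (tensor_map_linear f).

Lemma tensor_map_tens (M A B : lmodType R) (f : {linear A -> B}) (m : M) a :
  tensor_map f (tens m a) = tens m (f a).
Proof. exact/tensor_lift_tens/tensor_map_bilinear. Qed.

Definition flat (M : lmodType R) : Prop :=
  forall (A B : lmodType R) (f : {linear A -> B}),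
    injective f -> injective (tensor_map f : tensor M A -> tensor M B).

End Tensor.

Section Ext.
Variable R : comNzRingType.

Definition surjective_map (A B : Type) (f : A -> B) : Prop := forall y, exists x, f x = y.

Definition exact_at (A B C : lmodType R) (f : {linear A -> B}) (g : {linear B -> C}) : Prop :=
  forall y, g y = 0 <-> exists x, f x = y.

Definition projective (P : lmodType R) : Prop :=
  forall (A B : lmodType R) (p : {linear A -> B}) (h : {linear P -> B}),
    surjective_map p -> exists g : {linear P -> A}, h =1 p \o g.

Record proj_resolution (M : lmodType R) := ProjResolution {
  res_mod : nat -> lmodType R;
  res_diff : forall n, {linear res_mod n.+1 -> res_mod n};
  res_aug : {linear res_mod 0%N -> M};
  res_projective : forall n, projective (res_mod n);
  res_exact : forall n, exact_at (res_diff n.+1) (res_diff n);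
  res_exact0 : exact_at (res_diff 0%N) res_aug;
  res_aug_surj : surjective_map res_aug }.

(* Every 1-cocycle of the complex Hom(P, C) is a 1-coboundary. *)
Definition cohomology1_eq0 (M C : lmodType R) (P : proj_resolution M) : Prop :=
  forall f : {linear res_mod P 1 -> C}, (forall x, f (res_diff P 1 x) = 0) ->
    exists g : {linear res_mod P 0 -> C}, f =1 g \o res_diff P 0.

(* Ext^1(M, C) = 0; by [proj_resolution_ex] and [cohomology1_eq0_indep], the
   vanishing of H^1(Hom(P, C)) for one resolution P of M is equivalent to its
   vanishing for all of them. *)
Definition Ext1_eq0 (M C : lmodType R) : Prop :=
  forall P : proj_resolution M, cohomology1_eq0 C P.

Section Ker.
Variables (A B : lmodType R) (f : {linear A -> B}).

Definition ker_pred : {pred A} := fun x => f x == 0.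

Lemma ker_submod : submod_closed ker_pred.
Proof.
split=> [|a x y]; rewrite !unfold_in ?linear0 //.
by move=> /eqP fx /eqP fy; rewrite linearP fx fy scaler0 addr0.
Qed.

HB.instance Definition _ := GRing.isSubmodClosed.Build R A ker_pred ker_submod.

Record ker := Ker { ker_val :> A; _ : ker_val \in ker_pred }.
HB.instance Definition _ := [isSub for ker_val].
HB.instance Definition _ := [Choice of ker by <:].
HB.instance Definition _ := [SubChoice_isSubLmodule of ker by <:].

Lemma kerE (x : ker) : f (val x) = 0.
Proof. by case: x => x /=; rewrite unfold_in => /eqP. Qed.

Lemma ker_mk x : f x = 0 -> exists k : ker, val k = x.
Proof.
move=> fx; have kx : x \in ker_pred by rewrite unfold_in fx.
by exists (Ker kx).
Qed.

End Ker.

Lemma mk_linear (U V : lmodType R) (h : U -> V) :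
  linear h -> exists H : {linear U -> V}, H =1 h.
Proof.
move=> hl.
pose H : {linear U -> V} := HB.pack h (GRing.isLinear.Build R U V _ h hl).
by exists H.
Qed.

Lemma ker_lift (A B U : lmodType R) (f : {linear A -> B}) (h : {linear U -> A}) :
  (forall x, f (h x) = 0) ->
  exists k : {linear U -> ker f}, forall x, val (k x) = h x.
Proof.
move=> fh; have /choice[k kE] : forall x, exists k : ker f, val k = h x.
  by move=> x; apply: ker_mk.
have kl : linear k by move=> a x y; apply: val_inj; rewrite linearP /= !kE linearP.
by have [K KE] := mk_linear kl; exists K => x; rewrite KE.
Qed.

Lemma projective_exact (P A B C : lmodType R) (f : {linear A -> B})
    (g : {linear B -> C}) (h : {linear P -> B}) :
  projective P -> exact_at f g -> (forall x, g (h x) = 0) ->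
  exists l : {linear P -> A}, h =1 f \o l.
Proof.
move=> Pp ex gh; have gf x : g (f x) = 0 by apply/ex; exists x.
have [f' f'E] := ker_lift gf; have [h' h'E] := ker_lift gh.
have [|l lE] := Pp _ _ f' h'.
  move=> y; have /ex[x xE] := kerE y.
  by exists x; apply: val_inj; rewrite f'E.
by exists l => x; rewrite -h'E lE /= f'E.
Qed.

Lemma projective_freeg (K : choiceType) : projective {freeg K / R}.
Proof.
move=> A B p h ps.
have /choice[c cE] : forall k : K, exists a, p a = h << k >> by move=> k; apply: ps.
exists (fglift c); apply: (freeg_linear_ext (h := p \o fglift c)) => k /=.
by rewrite fglift1 cE.
Qed.

Section Existence.
Variable M : lmodType R.

Record stage := Stage {
  stage_src : lmodType R;
  stage_tgt : lmodType R;
  stage_map : {linear stage_src -> stage_tgt} }.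

Definition next_stage (s : stage) : stage :=
  @Stage {freeg (ker (stage_map s)) / R} (stage_src s) (fglift val).

Definition free_stage (n : nat) : stage :=
  iter n next_stage (@Stage {freeg M / R} M (fglift id)).

Definition free_diff n :
    {linear stage_src (free_stage n.+1) -> stage_src (free_stage n)} :=
  stage_map (free_stage n.+1).

Lemma next_stage_exact s : exact_at (stage_map (next_stage s)) (stage_map s).
Proof.
move=> y; split=> [/ker_mk[k <-]|[x <-]].
  by exists << k >>; apply: fglift1.
apply: (@freeg_linear_ext _ _ _ (stage_map s \o stage_map (next_stage s)) \0).
by move=> k; rewrite -[RHS](kerE k); congr (stage_map s _); apply: fglift1.
Qed.

Lemma proj_resolution_ex : inhabited (proj_resolution M).
Proof.
constructor; apply: (@ProjResolution M (fun n => stage_src (free_stage n))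
  free_diff (fglift id)).
- by case=> [|n]; apply: projective_freeg.
- by move=> n; apply: next_stage_exact.
- exact: next_stage_exact.
by move=> y; exists << y >>; apply: fglift1.
Qed.

End Existence.

Lemma res_diffK (M : lmodType R) (P : proj_resolution M) n x :
  res_diff P n (res_diff P n.+1 x) = 0.
Proof. by apply/res_exact; exists x. Qed.

Lemma res_augK (M : lmodType R) (P : proj_resolution M) x :
  res_aug P (res_diff P 0 x) = 0.
Proof. by apply/res_exact0; exists x. Qed.

Lemma res_compare (M : lmodType R) (P Q : proj_resolution M) :
  exists (u0 : {linear res_mod P 0 -> res_mod Q 0})
         (u1 : {linear res_mod P 1 -> res_mod Q 1}),
    (forall x, res_aug Q (u0 x) = res_aug P x) /\
    (forall x, res_diff Q 0 (u1 x) = u0 (res_diff P 0 x)).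
Proof.
have [u0 u0E] := res_projective (n := 0) (res_aug P) (@res_aug_surj _ Q).
have [|u1 u1E] := projective_exact (h := u0 \o res_diff P 0)
  (@res_projective _ P 1) (@res_exact0 _ Q).
  by move=> x; rewrite -[LHS]u0E res_augK.
by exists u0, u1; split=> x; [apply/esym/u0E | apply/esym/u1E].
Qed.

Lemma cohomology1_eq0_indep (M C : lmodType R) (P Q : proj_resolution M) :
  cohomology1_eq0 C P -> cohomology1_eq0 C Q.
Proof.
move=> H f fQ; have [u0 [u1 [u0E u1E]]] := res_compare P Q.
have [v0 [v1 [v0E v1E]]] := res_compare Q P.
have fker y : res_diff Q 0 y = 0 -> f y = 0.
  by move=> /res_exact[x <-].
have [|g gE] := H (f \o u1).
  by move=> x /=; apply: fker; rewrite u1E res_diffK linear0.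
have [|s sE] := projective_exact (h := (u0 \o v0) \- idfun)
  (@res_projective _ Q 0) (@res_exact0 _ Q).
  by move=> x; rewrite /= linearB u0E v0E subrr.
have dsE x : res_diff Q 0 (s x) = u0 (v0 x) - x by apply/esym/sE.
exists ((g \o v0) \- (f \o s)) => x /=.
have -> : g (v0 (res_diff Q 0 x)) = f (u1 (v1 x)) by rewrite -v1E; apply/esym/gE.
apply/eqP; rewrite -subr_eq0 -!linearB; apply/eqP/fker.
by rewrite !linearB /= u1E v1E dsE opprK addKr subrr.
Qed.

End Ext.

Definition contraadjusted (R : comNzRingType) (C : lmodType R) : Prop :=
  forall r : R, Ext1_eq0 (loc r) C.

Definition very_flat (R : comNzRingType) (M : lmodType R) : Prop :=
  forall C : lmodType R, contraadjusted C -> Ext1_eq0 M C.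

Section CoversEnvelopes.
Variables (R : comNzRingType) (X : lmodType R -> Prop).

Definition is_precover (M A : lmodType R) (f : {linear A -> M}) : Prop :=
  X A /\ forall (A' : lmodType R) (f' : {linear A' -> M}), X A' ->
    exists g : {linear A' -> A}, f' =1 f \o g.

(* A linear map is an automorphism iff it is bijective. *)
Definition is_cover (M A : lmodType R) (f : {linear A -> M}) : Prop :=
  is_precover f /\ forall g : {linear A -> A}, f =1 f \o g -> bijective g.

Definition covering : Prop :=
  forall M : lmodType R, exists (A : lmodType R) (f : {linear A -> M}), is_cover f.

Definition is_preenvelope (M B : lmodType R) (f : {linear M -> B}) : Prop :=
  X B /\ forall (B' : lmodType R) (f' : {linear M -> B'}), X B' ->
    exists g : {linear B -> B'}, f' =1 g \o f.

Definition is_envelope (M B : lmodType R) (f : {linear M -> B}) : Prop :=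
  is_preenvelope f /\ forall g : {linear B -> B}, f =1 g \o f -> bijective g.

Definition enveloping : Prop :=
  forall M : lmodType R, exists (B : lmodType R) (f : {linear M -> B}), is_envelope f.

End CoversEnvelopes.

(* Main.v *)
(** By the telescope presentation of R[1/r], a module C is contraadjusted iff for
    every r and every sequence c in C the equations x_n - r x_(n+1) = c_n have a
    solution. Call R a Goldman domain if some s <> 0 lies in all nonzero primes.

    Let V be very flat and s V = V for all s <> 0, with a map V -> Q onto the
    fraction field. In the product of the residue fields k(P), P <> 0, the
    families vanishing at all P not containing some s <> 0 form a contraadjusted
    submodule S, and the quotient by S is a vector space over Q. So
    V -> Q -> (prod k(P)) / S lifts to the product, where the lift is 0; hence
    1 lies in S, i.e. R is Goldman. This applies to V = Q, which gives the case
    of (d). For (b) take a very flat cover f : V -> Q. Its kernel K is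
    contraadjusted by Wakamatsu's lemma and K -> V/sV is onto with contraadjusted
    kernel, so V -> V/sV lifts to h : V -> K. As 1 - h is an automorphism with
    image in sV, V = sV. For (a) take the envelope E of a countable direct sum M
    of copies of R_p, p of height one; dually E/M is very flat, divisible and
    torsion free, and nonzero since M is not contraadjusted.
    A noetherian Goldman domain has finite spectrum and dimension at most 1 by
    Krull's principal ideal theorem.

    Conversely, if the spectrum is finite and the dimension at most 1, let s lie
    in all nonzero primes, so that Q = R[1/s]. Given M, take a free module B and a
    map B -> M + P, P free, inducing isomorphisms modulo all maximal ideals, and
    complete it s-adically to F -> M + P. Then F is an extension of a Q-vector
    space by B, hence very flat, and the kernel lies in the radical of F and is
    uniquely s-complete; this yields very flat covers, and it forces the kernel
    to vanish if M is flat. The contraadjusted envelope of M is the universal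
    extension of a Q-vector space by M. *)

From HB Require Import structures.
Require Import Defs.
From mathcomp Require Import all_boot all_order all_algebra.
From mathcomp Require Import boolp classical_sets functions cardinality.
From mathcomp Require Import freeg ring.

Set Implicit Arguments.
Unset Strict Implicit.
Unset Printing Implicit Defensive.

Import GRing.Theory.
Local Open Scope ring_scope.
Local Open Scope classical_set_scope.
Local Open Scope quotient_scope.

Local Notation span := Defs.span.
Local Notation frac := Defs.frac.

(** * Submodules, quotients and vanishing of Ext *)

Section LinearMaps.
Variable R : comNzRingType.
Implicit Types A B C D E F M N P Q U V W X Y Z : lmodType R.

Lemma factor_surj A B C (p : {linear A -> B}) (g : {linear A -> C}) :
  surjective_map p -> (forall x, p x = 0 -> g x = 0) ->
  exists h : {linear B -> C}, forall x, h (p x) = g x.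
Proof.
move=> /choice[s sK] pg.
have gE x y : p x = p y -> g x = g y.
  by move=> e; apply/subr0_eq; rewrite -linearB pg // linearB e subrr.
have [|h hE] := mk_linear (h := g \o s).
  by move=> a x y /=; rewrite -linearP; apply: gE; rewrite linearP !sK.
by exists h => x; rewrite hE; apply: gE; rewrite sK.
Qed.

Definition inclusion A B (f : {linear A -> B}) : {linear ker f -> A} := val.

Lemma inclusion_inj A B (f : {linear A -> B}) : injective (inclusion f).
Proof. exact: val_inj. Qed.

Lemma inclusionE A B (f : {linear A -> B}) x : f (inclusion f x) = 0.
Proof. exact: kerE. Qed.

Definition short_exact X Y M (a : {linear X -> Y}) (b : {linear Y -> M}) : Prop :=
  [/\ injective a, exact_at a b & surjective_map b].

Lemma short_exact_ker Y M (b : {linear Y -> M}) :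
  surjective_map b -> short_exact (inclusion b) b.
Proof.
move=> bs; split=> // y; split=> [/ker_mk[k <-]|[k <-]]; first by exists k.
exact: inclusionE.
Qed.

Lemma short_exact0 X Y M (a : {linear X -> Y}) (b : {linear Y -> M}) x :
  short_exact a b -> b (a x) = 0.
Proof. by case=> _ ex _; apply/ex; exists x. Qed.

Lemma submoduleP V (S : set V) :
  S 0 -> (forall x y, S x -> S y -> S (x + y)) ->
  (forall (a : R) x, S x -> S (a *: x)) -> submodule S.
Proof.
move=> S0 SD SZ; split=> [|a x y]; rewrite !inE // => Sx Sy.
by apply: SD => //; apply: SZ.
Qed.

Lemma spanP V (S : set V) x : submodule S -> (x \in span S) <-> S x.
Proof.
move=> SS; split=> [/asboolP|]; last exact: span_incl.
by apply; split.
Qed.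

Lemma span_ind V (G S : set V) : S 0 ->
  (forall x y, S x -> S y -> S (x + y)) ->
  (forall (a : R) x, S x -> S (a *: x)) ->
  G `<=` S -> forall x, x \in span G -> S x.
Proof.
move=> S0 SD SZ GS x /asboolP; apply; split=> //; exact: submoduleP.
Qed.

Lemma quotmod_eq0 V (G : set V) x : quotmod_pi G x = 0 <-> x \in span G.
Proof. by rewrite -(linear0 (quotmod_pi G)) quotmod_piP subr0. Qed.

Lemma quotmod_pi_surj V (G : set V) : surjective_map (quotmod_pi G).
Proof. by move=> x; have [v ->] := quotmod_surj x; exists v. Qed.

Lemma range_submodule V N (f : {linear N -> V}) : submodule (range f).
Proof.
apply: submoduleP => [|_ _ [x _ <-] [y _ <-]|a _ [x _ <-]].
- by exists 0; rewrite ?linear0.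
- by exists (x + y); rewrite ?linearD.
by exists (a *: x); rewrite ?linearZ.
Qed.

Lemma quotmod_submod0 V (S : set V) x : submodule S -> quotmod_pi S x = 0 <-> S x.
Proof. by move=> SS; apply: iff_trans (quotmod_eq0 _ _) _; apply: spanP. Qed.

Lemma quotmod_range0 V N (f : {linear N -> V}) x :
  quotmod_pi (range f) x = 0 <-> exists y, f y = x.
Proof.
apply: iff_trans (quotmod_submod0 _ (range_submodule f)) _.
by split=> [[y _]|[y]]; exists y.
Qed.

(** Encoded as the kernel of the projection modulo [span S], so that the module structure comes from
    [ker]. *)
Definition submod_of V (S : set V) : lmodType R := ker (quotmod_pi S).

Lemma submod_ofP V (S : set V) : submodule S ->
  forall x : submod_of S, S (inclusion (quotmod_pi S) x).
Proof. by move=> SS x; apply/spanP => //; apply/quotmod_eq0/inclusionE. Qed.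

Lemma submod_of_mk V (S : set V) v : S v ->
  exists x : submod_of S, inclusion (quotmod_pi S) x = v.
Proof. by move=> Sv; apply: ker_mk; apply/quotmod_eq0/span_incl. Qed.

End LinearMaps.

(** * Vanishing of Ext^1 through presentations, liftings and splittings *)

Section ExtVanishing.
Variable R : comNzRingType.
Implicit Types A B C D E F M N P Q U V W X Y Z : lmodType R.

Lemma res_ker_surj M (r : proj_resolution M) :
  exists k : {linear res_mod r 1 -> ker (res_aug r)},
    (forall x, inclusion _ (k x) = res_diff r 0 x) /\ surjective_map k.
Proof.
have [k kE] := ker_lift (@res_augK _ M r).
exists k; split=> // y.
have /(@res_exact0 _ M r)[x xE] := inclusionE y.
by exists x; apply: inclusion_inj; rewrite -xE -kE.
Qed.

(** A lift P_0 -> Y of the augmentation induces P_1 -> X; its composite with [u] is a cocycle, hence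
    of the form g d. As Y is the quotient of P_0 + X by P_1, the maps g and [u] glue. *)
Lemma ext1_extend M C X Y (a : {linear X -> Y}) (b : {linear Y -> M}) :
  Ext1_eq0 M C -> short_exact a b ->
  forall u : {linear X -> C}, exists v : {linear Y -> C}, forall x, v (a x) = u x.
Proof.
move=> MC ab u; have [ai ex bs] := ab; have [P] := proj_resolution_ex M.
have [phi phiE] := res_projective (n := 0) (res_aug P) bs.
have [xi xiE] : exists xi : {linear res_mod P 1 -> X},
    forall x, a (xi x) = phi (res_diff P 0 x).
  have [|l lE] := projective_exact (h := phi \o res_diff P 0)
    (@res_projective _ _ P 1) ex.
    by move=> x /=; rewrite -[LHS]phiE res_augK.
  by exists l => x; rewrite -[LHS]lE.
have [|g gE] := MC P (u \o xi).
  move=> x /=; suff -> : xi (res_diff P 1 x) = 0 by rewrite linear0.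
  by apply: ai; rewrite xiE res_diffK !linear0.
have lin : linear (fun z : res_mod P 0 * X => phi z.1 + a z.2).
  by move=> c z w /=; rewrite !linearP /= scalerDr addrACA.
have [p pE] := mk_linear lin.
have lin' : linear (fun z : res_mod P 0 * X => g z.1 + u z.2).
  by move=> c z w /=; rewrite !linearP /= scalerDr addrACA.
have [q qE] := mk_linear lin'.
have [y|z|v vE] := factor_surj (p := p) (g := q).
- have [x xE] := @res_aug_surj _ _ P (b y).
  have /ex[w wE] : b (y - phi x) = 0 by rewrite linearB -[b (phi x)]phiE xE subrr.
  by exists (x, w); rewrite pE /= wE addrC subrK.
- rewrite pE qE => /eqP; rewrite addr_eq0 => /eqP e.
  have /res_exact0[w wE] : res_aug P z.1 = 0.
    by rewrite phiE /= e linearN (short_exact0 _ ab) oppr0.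
  have -> : z.2 = - xi w.
    by apply: ai; rewrite linearN xiE wE e opprK.
  by rewrite linearN -wE -[g _]gE subrr.
exists v => x; have := vE (0, x); rewrite pE qE /= !linear0 !add0r; exact.
Qed.

(** Reduces all resolutions to one presentation. A cocycle descends to the kernel of P_0 -> M; a
    lift Y -> P_0 maps X into that kernel, and P_0 is the quotient of the sum of Y and the kernel by
    X, so maps on both parts glue. *)
Lemma ext1_pres M C X Y (a : {linear X -> Y}) (b : {linear Y -> M}) :
  projective Y -> short_exact a b ->
  (forall u : {linear X -> C}, exists v : {linear Y -> C}, forall x, v (a x) = u x) ->
  Ext1_eq0 M C.
Proof.
move=> Yp ab uv P f f0; have [ai ex bs] := ab.
have [k [kE ks]] := res_ker_surj P.
have kf x : k x = 0 -> f x = 0.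
  move=> kx; have /res_exact[w <-] : res_diff P 0 x = 0 by rewrite -kE kx linear0.
  exact: f0.
have [u uE] := factor_surj ks kf.
have [phi phiE] := Yp _ _ _ b (@res_aug_surj _ _ P).
have [|xi xiE] := ker_lift (f := res_aug P) (h := phi \o a).
  by move=> x /=; rewrite -[LHS]phiE (short_exact0 _ ab).
have [v vE] := uv (u \o xi).
have lin : linear (fun z : Y * ker (res_aug P) => phi z.1 + val z.2).
  by move=> c z w /=; rewrite !linearP /= scalerDr addrACA.
have [p pE] := mk_linear lin.
have lin' : linear (fun z : Y * ker (res_aug P) => v z.1 + u z.2).
  by move=> c z w /=; rewrite !linearP /= scalerDr addrACA.
have [q qE] := mk_linear lin'.
have [y|z|g gE] := factor_surj (p := p) (g := q).
- have [x xE] := bs (res_aug P y).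
  have [w wE] : exists w : ker (res_aug P), val w = y - phi x.
    by apply: ker_mk; rewrite linearB -[res_aug P (phi x)]phiE xE subrr.
  by exists (x, w); rewrite pE /= wE addrC subrK.
- rewrite pE qE => /eqP; rewrite addr_eq0 => /eqP e.
  have /ex[w wE] : b z.1 = 0.
    by rewrite phiE /= e (linearN (res_aug P)) kerE oppr0.
  have -> : z.2 = - xi w.
    by apply: val_inj; rewrite [RHS]linearN /= xiE /= wE e opprK.
  by rewrite linearN -wE vE /= subrr.
exists g => x; have := gE (0, k x); rewrite pE qE /= !linear0 !add0r uE => <- /=.
by rewrite -kE.
Qed.

(** The fibre product of F and A over M is an extension of A by [ker f]. Given a retraction v onto
    [ker f], the first projection minus v factors through A. *)
Lemma ext1_lift A F M (f : {linear F -> M}) (f' : {linear A -> M}) :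
  surjective_map f -> Ext1_eq0 A (ker f) ->
  exists g : {linear A -> F}, forall x, f (g x) = f' x.
Proof.
move=> fs AK.
have lin : linear (fun z : F * A => f z.1 - f' z.2).
  by move=> c z w /=; rewrite (linearP f) (linearP f') scalerBr opprD addrACA.
have [d dE] := mk_linear lin.
have dK (y : ker d) : f (val y).1 = f' (val y).2.
  by apply/eqP; rewrite -subr_eq0 -dE kerE.
pose b : {linear ker d -> A} := snd \o inclusion d.
have lin' : linear (fun x : ker f => (val x, 0) : F * A).
  by move=> c x y; congr (_, _); rewrite ?linearP //= scaler0 addr0.
have [j jE] := mk_linear lin'.
have [|a aE] := ker_lift (f := d) (h := j).
  by move=> x; rewrite dE jE /= kerE linear0 subr0.
have ab : short_exact a b.
  split=> [x y e|y|y].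
  - by apply: val_inj; have := congr1 (fst \o val) e; rewrite /= !aE !jE.
  - split=> [by0|[x <-]]; last by rewrite /b /= /inclusion aE jE.
    have [k kE] : exists k : ker f, val k = (val y).1.
      by apply: ker_mk; rewrite dK [(val y).2]by0 linear0.
    exists k; apply: val_inj; rewrite aE jE kE.
    by rewrite [RHS]surjective_pairing; congr (_, _); apply/esym.
  have [x xE] := fs (f' y).
  have [|k kE] := @ker_mk _ _ _ d (x, y); first by rewrite dE /= xE subrr.
  by exists k; rewrite /b /= /inclusion kE.
have [v vE] := ext1_extend AK ab idfun.
have [|x bx0|g gE] := @factor_surj _ _ _ _ b ((fst \o inclusion d) \- (inclusion f \o v)).
- by case: ab.
- have [_ ex _] := ab; have /ex[w <-] := bx0.
  by rewrite /= vE /inclusion aE jE subrr.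
exists g => x; have [_ _ /(_ x)[y <-]] := ab.
by rewrite gE /= linearB inclusionE subr0 dK.
Qed.

(** The pushout of P_0 along [u] is an extension of M by C. With a section s of it, y - s (b y) lies
    in C for y in P_0, and this map extends [u]. *)
Lemma ext1_split M C :
  (forall Z (j : {linear C -> Z}) (q : {linear Z -> M}), short_exact j q ->
     exists s : {linear M -> Z}, forall x, q (s x) = x) ->
  Ext1_eq0 M C.
Proof.
move=> sp; have [P] := proj_resolution_ex M.
pose b := res_aug P; have bs : surjective_map b := @res_aug_surj _ _ P.
have ab := short_exact_ker bs.
apply: (ext1_pres (@res_projective _ _ P 0) ab) => u.
have lin : linear (fun x : ker b => (u x, - val x) : C * res_mod P 0).
  by move=> c x y; congr (_, _); rewrite ?linearP //= opprD scalerN.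
have [r rE] := mk_linear lin.
pose G := range r; have GS : submodule G := range_submodule r.
pose pi : {linear (C * res_mod P 0)%type -> quotmod G} := quotmod_pi G.
have piE x : pi (u x, 0) = pi (0, val x).
  apply/quotmod_piP/spanP => //; exists x => //; rewrite rE.
  by congr (_, _); rewrite ?subr0 ?sub0r.
have lin1 : linear (fun c : C => (c, 0) : C * res_mod P 0).
  by move=> c x y; congr (_, _); rewrite //= scaler0 addr0.
have [i1 i1E] := mk_linear lin1.
have lin2 : linear (fun y : res_mod P 0 => (0, y) : C * res_mod P 0).
  by move=> c x y; congr (_, _); rewrite //= scaler0 addr0.
have [i2 i2E] := mk_linear lin2.
have [||q qE] := @factor_surj _ _ _ _ pi (b \o snd).
- exact: quotmod_pi_surj.
- by move=> z /quotmod_eq0/spanP-/(_ GS)[x _ <-]; rewrite rE /= (linearN b) kerE oppr0.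
have se : short_exact (pi \o i1) q.
  split=> [x y /=|z|y].
  - rewrite !i1E => /quotmod_piP/spanP-/(_ GS)[w _]; rewrite rE => -[e1 e2].
    suff w0 : w = 0 by move: e1; rewrite w0 linear0 => /esym/subr0_eq.
    by apply: val_inj; apply/oppr_inj; rewrite e2 subr0 linear0 ?oppr0.
  - split=> [qz|[x <-]]; last by rewrite qE /= i1E linear0.
    have [[c y] zE] := quotmod_pi_surj z; move: qz; rewrite -zE qE /= => /ker_mk[k kE].
    exists (c + u k); rewrite /= i1E.
    have -> : (c + u k, 0) = (c, 0) + (u k, 0) :> C * res_mod P 0.
      by congr (_, _); rewrite /= addr0.
    rewrite linearD [X in _ + X]piE -linearD; congr (pi _).
    by congr (_, _); rewrite /= ?addr0 ?add0r.
  have [x <-] := bs y; by exists (pi (0, x)); rewrite qE.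
have [s sE] := sp _ _ _ se; have [ji ex _] := se.
have ji' x y : pi (i1 x) = pi (i1 y) -> x = y by apply: ji.
have /choice[v vE] : forall y : res_mod P 0, exists c, pi (i1 c) = pi (i2 y) - s (b y).
  move=> y; have /ex[c cE] : q (pi (i2 y) - s (b y)) = 0.
    by rewrite linearB sE qE /= i2E subrr.
  by exists c.
have vl : linear v.
  move=> c x y; apply: ji'; rewrite vE (linearP i1) (linearP pi) !vE.
  by rewrite (linearP i2) (linearP pi) (linearP b) (linearP s) scalerBr opprD addrACA.
have [w wE] := mk_linear vl; exists w => x; rewrite wE; apply: ji'.
by rewrite vE inclusionE linear0 subr0 i1E i2E piE.
Qed.

Lemma ext1_projective M C : projective M -> Ext1_eq0 M C.
Proof.
move=> Mp; apply: ext1_split => Z j q [_ _ qs].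
by have [s sE] := Mp _ _ _ idfun qs; exists s => x; exact/esym/(sE x).
Qed.

(** The kernel of P_0 -> A -> D is an extension of B by the kernel of P_0 -> A. A map on the latter
    extends to the former because of B, then to P_0 because of D. *)
Lemma ext1_ext A B D C (i : {linear B -> A}) (p : {linear A -> D}) :
  short_exact i p -> Ext1_eq0 B C -> Ext1_eq0 D C -> Ext1_eq0 A C.
Proof.
move=> ip BC DC; have [ii iex ps] := ip.
have [P] := proj_resolution_ex A.
pose b := res_aug P; have bs : surjective_map b := @res_aug_surj _ _ P.
apply: (ext1_pres (@res_projective _ _ P 0) (short_exact_ker bs)) => u.
pose d : {linear res_mod P 0 -> D} := p \o b.
have ds : surjective_map d.
  by move=> y; have [z <-] := ps y; have [x <-] := bs z; exists x.
have /choice[c cE] : forall y : ker d, exists w, i w = b (val y).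
  by move=> y; apply/iex; apply: (kerE y).
have cl : linear c by move=> k x y; apply: ii; rewrite cE (linearP i) !cE -(linearP b).
have [c' c'E] := mk_linear cl.
have [|a aE] := ker_lift (f := d) (h := inclusion b).
  by move=> x; rewrite /= inclusionE linear0.
have se : short_exact a c'.
  split=> [x y e|y|y].
  - by apply: val_inj; have := congr1 val e; rewrite !aE.
  - split=> [|[x <-]].
      rewrite c'E => cy; have [|k kE] := @ker_mk _ _ _ b (val y).
        by rewrite -cE cy linear0.
      by exists k; apply: val_inj; rewrite aE; exact: kE.
    by apply: ii; rewrite c'E cE linear0 aE inclusionE.
  have [x xE] := bs (i y).
  have [|k kE] := @ker_mk _ _ _ d x; first by rewrite /d /= xE (short_exact0 _ ip).
  by exists k; apply: ii; rewrite c'E cE kE xE.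
have [v vE] := ext1_extend BC se u.
have [w wE] := ext1_extend DC (short_exact_ker ds) v.
exists w => x; rewrite -vE -wE; congr (w _); exact/esym/aE.
Qed.

(** Given an extension q : Z -> M, lift [p] through q and precompose with [i]. *)
Lemma ext1_retract M N C (i : {linear M -> N}) (p : {linear N -> M}) :
  (forall x, p (i x) = x) -> Ext1_eq0 N C -> Ext1_eq0 M C.
Proof.
move=> pi NC; apply: ext1_split => Z j q jq; have [ji ex qs] := jq.
(* [ker q] is isomorphic to C through j, which transports the hypothesis on N. *)
have CK : Ext1_eq0 N (ker q).
  have [P] := proj_resolution_ex N.
  have bs := @res_aug_surj _ _ P.
  apply: (ext1_pres (@res_projective _ _ P 0) (short_exact_ker bs)) => u.
  have /choice[c cE] : forall y : ker q, exists w, j w = val y.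
    by move=> y; apply/ex/kerE.
  have cl : linear c by move=> k x y; apply: ji; rewrite cE (linearP j) !cE.
  have [c' c'E] := mk_linear cl.
  have [|j' j'E] := ker_lift (f := q) (h := j).
    by move=> x; exact: short_exact0 jq.
  have [v vE] := ext1_extend NC (short_exact_ker bs) (c' \o u).
  exists (j' \o v) => x /=; apply: val_inj.
  by rewrite j'E vE /= c'E cE.
have [g gE] := ext1_lift p qs CK.
by exists (g \o i) => x /=; rewrite gE pi.
Qed.

End ExtVanishing.

(** * Telescopes and contraadjusted modules *)

Section Telescope.
Variable R : comNzRingType.
Implicit Types A B C E M V X Y : lmodType R.

(** This is the vanishing of lim^1 for the tower C <- C <- ... whose maps are multiplication by
    r. *)
Definition solvable (r : R) C : Prop :=
  forall c : nat -> C, exists x : nat -> C, forall n, x n - r *: x n.+1 = c n.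

Lemma solvable_surj r C : (forall x : C, exists y, r *: y = x) -> solvable r C.
Proof.
move=> /choice[d dE] c.
pose x := fix x n := if n is m.+1 then d (x m - c m) else 0.
by exists x => n /=; rewrite dE subKr.
Qed.

Lemma solvable_nilp r C k : (forall x : C, r ^+ k *: x = 0) -> solvable r C.
Proof.
(* The geometric series in r, which stops at k. *)
move=> rk c; exists (fun n => \sum_(i < k) r ^+ i *: c (n + i)%N) => n.
case: k rk => [|k] rk.
  have c0 m : c m = 0 by rewrite -[c m]scale1r -(expr0 r) rk.
  by rewrite !big_ord0 c0 scaler0 subr0.
rewrite big_ord_recl expr0 scale1r addn0 big_ord_recr /= scalerDr scalerA -exprS rk addr0.
rewrite scaler_sumr (eq_bigr (fun i : 'I_k => r *: (r ^+ i *: c (n.+1 + i)%N))).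
  by rewrite addrK.
by move=> i _; rewrite scalerA -exprS /bump leq0n add1n addSnnS.
Qed.

Lemma solvable_ext r A B C (a : {linear A -> B}) (b : {linear B -> C}) :
  short_exact a b -> solvable r A -> solvable r C -> solvable r B.
Proof.
move=> [ai ex /choice[s sK]] rA rC c; have [y yE] := rC (b \o c).
have /choice[d dE] n : exists d, a d = c n - (s (y n) - r *: s (y n.+1)).
  by apply/ex; rewrite !(linearB b) (linearZ_LR b) !sK yE subrr.
have [x xE] := rA d.
exists (fun n => a (x n) + s (y n)) => n.
rewrite scalerDr opprD addrACA -(linearZ_LR a) -(linearB a) xE dE.
by rewrite subrK.
Qed.

Lemma freeg_ind (K : choiceType) (S : {freeg K / R} -> Prop) :
  S 0 -> (forall u v, S u -> S v -> S (u + v)) ->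
  (forall a u, S u -> S (a *: u)) -> (forall k, S << k >>) -> forall u, S u.
Proof.
move=> S0 SD SZ Sk u; rewrite -(freeg_sumE u).
apply: (big_ind S) => // k _.
have -> : << coeff k u *g k >> = coeff k u *: << k >> :> {freeg K / R}.
  by apply/eqP/freeg_eqP => x; rewrite coeffZ !coeffU mul1r.
exact/SZ/Sk.
Qed.

Lemma freeg_coeff0 (K : choiceType) (u : {freeg K / R}) :
  (forall k, coeff k u = 0) -> u = 0.
Proof. by move=> u0; apply/eqP/freeg_eqP => k; rewrite u0 coeff0. Qed.

Variables (K : choiceType) (r : R).
Local Notation F := {freeg (K * nat) / R}.

(** Its cokernel is a direct sum of copies of R[1/r] indexed by K, where the generator (k, n) stands
    for 1 / r^n in the k-th copy. *)
Definition tel : {linear F -> F} :=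
  fglift (fun k : K * nat => << k >> - r *: << (k.1, k.2.+1) >> : F).

Definition level n : {linear {freeg K / R} -> F} :=
  fglift (fun k : K => << (k, n) >> : F).

Arguments tel : simpl never.
Arguments level : simpl never.

Lemma tel1 k n : tel << (k, n) >> = << (k, n) >> - r *: << (k, n.+1) >>.
Proof. exact: fglift1. Qed.

Lemma level1 n k : level n << k >> = << (k, n) >>.
Proof. exact: fglift1. Qed.

Lemma coeff_tel0 k u : coeff (k, 0%N) (tel u) = coeff (k, 0%N) u.
Proof.
elim/freeg_ind: u => [|u v eu ev|a u eu|[l n]]; rewrite ?linear0 //.
- by rewrite linearD !coeffD eu ev.
- by rewrite linearZ !coeffZ eu.
rewrite tel1 coeffB coeffZ !coeffU !xpair_eqE /= andbF mulr0 mulr0 subr0.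
by case: n.
Qed.

Lemma coeff_telS k n u :
  coeff (k, n.+1) (tel u) = coeff (k, n.+1) u - r * coeff (k, n) u.
Proof.
elim/freeg_ind: u => [|u v eu ev|a u eu|[l m]].
- by rewrite linear0 !coeff0 mulr0 subr0.
- by rewrite linearD !coeffD eu ev mulrDr opprD addrACA.
- by rewrite linearZ !coeffZ eu mulrBr !mulrA (mulrC r).
by rewrite tel1 coeffB coeffZ !coeffU !xpair_eqE /= eqSS.
Qed.

Lemma tel_inj : injective tel.
Proof.
move=> u v /eqP; rewrite -subr_eq0 -linearB => /eqP e; apply: subr0_eq.
apply: freeg_coeff0 => -[k n]; elim: n => [|n IH].
  by rewrite -coeff_tel0 e coeff0.
by have := coeff_telS k n (u - v); rewrite IH mulr0 subr0 e coeff0.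
Qed.

Lemma level_shift n j v : exists w, level n v = level (n + j)%N (r ^+ j *: v) + tel w.
Proof.
elim: j => [|j [w ->]]; first by exists 0; rewrite addn0 expr0 scale1r linear0 addr0.
have step m u : level m u = level m.+1 (r *: u) + tel (level m u).
  elim/freeg_ind: u => [|u x eu ex|a u eu|k].
  - by rewrite scaler0 !linear0 addr0.
  - by rewrite scalerDr !linearD {1}eu {1}ex addrACA.
  - by rewrite scalerA mulrC -scalerA 2!(linearZ_LR (level _)) (linearZ_LR tel) {1}eu scalerDr.
  by rewrite linearZ_LR !level1 tel1 addrC subrK.
exists (level (n + j)%N (r ^+ j *: v) + w).
by rewrite {1}step addnS exprS scalerA linearD addrA.
Qed.

(** The cokernel of [tel] is the directed union of the images of the levels: two levels n and m are
    both shifted to n + m. *)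
Lemma level_normal u : exists n v w, u = level n v + tel w.
Proof.
elim/freeg_ind: u => [|u v [n [x [w ->]]] [m [y [z ->]]]|a u [n [x [w ->]]]|[k n]].
- by exists 0%N, 0, 0; rewrite !linear0 addr0.
- have [w1 e1] := level_shift n m x; have [w2 e2] := level_shift m n y.
  exists (n + m)%N, (r ^+ m *: x + r ^+ n *: y), ((w1 + w2) + (w + z)).
  rewrite e1 e2 (addnC m) (linearD (level _)) !(linearD tel).
  by rewrite -(addrA (level _ _)) -(addrA (level _ (_ *: y))) addrACA [in LHS](addrACA (tel w1)).
- by exists n, (a *: x), (a *: w); rewrite (linearZ_LR (level n)) (linearZ_LR tel) scalerDr.
by exists n, << k >>, 0; rewrite level1 linear0 addr0.
Qed.

(** A relation at one level that is killed by r^j dies j levels later, hence comes from [tel]. *)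
Lemma tel_exact M (t : K * nat -> M) :
  (forall k n, t (k, n) = r *: t (k, n.+1)) ->
  (forall x, exists n v, x = fglift (fun k => t (k, n)) v) ->
  (forall n v, fglift (fun k => t (k, n)) v = 0 -> exists j, r ^+ j *: v = 0) ->
  short_exact tel (fglift t).
Proof.
move=> tr ts t0.
have lE n v : fglift t (level n v) = fglift (fun k => t (k, n)) v.
  apply: (freeg_linear_ext (g := fglift t \o level n) (h := fglift _)) => k.
  by rewrite /= level1 !fglift1.
have telE w : fglift t (tel w) = 0.
  apply: (freeg_linear_ext (g := fglift t \o tel) (h := \0)) => -[k n].
  by rewrite /= tel1 (linearB (fglift t)) (linearZ_LR (fglift t)) /= !fglift1 /= -tr subrr.
split=> [|u|x]; first exact: tel_inj.
  split=> [|[w <-]]; last exact: telE.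
  have [n [v [w ->]]] := level_normal u.
  rewrite linearD /= telE addr0 lE => /t0[j vj].
  have [z ->] := level_shift n j v.
  by exists (z + w); rewrite vj linear0 add0r linearD.
by have [n [v ->]] := ts x; exists (level n v); apply: lE.
Qed.

Lemma solvable_family C (c : K * nat -> C) : solvable r C ->
  exists x : K * nat -> C, forall k n, x (k, n) - r *: x (k, n.+1) = c (k, n).
Proof.
move=> rC.
have /choice[x xE] : forall k, exists x : nat -> C,
    forall n, x n - r *: x n.+1 = c (k, n) by move=> k; apply: rC.
by exists (fun k => x k.1 k.2) => k n; apply: xE.
Qed.

Lemma ext1_tel M C (t : K * nat -> M) :
  short_exact tel (fglift t) -> solvable r C -> Ext1_eq0 M C.
Proof.
move=> te rC; apply: (ext1_pres _ te) => [|u]; first exact: projective_freeg.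
have [x xE] := solvable_family (fun k => u << k >>) rC.
exists (fglift x); apply: (freeg_linear_ext (g := fglift x \o tel)) => -[k n] /=.
by rewrite tel1 (linearB (fglift x)) (linearZ_LR (fglift x)) /= !fglift1.
Qed.

(** E is the quotient of M + F by the elements (- c u, tel u), and the injectivity of [tel] makes M
    embed. It serves both the kernels of covers and the construction of envelopes. *)
Lemma adjoin_solutions M (c : K * nat -> M) :
  exists (E : lmodType R) (i : {linear M -> E}) (e : K * nat -> E),
  [/\ injective i,
      forall k n, e (k, n) - r *: e (k, n.+1) = i (c (k, n)),
      forall C (g : {linear M -> C}) (x : K * nat -> C),
        (forall k n, x (k, n) - r *: x (k, n.+1) = g (c (k, n))) ->
        exists h : {linear E -> C},
          (forall m, h (i m) = g m) /\ (forall k, h (e k) = x k) &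
      forall y, exists n v m, y = i m + fglift (fun k => e (k, n)) v].
Proof.
have psil : linear (fun u : F => (- fglift c u, tel u) : M * F).
  by move=> a u v; congr (_, _); rewrite ?(linearP tel) // (linearP (fglift c)) opprD -scalerN.
have [psi psiE] := mk_linear psil.
pose G := range psi; have GS : submodule G := range_submodule psi.
pose pi : {linear (M * F)%type -> quotmod G} := quotmod_pi G.
have l1 : linear (fun m : M => (m, 0) : M * F).
  by move=> a x y; congr (_, _); rewrite //= scaler0 addr0.
have [i1 i1E] := mk_linear l1.
have l2 : linear (fun u : F => (0, u) : M * F).
  by move=> a x y; congr (_, _); rewrite //= scaler0 addr0.
have [i2 i2E] := mk_linear l2.
have piE m u : pi (m, u) = pi (i1 m) + pi (i2 u).
  by rewrite -linearD i1E i2E; congr (pi _); congr (_, _); rewrite /= ?addr0 ?add0r.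
have telE u : pi (i2 (tel u)) = pi (i1 (fglift c u)).
  apply/quotmod_piP/spanP => //; exists u => //.
  by rewrite psiE i1E i2E; congr (_, _); rewrite ?sub0r ?subr0.
exists (quotmod G), (pi \o i1), (fun k => pi (i2 << k >>)); split.
- move=> x y; rewrite /= !i1E => /quotmod_piP/spanP-/(_ GS)[u _].
  rewrite psiE => e.
  have u0 : u = 0 by apply: tel_inj; rewrite linear0; have := congr1 snd e; rewrite /= subrr.
  by apply: subr0_eq; have := congr1 fst e; rewrite /= u0 linear0 oppr0 => ->.
- move=> k n; rewrite -(linearZ_LR pi) -(linearZ_LR i2) -(linearB pi) -(linearB i2).
  by rewrite -tel1 telE fglift1.
- move=> C g x xE.
  have [||h hE] := @factor_surj _ _ _ _ pi (g \o fst \+ (fglift x \o snd)).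
  + exact: quotmod_pi_surj.
  + move=> _ /quotmod_eq0/spanP-/(_ GS)[u _ <-]; rewrite psiE /= linearN.
    apply/eqP; rewrite addrC subr_eq0; apply/eqP.
    apply: (freeg_linear_ext (g := fglift x \o tel) (h := g \o fglift c)) => -[k n].
    by rewrite /= tel1 (linearB (fglift x)) (linearZ_LR (fglift x)) /= !fglift1.
  exists h; split=> [m|k]; first by rewrite /= hE /= i1E linear0 addr0.
  by rewrite hE /= i2E linear0 add0r fglift1.
move=> y; have [[m u] <-] := quotmod_pi_surj y.
have [n [v [w ->]]] := level_normal u.
exists n, v, (m + fglift c w); rewrite -/pi piE (linearD i2) (linearD pi) telE /=.
rewrite (linearD i1) (linearD pi) -addrA.
congr (_ + _); rewrite addrC; congr (_ + _).
apply: (freeg_linear_ext (g := pi \o i2 \o level n) (h := fglift _)) => k.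
by rewrite /= level1 fglift1.
Qed.

End Telescope.

Section Contraadjusted.
Variable R : comNzRingType.
Implicit Types C M : lmodType R.

Lemma loc_tel (r : R) :
  short_exact (tel unit r) (fglift (fun k : unit * nat => frac r 1 k.2)).
Proof.
have fE n (v : {freeg unit / R}) :
    fglift (fun _ : unit => frac r 1 n) v = frac r (coeff tt v) n.
  elim/freeg_ind: v => [|u v eu ev|a u eu|[]].
  - by rewrite linear0 coeff0; apply: frac_eq; rewrite !mul0r.
  - rewrite [LHS]linearD [X in X + _]eu [X in _ + X]ev fracD coeffD.
    by apply: frac_eq; rewrite exprD; ring.
  - transitivity (a *: fglift (fun _ : unit => frac r 1 n) u); first exact: linearZ_LR.
    by rewrite eu fracZ coeffZ.
  by rewrite fglift1 coeffU eqxx mulr1.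
apply: tel_exact => /= [_ n|x|n v].
- by rewrite fracZ; apply: frac_eq; rewrite exprS; ring.
- have [a [n ->]] := frac_surj x; exists n, << a *g tt >>.
  by rewrite fE coeffU eqxx mulr1.
rewrite fE => /fracP[k]; rewrite expr0 mul0r mulr0 mulr1 => rk.
by exists k; apply: freeg_coeff0 => -[]; rewrite coeffZ.
Qed.

Lemma contraadjustedP C : contraadjusted C <-> forall r, solvable r C.
Proof.
split=> [Cc r c|rC r]; last exact: (ext1_tel (loc_tel r)).
have [v vE] := ext1_extend (Cc r) (loc_tel r) (fglift (fun k => c k.2)).
exists (fun n => v << (tt, n) >>) => n.
by rewrite -(linearZ_LR v) -(linearB v) -tel1 vE /= fglift1.
Qed.

End Contraadjusted.

(** * Noetherian domains and Krull's principal ideal theorem *)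

Section Ideals.
Variable R : idomainType.
Implicit Types I J P Q L H : set R.

Lemma SpecP P :
  Spec R P <-> [/\ is_ideal P, ~ P 1 & forall a b, P (a * b) -> P a \/ P b].
Proof.
split=> [[[P0 P1 PD] Pp]|[[P0 PD PM] P1 Pp]].
  have PD' a x y : P x -> P y -> P (a * x + y).
    by move=> /mem_set Px /mem_set Py; apply/set_mem/PD.
  split; last 1 first.
  - by move=> a b /mem_set /Pp /orP[] /set_mem; [left|right].
  - split=> [|x y Px Py|a x Px]; first exact: set_mem.
      by rewrite -[x]mul1r; apply: PD'.
    by rewrite -[a * x]addr0; apply: PD' => //; apply: set_mem.
  by move=> /mem_set; apply/negP.
split; first split.
- exact: mem_set.
- by apply/negP => /set_mem.
- by move=> a x y /set_mem Px /set_mem Py; apply/mem_set/PD/Py/PM.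
by move=> a b /set_mem /Pp[] /mem_set ->; rewrite ?orbT.
Qed.

Lemma ideal_prime P : Spec R P -> is_ideal P. Proof. by case/SpecP. Qed.
Lemma prime1 P : Spec R P -> ~ P 1. Proof. by case/SpecP. Qed.

Lemma primeM P a b : Spec R P -> P (a * b) -> P a \/ P b.
Proof. by case/SpecP => _ _; apply. Qed.

Lemma ideal0 I : is_ideal I -> I 0. Proof. by case. Qed.
Lemma idealD I x y : is_ideal I -> I x -> I y -> I (x + y).
Proof. by case=> _ + _; apply. Qed.
Lemma idealMl I a x : is_ideal I -> I x -> I (a * x).
Proof. by case=> _ _; apply. Qed.
Lemma idealMr I a x : is_ideal I -> I x -> I (x * a).
Proof. by rewrite mulrC; apply: idealMl. Qed.
Lemma idealN I x : is_ideal I -> I x -> I (- x).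
Proof. by rewrite -mulN1r; apply: idealMl. Qed.
Lemma idealB I x y : is_ideal I -> I x -> I y -> I (x - y).
Proof. by move=> Ii Ix Iy; apply: idealD => //; apply: idealN. Qed.
Lemma idealDr I x y : is_ideal I -> I y -> I (x + y) -> I x.
Proof. by move=> Ii Iy Ixy; rewrite -(addrK y x); apply: idealB. Qed.
Lemma ideal1 I : is_ideal I -> I 1 -> I = setT.
Proof. by move=> Ii I1; apply/seteqP; split=> x // _; rewrite -[x]mulr1; apply: idealMl. Qed.

Definition adjoin I a : set R := [set x | exists i b, I i /\ x = i + b * a].

Lemma adjoin_ideal I a : is_ideal I -> is_ideal (adjoin I a).
Proof.
move=> Ii; split=> [|_ _ [i [b [Ii' ->]]] [j [c [Ij ->]]]|c _ [i [b [Ii' ->]]]].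
- by exists 0, 0; split; [apply: ideal0|rewrite mul0r addr0].
- by exists (i + j), (b + c); split; [apply: idealD|ring].
by exists (c * i), (c * b); split; [apply: idealMl|ring].
Qed.

Lemma sub_adjoin I a : I `<=` adjoin I a.
Proof. by move=> x Ix; exists x, 0; split=> //; rewrite mul0r addr0. Qed.

Lemma mem_adjoin I a : is_ideal I -> adjoin I a a.
Proof. by move=> Ii; exists 0, 1; split; [apply: ideal0|rewrite mul1r add0r]. Qed.

Lemma adjoin_sub I J a : is_ideal J -> I `<=` J -> J a -> adjoin I a `<=` J.
Proof.
by move=> Ji IJ Ja _ [i [b [/IJ Ji' ->]]]; apply: idealD => //; apply: idealMl.
Qed.

Lemma adjoin_mono I J a : I `<=` J -> adjoin I a `<=` adjoin J a.
Proof. by move=> IJ _ [i [b [/IJ Ji ->]]]; exists i, b. Qed.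

Lemma adjoin_proper I a : is_ideal I -> ~ I a -> I `<` adjoin I a.
Proof.
move=> Ii Ia; split; first exact: sub_adjoin.
by move=> h; apply/Ia/h/mem_adjoin.
Qed.

Definition principal a : set R := [set x | exists b, x = b * a].

Lemma principal_ideal a : is_ideal (principal a).
Proof.
split=> [|_ _ [b ->] [c ->]|c _ [b ->]]; first by exists 0; rewrite mul0r.
  by exists (b + c); rewrite mulrDl.
by exists (c * b); rewrite mulrA.
Qed.

Lemma mem_principal a : principal a a. Proof. by exists 1; rewrite mul1r. Qed.

Lemma principal_sub I a : is_ideal I -> I a -> principal a `<=` I.
Proof. by move=> Ii Ia _ [b ->]; apply: idealMl. Qed.

Lemma zero_prime : Spec R [set 0].
Proof.
apply/SpecP; split=> [|/eqP|a b /eqP].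
- split=> // [x y -> ->|a x ->]; [exact: addr0|exact: mulr0].
- by rewrite oner_eq0.
by rewrite mulf_eq0 => /orP[] /eqP; [left|right].
Qed.

Section Noetherian.
Hypothesis noethR : noetherian R.

Lemma noeth_max (F : set (set R)) : F `<=` @is_ideal R -> F !=set0 ->
  exists M, F M /\ forall J, F J -> M `<=` J -> J `<=` M.
Proof.
move=> Fi [I0 FI0].
(* The empty set joins the family because the union of the empty chain has to belong to it. *)
have [C FC Ctot|M [FM Mmax]] := @Zorn_bigcup R [set A | F A \/ A = set0].
  have [[X CX]|C0] := pselect (exists X, C X /\ F X); last first.
    right; apply/seteqP; split=> // x [X CX Xx]; have [FX|X0] := FC _ CX.
      by case: C0; exists X.
    by move: Xx; rewrite X0.
  have [CX' FX] := CX.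
  pose U := \bigcup_(Y in C) Y.
  have Cid Y y : C Y -> Y y -> is_ideal Y.
    by move=> CY Yy; have [/Fi//|Y0] := FC _ CY; move: Yy; rewrite Y0.
  have Ui : is_ideal U.
    split=> [|x y [Y CY Yx] [Z CZ Zy]|a x [Y CY Yx]].
    - by exists X => //; apply: ideal0 (Fi _ FX).
    - have [YZ|ZY] := Ctot _ _ CY CZ.
        by exists Z => //; apply: idealD => //; [apply: Cid Zy|apply: YZ].
      by exists Y => //; apply: idealD => //; [apply: Cid Yx|apply: ZY].
    by exists Y => //; apply: idealMl => //; apply: Cid Yx.
  (* The union is finitely generated, so one member of the chain contains all generators. *)
  have [s sE] := noethR Ui.
  have sU x : x \in s -> U x by move=> xs; rewrite sE => J [_]; apply.
  have [Y [CY FY Ys]] : exists Y, [/\ C Y, F Y & forall x, x \in s -> Y x].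
    move: sU; clear sE; elim: s => [|x s IH] sU; first by exists X.
    have [|Y [CY FY Ys]] := IH; first by move=> y ys; apply: sU; rewrite inE ys orbT.
    have [|Z CZ Zx] := sU x; first by rewrite inE eqxx.
    have FZ : F Z by have [//|Z0] := FC _ CZ; move: Zx; rewrite Z0.
    have [YZ|ZY] := Ctot _ _ CY CZ.
      by exists Z; split=> // y; rewrite inE => /orP[/eqP->//|/Ys/YZ].
    by exists Y; split=> // y; rewrite inE => /orP[/eqP->|/Ys//]; apply: ZY.
  have -> : \bigcup_(Z in C) Z = Y.
    apply/seteqP; split=> [x|x Yx]; last by exists Y.
    by rewrite -/U => Ux; move: Ux; rewrite sE; apply; split=> //; apply: Fi.
  by left.
have FM' : F M.
  case: FM => // M0; case: (Mmax I0); last by left.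
  rewrite M0; split=> // I00; have := ideal0 (Fi _ FI0); exact: I00.
exists M; split=> // J FJ MJ; apply: contrapT => JM.
by apply: (Mmax J); [split|left].
Qed.

Lemma noeth_ind (S : set R -> Prop) :
  (forall I, is_ideal I -> (forall J, is_ideal J -> I `<` J -> S J) -> S I) ->
  forall I, is_ideal I -> S I.
Proof.
move=> IH I Ii; apply: contrapT => SI.
have [J [Ji _]//||M [[Mi SM] Mmax]] := @noeth_max [set J | is_ideal J /\ ~ S J].
  by exists I.
apply: SM; apply: IH => // J Ji [MJ JM]; apply: contrapT => SJ.
by apply: JM; apply: Mmax.
Qed.

(** Noetherian induction: a proper ideal that is not prime contains a product a b with a and b
    outside, and adjoining either gives a larger ideal. Statements on all ideals are reduced to
    primes in this way throughout. *)
Lemma prime_ind (S : set R -> Prop) : S setT -> (forall P, Spec R P -> S P) ->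
  (forall I a b, is_ideal I -> I (a * b) ->
     S (adjoin I a) -> S (adjoin I b) -> S I) ->
  forall I, is_ideal I -> S I.
Proof.
move=> ST SP Sab; apply: noeth_ind => I Ii IH.
have [/(ideal1 Ii)->//|I1] := pselect (I 1).
have [/SP//|nP] := pselect (Spec R I).
have [[a [b [Iab Ia Ib]]]|h] := pselect (exists a b, [/\ I (a * b), ~ I a & ~ I b]).
  by apply: (Sab I a b) => //; apply: IH; [apply: adjoin_ideal|apply: adjoin_proper
    |apply: adjoin_ideal|apply: adjoin_proper].
case: nP; apply/SpecP; split=> // a b Iab.
have [|Ia] := pselect (I a); first by left.
by right; apply: contrapT => Ib; apply: h; exists a, b.
Qed.

Lemma proper_sub_prime I : is_ideal I -> ~ I 1 -> exists P, Spec R P /\ I `<=` P.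
Proof.
move: I; apply: prime_ind => [h|P Pp _|I a b Ii Iab Sa Sb I1]; first by case: h.
  by exists P; split.
have [a1|/Sa[P [Pp aP]]] := pselect (adjoin I a 1); last first.
  by exists P; split=> //; apply: subset_trans aP; apply: sub_adjoin.
have [b1|/Sb[P [Pp bP]]] := pselect (adjoin I b 1); last first.
  by exists P; split=> //; apply: subset_trans bP; apply: sub_adjoin.
case: I1; case: a1 b1 => i [c [Ic e1]] [j [d [Jd e2]]].
rewrite -[1]mul1r {1}e1 {1}e2.
have -> : (i + c * a) * (j + d * b) = (j + d * b) * i + (c * a * j + c * d * (a * b)).
  by ring.
by apply: idealD => //; [apply: idealMl|apply: idealD => //; apply: idealMl].
Qed.

(** A prime over I contains a or b, so the lists for the two larger ideals are concatenated. *)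
Lemma finite_min_primes I : is_ideal I ->
  exists l : seq (set R), (forall P, List.In P l -> Spec R P /\ I `<=` P) /\
    forall P, Spec R P -> I `<=` P -> exists Q, List.In Q l /\ Q `<=` P.
Proof.
move: I; apply: prime_ind => [|P Pp|I a b Ii Iab [l [lP lmin]] [k [kP kmin]]].
- by exists [::]; split=> // P Pp TP; case: (prime1 Pp); apply: TP.
- exists [:: P]; split=> [Q [<-|[]]|Q Qp PQ]; first by split.
  by exists P; split=> //; left.
exists (l ++ k); split=> [P /List.in_app_iff[/lP|/kP] [Pp aP]|P Pp IP].
- by split=> //; apply: subset_trans aP; apply: sub_adjoin.
- by split=> //; apply: subset_trans aP; apply: sub_adjoin.
have Pi := ideal_prime Pp.
have [Pa|Pb] := primeM Pp (IP _ Iab).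
  have [|Q [Ql QP]] := lmin P Pp; first exact: adjoin_sub.
  by exists Q; split=> //; apply/List.in_app_iff; left.
have [|Q [Ql QP]] := kmin P Pp; first exact: adjoin_sub.
by exists Q; split=> //; apply/List.in_app_iff; right.
Qed.

Lemma list_min (l : seq (set R)) P : exists Q,
  [/\ Q = P \/ List.In Q l, Q `<=` P &
      forall Q', List.In Q' l -> Q' `<=` Q -> Q' = Q].
Proof.
elim: l P => [|A l IH] P; first by exists P; split=> //; left.
have [AP|AP] := pselect (A `<=` P).
  have [Q [Ql QA Qmin]] := IH A; exists Q; split.
  - by right; case: Ql => [->|]; [left|right].
  - exact: subset_trans AP.
  by move=> Q' [<- AQ|]; [apply/seteqP|apply: Qmin].
have [Q [Ql QP Qmin]] := IH P; exists Q; split=> //.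
  by case: Ql => [->|]; [left|right; right].
by move=> Q' [<- AQ|]; [case: AP; apply: subset_trans QP|apply: Qmin].
Qed.

(** * Contraction from localizations and Krull's principal ideal theorem *)

Definition minimal_over P I : Prop :=
  forall Q, Spec R Q -> I `<=` Q -> Q `<=` P -> Q = P.

Lemma min_prime_below I P : is_ideal I -> Spec R P -> I `<=` P ->
  exists Q, [/\ Spec R Q, I `<=` Q, Q `<=` P & minimal_over Q I].
Proof.
move=> Ii Pp IP; have [l [lP lmin]] := finite_min_primes Ii.
have [Q0 [Q0l Q0P]] := lmin P Pp IP.
have [Q [Ql QQ0 Qmin]] := list_min l Q0.
have Ql' : List.In Q l by case: Ql => [->|].
have [Qp IQ] := lP _ Ql'; exists Q; split=> //; first exact: subset_trans Q0P.
move=> Q' Q'p IQ' Q'Q; have [Q'' [Q''l Q''Q']] := lmin Q' Q'p IQ'.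
have e : Q'' = Q by apply: Qmin => //; apply: subset_trans Q'Q.
by apply/seteqP; split=> //; rewrite -e.
Qed.

(** For a prime P this is the contraction of I R_P to R. Ideals of the local ring R_P are
    represented below by the ideals that contain their own [sat P]. *)
Definition sat P I : set R := [set y | exists t, ~ P t /\ I (t * y)].

Lemma sat_ideal P I : Spec R P -> is_ideal I -> is_ideal (sat P I).
Proof.
move=> Pp Ii; split=> [|x y [t [Pt Ix]] [u [Pu Iy]]|a x [t [Pt Ix]]].
- by exists 1; split; [apply: prime1|rewrite mul1r; apply: ideal0].
- exists (t * u); split; first by move=> /(primeM Pp)[].
  have -> : t * u * (x + y) = u * (t * x) + t * (u * y) by ring.
  by apply: idealD => //; apply: idealMl.
by exists t; split=> //; rewrite mulrCA; apply: idealMl.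
Qed.

Lemma sub_sat P I : Spec R P -> I `<=` sat P I.
Proof. by move=> Pp x Ix; exists 1; split; [apply: prime1|rewrite mul1r]. Qed.

Lemma sat_sat P I : Spec R P -> sat P (sat P I) `<=` sat P I.
Proof.
move=> Pp x [t [Pt [u [Pu Ix]]]]; exists (u * t).
by split; [move=> /(primeM Pp)[]|rewrite -mulrA].
Qed.

Lemma sat_mono P I J : I `<=` J -> sat P I `<=` sat P J.
Proof. by move=> IJ x [t [Pt /IJ]]; exists t. Qed.

Lemma sat_antimono P Q I : Q `<=` P -> sat P I `<=` sat Q I.
Proof. by move=> QP x [t [Pt It]]; exists t; split=> // /QP. Qed.

(** A maximal annihilator of a nonzero element of R / I is prime. It contains I and, I being
    contracted from R_P, lies in P; minimality makes it equal to P. *)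
Lemma assoc_prime P I : is_ideal I -> Spec R P -> sat P I `<=` I ->
  minimal_over P I -> ~ I 1 -> exists a, ~ I a /\ forall x, I (x * a) <-> P x.
Proof.
move=> Ii Pp satI Pmin I1.
pose ann a := [set x | I (x * a)].
have ann_ideal a : is_ideal (ann a).
  split=> [|x y Ix Iy|c x Ix]; rewrite /ann /=.
  - by rewrite mul0r; apply: ideal0.
  - by rewrite mulrDl; apply: idealD.
  by rewrite -mulrA; apply: idealMl.
have [_ [a [Ia ->]]||_ [[a [Ia ->]] amax]] :=
    @noeth_max [set J | exists a, ~ I a /\ J = ann a].
- exact: ann_ideal.
- by exists (ann 1); exists 1.
exists a; split=> // x; suff -> : P = ann a by [].
symmetry; apply: Pmin.
- apply/SpecP; split=> //; first by rewrite /ann /= mul1r.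
  move=> b c Ibc; have [|nc] := pselect (ann a c); first by right.
  left; apply: (amax (ann (c * a))).
  + by exists (c * a).
  + by move=> y Iy; rewrite /ann /= mulrCA; apply: idealMl.
  by rewrite /ann /= mulrA.
- by move=> y Iy; apply: idealMr.
move=> y Iy; apply: contrapT => Py; apply: Ia; apply: satI; by exists y.
Qed.

(** In substance, R_P / I R_P is artinian. By noetherian induction on I, with a from [assoc_prime]:
    the contractions of J_n + a R become stationary, and so does the truth of a in J_n. *)
Lemma sat_dcc P I : Spec R P -> is_ideal I -> sat P I `<=` I -> minimal_over P I ->
  forall J : nat -> set R, (forall n, is_ideal (J n)) -> (forall n, I `<=` J n) ->
  (forall n, sat P (J n) `<=` J n) -> (forall n, J n.+1 `<=` J n) ->
  exists N, forall n, (N <= n)%N -> J N `<=` J n.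
Proof.
move=> Pp Ii; move: I Ii; apply: noeth_ind => I Ii IH satI Pmin J Ji IJ satJ Jdec.
have Jdec' m n : (m <= n)%N -> J n `<=` J m.
  move=> /subnKC <-; elim: (n - m)%N => [|k IHk]; first by rewrite addn0.
  by rewrite addnS; apply: subset_trans IHk.
have [I1|I1] := pselect (I 1).
  by exists 0%N => n _ x _; rewrite (ideal1 (Ji n) (IJ n _ I1)).
have [a [Ia annP]] := assoc_prime Ii Pp satI Pmin I1.
have sI A : is_ideal A -> is_ideal (sat P (adjoin A a)).
  by move=> Ai; apply/sat_ideal/adjoin_ideal.
have II' A : is_ideal A -> A `<=` sat P (adjoin A a).
  by move=> Ai; apply: subset_trans (sub_sat Pp); apply: sub_adjoin.
have aI' A : is_ideal A -> sat P (adjoin A a) a by move=> Ai; apply/sub_sat/mem_adjoin.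
have [||||||N1 HN1] := IH (sat P (adjoin I a)) (sI I Ii) _ _ _
    (fun n => sat P (adjoin (J n) a)) (fun n => sI _ (Ji n)).
- by split; [exact: II'|move=> h; apply/Ia/h/aI'].
- exact: sat_sat.
- by move=> Q Qp aQ; apply: Pmin => //; apply: subset_trans aQ; apply: II'.
- by move=> n; apply: sat_mono; apply: adjoin_mono.
- by move=> n; apply: sat_sat.
- by move=> n; apply: sat_mono; apply: adjoin_mono.
have [N2 HN2] : exists N, forall n, (N <= n)%N -> J N a -> J n a.
  have [|/existsNP[N Na]] := pselect (forall n, J n a); first by exists 0%N.
  by exists N.
exists (maxn N1 N2) => n nN y Jy.
have [N1n N2n] : (N1 <= n)%N /\ (N2 <= n)%N by apply/andP; rewrite -geq_max.
have [t [Pt [j [r [Jj e]]]]] : sat P (adjoin (J n) a) y.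
  by apply: HN1 => //; apply: II' => //; apply: Jdec' Jy; apply: leq_maxl.
apply: (satJ n); exists t; split=> //; rewrite e; apply: idealD => //.
(* If r is in P then r a is in I. Otherwise r is a unit at P, so a lies in the earlier term of the
   chain and hence in [J n]. *)
have [Pr|Pr] := pselect (P r); first by apply: IJ; apply/annP.
apply: idealMl => //; apply: HN2 => //; apply: (Jdec' _ (maxn N1 N2)); first exact: leq_maxr.
apply: (satJ (maxn N1 N2)); exists r; split=> //; apply: (@idealDr _ _ j) => //.
  by apply: Jdec' Jj.
by rewrite addrC -e; apply: idealMl.
Qed.

(* Krull's principal ideal theorem: the chain J_n + xR, where J_n is the
   contraction of s^n R_Q, becomes stationary locally at P, so that
   J_n = J_(n+1) by Nakayama and s is a unit of R_Q. *)
Lemma krull_principal P Q x s : Spec R P -> P x -> minimal_over P (principal x) ->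
  Spec R Q -> Q `<=` P -> Q s -> s != 0 -> Q = P.
Proof.
move=> Pp Px Pmin Qp QP Qs s0; apply: contrapT => QneP.
have Qx : ~ Q x.
  by move=> Qx; apply: QneP; apply: Pmin => //; apply: principal_sub => //; apply: ideal_prime.
have [[Pi Qi] P1] := (ideal_prime Pp, ideal_prime Qp, prime1 Pp).
pose J n := sat Q (principal (s ^+ n)).
have Ji n : is_ideal (J n) by apply/sat_ideal/principal_ideal.
have satJ n : sat P (J n) `<=` J n.
  by apply: subset_trans (sat_antimono QP) _; apply: sat_sat.
have Jdec n : J n.+1 `<=` J n.
  by apply: sat_mono => _ [b ->]; exists (b * s); rewrite exprS mulrA.
pose J' n := sat P (adjoin (J n) x).
have [|||||||N HN] := @sat_dcc P (sat P (principal x)) Pp _ _ _ J'.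
- exact/sat_ideal/principal_ideal.
- exact: sat_sat.
- by move=> Q' Q'p xQ'; apply: Pmin => //; apply: subset_trans xQ'; apply: sub_sat.
- by move=> n; apply/sat_ideal/adjoin_ideal.
- move=> n; apply: sat_mono; apply: principal_sub; first exact: adjoin_ideal.
  exact: mem_adjoin.
- by move=> n; apply: sat_sat.
- by move=> n; apply: sat_mono; apply: adjoin_mono.
have step y : J N y -> exists t j r, [/\ ~ P t, J N.+1 j, J N r & t * y = j + r * x].
  move=> Jy; have [t [Pt [j [r [Jj e]]]]] : J' N.+1 y.
    by apply: HN => //; apply: sub_sat => //; apply: sub_adjoin.
  (* r x lies in [J N] and x is outside Q, so r lies in [J N]. *)
  exists t, j, r; split=> //; apply: (@sat_sat Q _ Qp); exists x; split=> //.
  apply: (idealDr (Ji N) (Jdec _ _ Jj)).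
  by rewrite mulrC addrC -e; apply: idealMl.
have JN : J N `<=` J N.+1.
  apply: contrapT => nJ.
  (* Nakayama's lemma by maximality: H is a largest contracted ideal strictly below [J N] that
     contains [J N.+1], and this forces x z into H for all z in [J N]. *)
  have [|| H [[Hi JH HJ satH neH] Hmax]] := @noeth_max [set H |
      [/\ is_ideal H, J N.+1 `<=` H, H `<=` J N, sat P H `<=` H & ~ J N `<=` H]].
  - by move=> H [].
  - by exists (J N.+1); split=> //.
  have xH z : J N z -> H (z * x).
    move=> Jz; apply: contrapT => Hzx.
    pose H' := sat P (adjoin H (z * x)).
    have HH' : H `<=` H' by apply: subset_trans (sub_sat Pp); apply: sub_adjoin.
    have [|h] := pselect (J N `<=` H').
      move=> /(_ _ Jz)[t [Pt [h [r [Hh e]]]]].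
      have Hz : H z.
        apply: satH; exists (t - r * x); split.
          by move=> /(idealDr Pi (idealN Pi (idealMl r Pi Px))).
        by have -> : (t - r * x) * z = h by rewrite mulrBl e; ring.
      by apply: Hzx; apply: idealMr.
    apply: Hzx; apply: (Hmax H') => //; last by apply/sub_sat/mem_adjoin.
    split=> //.
    + exact/sat_ideal/adjoin_ideal.
    + exact: subset_trans HH'.
    + apply: subset_trans (satJ N); apply: sat_mono; apply: adjoin_sub => //.
      exact: idealMr.
    exact: sat_sat.
  apply: neH => y /step[t [j [r [Pt Jj Jr e]]]]; apply: satH; exists t; split=> //.
  by rewrite e; apply: idealD => //; [apply: JH|apply: xH].
(* Here t s^N = b s^(N+1) with t outside Q; cancelling gives t = b s in Q. *)
have [t [Qt [b e]]] : J N.+1 (s ^+ N) by apply/JN/sub_sat/mem_principal.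
apply: Qt; have -> : t = b * s; last exact: idealMl.
by apply: (mulIf (expf_neq0 N s0)); rewrite e exprS mulrA.
Qed.

(** * Height one primes, prime avoidance and Goldman domains *)

Definition nonzero P : Prop := exists2 x, P x & x != 0.

Definition height1 P : Prop :=
  [/\ Spec R P, nonzero P & forall Q, Spec R Q -> nonzero Q -> Q `<=` P -> Q = P].

(** By Krull's theorem a minimal prime over x has height one. *)
Lemma height1_between P x : Spec R P -> P x -> x != 0 ->
  exists Q, [/\ height1 Q, Q x & Q `<=` P].
Proof.
move=> Pp Px x0.
have [|Q [Qp xQ QP Qmin]] := min_prime_below (principal_ideal x) Pp.
  by apply: principal_sub => //; apply: ideal_prime.
have Qx : Q x by apply/xQ/mem_principal.
exists Q; split=> //; split=> //; first by exists x.
by move=> Q' Q'p [s Q's s0] Q'Q; apply: krull_principal Qx Qmin _ _ Q's s0.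
Qed.

(** If the element x found for the tail lies in P, add to it some y in I that lies in every prime of
    the tail but not in P. *)
Lemma prime_avoidance I (l : seq (set R)) : is_ideal I ->
  (forall P, List.In P l -> Spec R P /\ ~ I `<=` P) ->
  (forall P Q, List.In P l -> List.In Q l -> P `<=` Q -> P = Q) ->
  exists x, I x /\ forall P, List.In P l -> ~ P x.
Proof.
move=> Ii; elim: l => [|P l IH] lP anti; first by exists 0; split=> //; apply: ideal0.
have [||x [Ix lx]] := IH.
- by move=> Q Ql; apply: lP; right.
- by move=> Q Q' Ql Q'l; apply: anti; right.
have [Px|Px] := pselect (P x); last first.
  by exists x; split=> // Q [<-//|]; apply: lx.
have Pl : ~ List.In P l by move=> /lx.
have [Pp /existsNP[y0 /not_implyP[Iy0 Py0]]] := lP P (or_introl erefl).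
have [y [Iy Py ly]] : exists y, [/\ I y, ~ P y & forall Q, List.In Q l -> Q y].
  have : forall Q, List.In Q l -> is_ideal Q /\ ~ Q `<=` P.
    move=> Q Ql; split; first by apply/ideal_prime; have [] := lP Q (or_intror Ql).
    by move=> QP; apply: Pl; rewrite -(anti Q P) //; [right|left].
  elim: (l) => [|Q k IHk] kQ; first by exists y0.
  have [|y [Iy Py ky]] := IHk; first by move=> Q' Q'k; apply: kQ; right.
  have [Qi /existsNP[z /not_implyP[Qz Pz]]] := kQ Q (or_introl erefl).
  exists (z * y); split; first exact: idealMl.
    by move=> /(primeM Pp)[].
  move=> Q' [<-|Q'k]; first exact: idealMr.
  by apply: idealMl; [have [] := kQ Q' (or_intror Q'k)|apply: ky].
exists (x + y); split=> [|Q [<-|Ql]].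
- exact: idealD.
- by rewrite addrC => /(idealDr (ideal_prime Pp) Px).
have [Qp _] := lP Q (or_intror Ql).
by move=> /(idealDr (ideal_prime Qp) (ly Q Ql)); apply: lx.
Qed.

Definition goldman : Prop :=
  exists s : R, s != 0 /\ forall P, Spec R P -> nonzero P -> P s.

(** Height one primes are minimal over s, hence finite in number. A nonzero prime of larger height
    would by avoidance contain an x outside all of them, against [height1_between]. *)
Lemma goldman_finite_spec : goldman -> finite_set (Spec R) /\ krull_dim_le R 1.
Proof.
move=> [s [s0 sP]].
have [l [lP lmin]] := finite_min_primes (principal_ideal s).
pose l1 := [seq P <- l | `[< height1 P >]].
have l1P P : List.In P l1 <-> height1 P.
  split=> [/List.filter_In[_ /asboolP]//|hP]; apply/List.filter_In; split; last exact/asboolP.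
  have [Pp Pn Pmin] := hP.
  have [|Q [Ql QP]] := lmin P Pp.
    by apply: principal_sub; [apply: ideal_prime|apply: sP].
  have [Qp sQ] := lP _ Ql; rewrite -(Pmin Q) //.
  by exists s => //; apply/sQ/mem_principal.
have h1 P : Spec R P -> nonzero P -> height1 P.
  move=> Pp Pn; apply: contrapT => Ph.
  have [||x [Px lx]] := @prime_avoidance P l1 (ideal_prime Pp).
  - move=> Q /l1P hQ; have [Qp Qn Qmin] := hQ; split=> // PQ.
    by apply: Ph; rewrite (Qmin P).
  - by move=> Q Q' /l1P[Qp Qn _] /l1P[_ _]; apply.
  have x0 : x != 0.
    apply/eqP => x0; have [y Py y0] := Pn.
    have [Q [hQ Qy _]] := height1_between Pp Py y0.
    apply: (lx Q); first exact/l1P.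
    by rewrite x0; apply: ideal0; apply: ideal_prime; case: hQ.
  have [Q [hQ Qx _]] := height1_between Pp Px x0.
  by apply: (lx Q) => //; apply/l1P.
split.
  have : Spec R `<=` [set P | List.In P ([set 0] :: l1)].
    move=> P Pp; have [/h1 hP|nP] := pselect (nonzero P).
      by right; apply/l1P/hP.
    left; apply/seteqP; split=> [x ->|x Px]; first exact: ideal0 (ideal_prime Pp).
    by apply: contrapT => /eqP x0; apply: nP; exists x.
  move=> /sub_finite_set; apply; elim: ([set 0] :: l1) => [|P k IHk] /=.
    have -> : [set _ : set R | False] = set0 by apply/seteqP; split.
    exact: finite_set0.
  have -> : [set Q | P = Q \/ List.In Q k] = [set P] `|` [set Q | List.In Q k].
    by apply/seteqP; split=> Q [e|e]; rewrite /= ?e; by [left|right].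
  by rewrite finite_setU; split=> //; exact: finite_set1.
move=> m P Pp Plt; rewrite leqNgt; apply/negP => m2.
have n0 i : (0 < i <= m)%N -> nonzero (P i).
  case: i => // i /andP[_ im]; have [PP /existsNP[x /not_implyP[Px nPx]]] := Plt i im.
  exists x => //; apply/eqP => x0; apply: nPx; rewrite x0.
  exact: ideal0 (ideal_prime (Pp i (ltnW im))).
have [_ _ P2] := h1 _ (Pp 2 m2) (n0 2 m2).
have [P12 P21] := Plt 1%N m2.
have e : P 1%N = P 2%N.
  by apply: P2 => //; [exact: Pp (ltnW m2)|apply: (n0 1%N); exact: ltnW m2].
by apply: P21; rewrite e.
Qed.

End Noetherian.

End Ideals.

(** * The fraction field as a module *)

(** A synonym of the fraction field that carries the structure of an R-module beside that of a
    field. *)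
Definition Qmod (R : idomainType) : Type := {fraction R}.
HB.instance Definition _ (R : idomainType) := GRing.Field.on (Qmod R).

Section FractionModule.
Variable R : idomainType.
Local Notation "a %:F" := (tofrac a : Qmod R).

Definition Qscale (a : R) (q : Qmod R) : Qmod R := a%:F * q.

Lemma QscaleA a b q : Qscale a (Qscale b q) = Qscale (a * b) q.
Proof. by rewrite /Qscale tofracM mulrA. Qed.
Lemma Qscale1 : left_id 1 Qscale.
Proof. by move=> q; rewrite /Qscale tofrac1 mul1r. Qed.
Lemma QscaleDr : right_distributive Qscale +%R.
Proof. by move=> a x y; rewrite /Qscale mulrDr. Qed.
Lemma QscaleDl q : {morph Qscale^~ q : a b / a + b}.
Proof. by move=> a b; rewrite /Qscale tofracD mulrDl. Qed.

HB.instance Definition _ := GRing.Zmodule_isLmodule.Build R (Qmod R)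
  QscaleA Qscale1 QscaleDr QscaleDl.

Lemma QscaleE (a : R) (q : Qmod R) : a *: q = a%:F * q.
Proof. by []. Qed.

Lemma tofrac_neq0 (a : R) : a != 0 -> a%:F != 0.
Proof. by rewrite tofrac_eq0. Qed.

Lemma Qmod_frac (q : Qmod R) : exists a b, b != 0 /\ q = a%:F / b%:F.
Proof.
pose x : {ratio R} := repr (q : {fraction R}).
have x0 := denom_ratioP x.
exists \n_x, \d_x; split=> //.
apply: (mulIf (tofrac_neq0 x0)); rewrite divfK ?tofrac_neq0 //.
have -> : q = \pi_({fraction R}) x by rewrite reprK.
unlock tofrac; rewrite -[LHS]FracField.pi_mul.
apply/eqP; rewrite FracField.equivf_def /FracField.mulf.
rewrite !numden_Ratio ?mulf_neq0 ?oner_eq0 //.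
by apply/eqP; ring.
Qed.

Lemma Qmod_torsion_free (a : R) (q : Qmod R) : a != 0 -> a *: q = 0 -> q = 0.
Proof. by move=> a0 /eqP; rewrite QscaleE mulf_eq0 tofrac_eq0 (negPf a0) => /eqP. Qed.

Lemma QscaleVK (a : R) (q : Qmod R) : a != 0 -> a *: ((a%:F)^-1 * q : Qmod R) = q.
Proof. by move=> a0; rewrite QscaleE mulrA divff ?mul1r ?tofrac_neq0. Qed.

Lemma Qmod_divisible (a : R) (q : Qmod R) : a != 0 -> exists q', a *: q' = q.
Proof. by move=> a0; exists ((a%:F)^-1 * q); apply: QscaleVK. Qed.

End FractionModule.

(** * Bases over residue fields and flatness of the fraction field *)

Section IndependentFamilies.
Variable R : idomainType.

(** For a prime p that kills V, an [independent] and [spanning] family gives a basis of V_p over the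
    residue field of p: over the fraction field if p = 0, over R/p if p is maximal. *)
Definition independent (p : set R) (V : lmodType R) (K : choiceType) (t : K -> V) :=
  forall u : {freeg K / R}, fglift t u = 0 -> forall k, p (coeff k u).

Definition spanning (p : set R) (V : lmodType R) (K : choiceType) (t : K -> V) :=
  forall x : V, exists r u, ~ p r /\ r *: x = fglift t u.

Lemma max_independent (p : set R) (V : lmodType R) :
  Spec R p -> (forall r (x : V), p r -> r *: x = 0) ->
  exists (K : choiceType) (t : K -> V), independent p t /\ spanning p t.
Proof.
move=> pp pV; have pi := ideal_prime pp.
pose supp (T : set V) (u : {freeg V / R}) := forall x, ~ T x -> coeff x u = 0.
pose ind T := forall u, supp T u -> fglift id u = 0 -> forall x, p (coeff x u).
(* A relation has finite support, so a relation on the union of a nonempty chain lives on one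
   member. *)
have [C Cind Ctot|T [Tind Tmax]] := @Zorn_bigcup V ind.
  move=> u uC u0 x.
  have [[X [CX uX]]|allC] := pselect (exists X, C X /\ supp X u).
    exact: (Cind X CX u uX u0).
  suff : [set` dom u] `<=` set0.
    move=> d0; have -> : coeff x u = 0; last exact: ideal0.
    by apply/coeff_outdom/negP => /d0.
  move=> y0 yu; apply: allC.
  suff [X [CX Xd]] : exists X, C X /\ forall y, y \in dom u -> X y.
    exists X; split=> // y Xy; apply/coeff_outdom/negP => /Xd //.
  have Cd y : y \in dom u -> exists X, C X /\ X y.
    rewrite mem_dom => /eqP yu'; apply: contrapT => nC; apply: yu'; apply: uC.
    by move=> [X CX Xy]; apply: nC; exists X.
  have [X0 [CX0 _]] := Cd _ yu.
  elim: (dom u) Cd => [|y s IH] Cd; first by exists X0.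
  have [|X [CX Xs]] := IH; first by move=> z zs; apply: Cd; rewrite inE zs orbT.
  have [|Y [CY Yy]] := Cd y; first by rewrite inE eqxx.
  have [XY|YX] := Ctot _ _ CX CY.
    by exists Y; split=> // z; rewrite inE => /orP[/eqP->//|/Xs/XY].
  by exists X; split=> // z; rewrite inE => /orP[/eqP->|/Xs//]; apply: YX.
pose K : choiceType := {x : V | x \in T}.
(* [io] and [back] pass between the free modules on T and on V. *)
pose io : {linear {freeg K / R} -> {freeg V / R}} :=
  fglift (fun k : K => << val k >> : {freeg V / R}).
pose back : {linear {freeg V / R} -> {freeg K / R}} :=
  fglift (fun x : V => if insub x is Some k then << k >> else 0 : {freeg K / R}).
have coeff_io k v : coeff (val k) (io v) = coeff k v.
  elim/freeg_ind: v => [|u v eu ev|a u eu|l]; first by rewrite linear0 !coeff0.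
  - by rewrite linearD !coeffD eu ev.
  - by rewrite (linearZ_LR io) !coeffZ eu.
  by rewrite [io _]fglift1 !coeffU (inj_eq val_inj).
have io_supp v : supp T (io v).
  move=> x Tx; elim/freeg_ind: v => [|u v eu ev|a u eu|l]; first by rewrite linear0 coeff0.
  - by rewrite linearD coeffD eu ev addr0.
  - by rewrite (linearZ_LR io) coeffZ eu mulr0.
  rewrite [io _]fglift1 coeffU; case: eqP => [e|]; last by rewrite mulr0.
  by case: Tx; rewrite -e; apply: set_mem; apply: valP.
have io_back u : supp T u -> io (back u) = u.
  move=> Tu; apply/eqP/freeg_eqP => x.
  suff : coeff x (io (back u)) = if x \in T then coeff x u else 0.
    by case: ifPn => // /negP xT ->; rewrite Tu // => /mem_set.
  elim/freeg_ind: (u) => [|v w ev ew|a v ev|y].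
  - by rewrite !linear0 !coeff0 if_same.
  - by rewrite !linearD !coeffD ev ew; case: ifP => // _; rewrite addr0.
  - by rewrite (linearZ_LR back) (linearZ_LR io) !coeffZ ev; case: ifP => // _; rewrite mulr0.
  have -> : back << y >> = if insub y is Some k then << k >> else 0 by exact: fglift1.
  case: insubP => [k yT ky|yT].
    rewrite [io _]fglift1 ky !coeffU; case: eqP => [<-|]; first by rewrite yT.
    by rewrite mulr0 if_same.
  rewrite linear0 coeff0 coeffU; case: eqP => [<-|]; first by rewrite (negPf yT).
  by rewrite mulr0 if_same.
have io_lift v : fglift (val : K -> V) v = fglift id (io v).
  apply: (freeg_linear_ext (g := fglift (val : K -> V)) (h := fglift id \o io)) => k.
  by rewrite /= !fglift1.
exists K, val; split=> [u u0 k|x].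
  by rewrite -coeff_io; apply: Tind; rewrite -?io_lift.
have [Tx|Tx] := pselect (T x).
  exists 1, << Sub x (mem_set Tx) >>; split; first exact: prime1.
  by rewrite scale1r fglift1.
have [Tx' TTx] : T `<` (T `|` [set x]) /\ ~ ind (T `|` [set x]).
  suff Tx' : T `<` (T `|` [set x]) by split=> //; apply: Tmax.
  by split=> [y|h]; [left|apply/Tx/h; right].
have [u [uT u0 [y uy]]] : exists u, [/\ supp (T `|` [set x]) u, fglift id u = 0 &
    exists y, ~ p (coeff y u)].
  apply: contrapT => h; apply: TTx => u uT u0 y; apply: contrapT => uy.
  by apply: h; exists u; split=> //; exists y.
(* If the coefficient r of x were in p, then r x = 0 and u' would be a relation on T, so that all
   coefficients of u would be in p. Hence r is outside p and multiplies x into the span of T. *)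
pose r := coeff x u; pose u' := u - r *: << x >>.
have u'T : supp T u'.
  move=> z Tz; rewrite coeffB coeffZ coeffU mul1r; case: eqP => [<-|xz].
    by rewrite mulr1 subrr.
  by rewrite mulr0 subr0; apply: uT => -[//|zx]; apply: xz.
have u'E : fglift id u' = - (r *: x).
  by rewrite (linearB (fglift id)) (linearZ_LR (fglift id)) /= u0 sub0r fglift1.
have [pr|pr] := pselect (p r); last first.
  exists r, (- back u'); split=> //.
  by rewrite (linearN (fglift _)) /= io_lift io_back // u'E opprK.
have uE : u = u' + r *: << x >> by rewrite subrK.
case: uy; rewrite uE coeffD coeffZ; apply: idealD => //; last exact: idealMr.
by apply: Tind => //; rewrite u'E pV // oppr0.
Qed.

Lemma coordinate (V : lmodType R) (K : choiceType) (t : K -> V) (k : K) :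
  independent [set 0] t -> spanning [set 0] t ->
  exists phi : {linear V -> Qmod R}, forall x r u, r != 0 -> r *: x = fglift t u ->
    phi x = tofrac (coeff k u) / tofrac r.
Proof.
move=> ti ts.
have /choice[f fE] : forall x, exists q : Qmod R, forall r u, r != 0 ->
    r *: x = fglift t u -> q = tofrac (coeff k u) / tofrac r.
  move=> x; have [r [u [/eqP r0 ru]]] := ts x.
  exists (tofrac (coeff k u) / tofrac r) => r' u' r'0 ru'.
  have /ti/(_ k) : fglift t (r' *: u - r *: u') = 0.
    rewrite (linearB (fglift t)) !(linearZ_LR (fglift t)) /= -ru -ru' !scalerA.
    by rewrite mulrC subrr.
  rewrite coeffB !coeffZ => /subr0_eq e.
  by apply/eqP; rewrite eqr_div ?tofrac_eq0 // -!tofracM tofrac_eq mulrC e mulrC.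
have fl : linear f.
  move=> a x y; have [r [u [/eqP r0 ru]]] := ts x; have [s [v [/eqP s0 sv]]] := ts y.
  rewrite (fE x r u) // (fE y s v) //.
  rewrite (fE _ (r * s) ((a * s) *: u + r *: v)) ?mulf_neq0 //.
    rewrite coeffD !coeffZ QscaleE tofracD !tofracM.
    rewrite mulrDl; congr (_ + _).
      by rewrite [X in X / _]mulrAC -mulf_div divff ?tofrac_eq0 // mulr1 mulrA.
    by rewrite -mulf_div divff ?tofrac_eq0 // mul1r.
  rewrite (linearD (fglift t)) !(linearZ_LR (fglift t)) /= -ru -sv scalerDr !scalerA.
  by congr (_ *: _ + _); ring.
have [phi phiE] := mk_linear fl.
by exists phi => x r u r0 ru; rewrite phiE; apply: fE.
Qed.

(** Some coordinate of b is nonzero, and one divides by its value. This stands in for the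
    injectivity of the fraction field. *)
Lemma functional (V : lmodType R) (b : V) : (forall r, r != 0 -> r *: b <> 0) ->
  exists phi : {linear V -> Qmod R}, phi b = 1.
Proof.
move=> bt; have [|K [t [ti ts]]] := @max_independent [set 0] V (zero_prime R).
  by move=> r x ->; rewrite scale0r.
have [r [u [/eqP r0 ru]]] := ts b.
have [k uk] : exists k, coeff k u != 0.
  apply: contrapT => h; apply: (bt r r0); rewrite ru.
  have -> : u = 0; last exact: linear0.
  by apply: freeg_coeff0 => k; apply: contrapT => /eqP uk; apply: h; exists k.
have [phi phiE] := coordinate k ti ts.
have pb : phi b != 0 by rewrite (phiE b r u) // mulf_neq0 ?invr_eq0 ?tofrac_eq0.
have lin : linear (fun x => (phi b)^-1 * phi x : Qmod R).
  by move=> a x y; rewrite linearP !QscaleE mulrDr mulrCA.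
have [psi psiE] := mk_linear lin.
by exists psi; rewrite psiE mulVf.
Qed.

Section TensorRules.
Variables (M N : lmodType R).
Implicit Types (m : M) (n : N).

Lemma tensDl m m' n : tens (m + m') n = tens m n + tens m' n.
Proof. by have := (tens_bilinear M N).1 n 1 m m'; rewrite !scale1r. Qed.
Lemma tensDr m n n' : tens m (n + n') = tens m n + tens m n'.
Proof. by have := (tens_bilinear M N).2 m 1 n n'; rewrite !scale1r. Qed.
Lemma tens0l n : tens (0 : M) n = 0.
Proof. by apply: (addrI (tens 0 n)); rewrite -tensDl !addr0. Qed.
Lemma tens0r m : tens m (0 : N) = 0.
Proof. by apply: (addrI (tens m 0)); rewrite -tensDr !addr0. Qed.
Lemma tensZl a m n : tens (a *: m) n = a *: tens m n.
Proof. by have := (tens_bilinear M N).1 n a m 0; rewrite tens0l !addr0. Qed.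
Lemma tensZr a m n : tens m (a *: n) = a *: tens m n.
Proof. by have := (tens_bilinear M N).2 m a n 0; rewrite tens0r !addr0. Qed.

End TensorRules.

(** With common denominators every tensor becomes 1/b tensor a. If its image is zero then f a is
    torsion, so r a = 0 for some nonzero r, and r can be divided out of 1/b. *)
Lemma flat_Qmod : flat (Qmod R : lmodType R).
Proof.
move=> A B f fi.
have elt (x : tensor (Qmod R) A) : exists b a, b != 0 /\ x = tens ((tofrac b)^-1 : Qmod R) a.
  have [t ->] := quotmod_surj x.
  elim/freeg_ind: t => [|u v [b [a [b0 eu]]] [c [d [c0 ev]]]|a u [b [c [b0 eu]]]|[q a]].
  - by exists 1, 0; rewrite oner_neq0 linear0 tens0r.
  - exists (b * c), (c *: a + b *: d); split; first exact: mulf_neq0.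
    rewrite quotmod_piD eu ev tensDr !tensZr -!tensZl; congr (tens _ _ + tens _ _);
      rewrite QscaleE tofracM invfM.
      by rewrite mulrCA divff ?mulr1 ?tofrac_eq0.
    by rewrite mulrA divff ?mul1r ?tofrac_eq0.
  - exists b, (a *: c); split=> //; rewrite tensZr -eu.
    exact: (linearZ_LR (quotmod_pi (@bilin_rel R (Qmod R) A))).
  have [n [d [d0 qE]]] := Qmod_frac q; exists d, (n *: a); split=> //.
  by rewrite tensZr -tensZl QscaleE -qE.
have ker0 (x : tensor (Qmod R) A) : tensor_map f x = 0 -> x = 0.
  have [b [a [b0 ->]]] := elt x; rewrite tensor_map_tens => fa0.
  have [r [r0 rfa]] : exists r, r != 0 /\ r *: f a = 0.
    (* Otherwise the bilinear map sending (q, x) to q phi(x) takes 1/b tensor f a to 1/b, which is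
       not zero. *)
    apply: contrapT => nr; have [|phi phi1] := @functional B (f a).
      by move=> r r0 rfa; apply: nr; exists r.
    have bil : bilinear_map (fun (q : Qmod R) x => q * phi x : Qmod R).
      split=> [y c q q'|q c y y']; first by rewrite !QscaleE mulrDl mulrA.
      by rewrite linearP !QscaleE mulrDr mulrCA.
    have := tensor_lift_tens bil (tofrac b)^-1 (f a); rewrite fa0 phi1 mulr1.
    have [L LE] := mk_linear (tensor_lift_linear bil).
    rewrite -LE linear0 => /esym/eqP; rewrite invr_eq0 tofrac_eq0 => /eqP b0'.
    by move: b0; rewrite b0' eqxx.
  have ra : r *: a = 0 by apply: fi; rewrite linear0 linearZ_LR.
  have [q' <-] := Qmod_divisible ((tofrac b)^-1 : Qmod R) r0.
  by rewrite tensZl -tensZr ra tens0r.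
by move=> x y /eqP; rewrite -subr_eq0 -linearB => /eqP /ker0 /subr0_eq.
Qed.

End IndependentFamilies.

(** * Divisible very flat modules and Goldman domains *)

Definition divisible_by_all (R : idomainType) (V : lmodType R) : Prop :=
  forall (s : R) (x : V), s != 0 -> exists y, s *: y = x.

Section LocalSupport.
Variable R : idomainType.
Local Notation Q := (Qmod R).
Local Notation "a %:F" := (tofrac a : Q).
Implicit Types (P : set R) (q : Q) (y : set R -> Q).

(** For a prime P, [in_loc P] is the local ring R_P inside the fraction field, and [in_maxloc P] is
    its maximal ideal. *)
Definition in_loc P q : Prop := exists a t, ~ P t /\ t%:F * q = a%:F.
Definition in_maxloc P q : Prop := exists a t, [/\ ~ P t, P a & t%:F * q = a%:F].

Lemma in_locR P (a : R) : Spec R P -> in_loc P a%:F.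
Proof. by move=> /prime1 P1; exists a, 1; rewrite tofrac1 mul1r. Qed.

Lemma in_locD P q q' : Spec R P -> in_loc P q -> in_loc P q' -> in_loc P (q + q').
Proof.
move=> Pp [a [t [Pt e]]] [b [u [Pu e']]]; exists (u * a + t * b), (t * u).
split; first by move=> /(primeM Pp)[].
by rewrite tofracD !tofracM -e -e'; ring.
Qed.

Lemma in_locM P q q' : Spec R P -> in_loc P q -> in_loc P q' -> in_loc P (q * q').
Proof.
move=> Pp [a [t [Pt e]]] [b [u [Pu e']]]; exists (a * b), (t * u).
split; first by move=> /(primeM Pp)[].
by rewrite !tofracM -e -e'; ring.
Qed.

Lemma in_locV P (r : R) : Spec R P -> ~ P r -> in_loc P (r%:F)^-1.
Proof.
move=> Pp Pr; exists 1, r; split=> //; rewrite tofrac1 divff // tofrac_eq0.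
by apply/eqP => r0; apply: Pr; rewrite r0; apply: ideal0; apply: ideal_prime.
Qed.

Lemma in_maxloc_loc P q : in_maxloc P q -> in_loc P q.
Proof. by move=> [a [t [Pt _ e]]]; exists a, t. Qed.

Lemma in_maxlocR P (a : R) : Spec R P -> P a -> in_maxloc P a%:F.
Proof. by move=> /prime1 P1; exists a, 1; rewrite tofrac1 mul1r. Qed.

Lemma in_maxloc0 P : Spec R P -> in_maxloc P 0.
Proof.
move=> Pp; rewrite -(tofrac0 R); apply: in_maxlocR => //.
exact: ideal0 (ideal_prime Pp).
Qed.

Lemma in_maxlocD P q q' :
  Spec R P -> in_maxloc P q -> in_maxloc P q' -> in_maxloc P (q + q').
Proof.
move=> Pp [a [t [Pt Pa e]]] [b [u [Pu Pb e']]]; exists (u * a + t * b), (t * u).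
have Pi := ideal_prime Pp.
split; first by move=> /(primeM Pp)[].
  by apply: idealD => //; apply: idealMl.
by rewrite tofracD !tofracM -e -e'; ring.
Qed.

Lemma in_maxlocM P q q' :
  Spec R P -> in_loc P q -> in_maxloc P q' -> in_maxloc P (q * q').
Proof.
move=> Pp [a [t [Pt e]]] [b [u [Pu Pb e']]]; exists (a * b), (t * u).
split; first by move=> /(primeM Pp)[].
  by apply: idealMl => //; apply: ideal_prime.
by rewrite !tofracM -e -e'; ring.
Qed.

Lemma in_maxloc1 P : Spec R P -> ~ in_maxloc P 1.
Proof.
move=> Pp [a [t [Pt Pa]]]; rewrite mulr1 => /eqP; rewrite tofrac_eq => /eqP ta.
by apply: Pt; rewrite ta.
Qed.

(** The index runs over all subsets of R, with no condition off the spectrum, neither here nor in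
    [maxlocals]. So [locals] modulo [maxlocals] is the product of the residue fields at the nonzero
    primes. *)
Definition locals : set (set R -> Q) :=
  [set y | forall P, Spec R P -> in_loc P (y P)].

Definition maxlocals : set (set R -> Q) :=
  [set y | locals y /\ forall P, Spec R P -> nonzero P -> in_maxloc P (y P)].

Definition almost_maxlocals : set (set R -> Q) :=
  [set y | locals y /\ exists2 s, s != 0 &
    forall P, Spec R P -> nonzero P -> ~ P s -> in_maxloc P (y P)].

Lemma locals_submodule : submodule locals.
Proof.
apply: submoduleP => [P Pp|x y Ux Uy P Pp|a x Ux P Pp].
- exact/in_maxloc_loc/in_maxloc0.
- by apply: in_locD; [|apply: Ux|apply: Uy].
by apply: in_locM; [|apply: in_locR|apply: Ux].
Qed.

Lemma maxlocals_submodule : submodule maxlocals.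
Proof.
have SU := @spanP _ _ locals _ locals_submodule.
have UD x y : locals x -> locals y -> locals (x + y).
  by move=> /SU Ux /SU Uy; apply/SU; rewrite rpredD.
have UZ a x : locals x -> locals (a *: x) by move=> /SU Ux; apply/SU; rewrite rpredZ.
apply: submoduleP => [|x y [Ux xP] [Uy yP]|a x [Ux xP]].
- by split; [apply/SU; rewrite rpred0|move=> P Pp _; exact: in_maxloc0].
- by split; [exact: UD|move=> P Pp Pn; apply: in_maxlocD; [|apply: xP|apply: yP]].
split; [exact: UZ|move=> P Pp Pn; apply: in_maxlocM => //; first exact: in_locR].
exact: xP.
Qed.

Lemma almost_maxlocals_submodule : submodule almost_maxlocals.
Proof.
have SU := @spanP _ _ locals _ locals_submodule.
have UD x y : locals x -> locals y -> locals (x + y).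
  by move=> /SU Ux /SU Uy; apply/SU; rewrite rpredD.
have UZ a x : locals x -> locals (a *: x) by move=> /SU Ux; apply/SU; rewrite rpredZ.
apply: submoduleP => [|x y [Ux [s s0 xP]] [Uy [t t0 yP]]|a x [Ux [s s0 xP]]].
- split; first by apply/SU; rewrite rpred0.
  by exists 1; [exact: oner_neq0|move=> P Pp _ _; exact: in_maxloc0].
- split; first exact: UD.
  exists (s * t) => [|P Pp Pn Pst]; first exact: mulf_neq0.
  apply: in_maxlocD => //.
    by apply: xP => // Ps; apply: Pst; apply: idealMr => //; apply: ideal_prime.
  by apply: yP => // Pt; apply: Pst; apply: idealMl => //; apply: ideal_prime.
split; first exact: UZ.
exists s => // P Pp Pn Ps; apply: in_maxlocM => //; first exact: in_locR.
exact: xP.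
Qed.

(* Outside the primes containing [r] one divides by [r]; the primes containing
   [r] need no correction, since [r * y] vanishes there modulo [P R_P]. *)
Lemma almost_maxlocals_solvable (r : R) (c : nat -> set R -> Q) :
  (forall n, almost_maxlocals (c n)) ->
  exists x : nat -> set R -> Q, (forall n, almost_maxlocals (x n)) /\
    forall n, maxlocals (x n - r *: x n.+1 - c n).
Proof.
move=> cN.
pose x := fix x n : set R -> Q := fun P =>
  if `[< P r >] then c n P else
  if n is m.+1 then (r%:F)^-1 * (x m P - c m P) else 0.
have xr n P : P r -> x n P = c n P by move=> Pr; case: n => [|n] /=; rewrite asboolT.
have xS n P : ~ P r -> x n.+1 P = (r%:F)^-1 * (x n P - c n P).
  by move=> Pr; rewrite /= asboolF.
have x0 P : ~ P r -> x 0%N P = 0 by move=> Pr; rewrite /= asboolF.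
have N1 P q : Spec R P -> in_loc P q -> in_loc P (- q).
  move=> Pp qP; rewrite -mulN1r; apply: in_locM => //.
  by rewrite -(tofrac1 R) -tofracN; apply: in_locR.
have N2 P q : Spec R P -> in_maxloc P q -> in_maxloc P (- q).
  move=> Pp qP; rewrite -mulN1r; apply: in_maxlocM => //.
  by rewrite -(tofrac1 R) -tofracN; apply: in_locR.
have xU n : locals (x n).
  elim: n => [|n IH] P Pp; have [Pr|Pr] := pselect (P r).
  - by rewrite xr //; apply: (cN 0%N).1.
  - by rewrite x0 //; apply/in_maxloc_loc/in_maxloc0.
  - by rewrite xr //; apply: (cN n.+1).1.
  rewrite xS //; apply: in_locM => //; first exact: in_locV.
  by apply: in_locD; [|apply: IH|apply: N1 => //; apply: (cN n).1].
exists x; split=> n.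
  split=> //.
  elim: n => [|n [s s0 sP]].
    have [_ [s s0 sP]] := cN 0%N; exists s => // P Pp Pn Ps.
    have [Pr|Pr] := pselect (P r); first by rewrite xr //; apply: sP.
    by rewrite x0 //; apply: in_maxloc0.
  have [_ [t t0 tP]] := cN n; have [_ [u u0 uP]] := cN n.+1.
  exists (s * (t * u)) => [|P Pp Pn Pstu]; first by rewrite !mulf_neq0.
  have Pi := ideal_prime Pp.
  have [Pr|Pr] := pselect (P r).
    rewrite xr //; apply: uP => // Pu; apply: Pstu.
    by apply: idealMl => //; apply: idealMl.
  rewrite xS //; apply: in_maxlocM => //; first exact: in_locV.
  apply: in_maxlocD => //.
    by apply: sP => // Ps; apply: Pstu; apply: idealMr.
  apply: N2 => //; apply: tP => // Pt; apply: Pstu.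
  by apply: idealMl => //; apply: idealMr.
have zE P : (x n - r *: x n.+1 - c n) P = x n P - r%:F * x n.+1 P - c n P by [].
have zU P : Spec R P -> in_loc P (x n P - r%:F * x n.+1 P - c n P).
  move=> Pp; apply: in_locD => //; last by apply: N1 => //; apply: (cN n).1.
  apply: in_locD => //; first exact: xU.
  by apply: N1 => //; apply: in_locM; [|exact: in_locR|exact: xU].
split=> [P Pp|P Pp Pn]; rewrite zE; first exact: zU.
have [Pr|Pr] := pselect (P r).
  rewrite (xr n) // addrAC subrr sub0r; apply: N2 => //.
  rewrite mulrC; apply: in_maxlocM => //; last exact: in_maxlocR.
  exact: xU.
rewrite xS // mulrA divff ?mul1r.
  by rewrite opprB addrCA subrr addr0 subrr; apply: in_maxloc0.
rewrite tofrac_eq0; apply/eqP => r0; apply: Pr; rewrite r0.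
exact: ideal0 (ideal_prime Pp).
Qed.

Lemma very_flat_divisible_goldman (V : lmodType R) (chi : {linear V -> Q}) v0 :
  very_flat V -> divisible_by_all V -> chi v0 = 1 -> goldman R.
Proof.
move=> Vvf Vdiv chi1.
pose U := submod_of locals.
pose iota : {linear U -> (set R -> Q)} := inclusion _.
have iotaU u : locals (iota u) by apply: submod_ofP; exact: locals_submodule.
have mkU y : locals y -> exists u, iota u = y by move=> /submod_of_mk.
pose N0 : set U := [set u | maxlocals (iota u)].
pose N : set U := [set u | almost_maxlocals (iota u)].
have pull S : submodule S -> submodule [set u | S (iota u)].
  move=> SS; have SP := @spanP _ _ S _ SS; apply: submoduleP => [|x y|a x]; rewrite /mkset.
  - by rewrite (linear0 iota); apply/SP; rewrite rpred0.
  - by move=> /SP Sx /SP Sy; apply/SP; rewrite (linearD iota) rpredD.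
  by move=> /SP Sx; apply/SP; rewrite (linearZ_LR iota) rpredZ.
have N0S : submodule N0 by apply: pull; exact: maxlocals_submodule.
have NS : submodule N by apply: pull; exact: almost_maxlocals_submodule.
pose p0 : {linear U -> quotmod N0} := quotmod_pi N0.
pose p1 : {linear U -> quotmod N} := quotmod_pi N.
have p0E u : p0 u = 0 <-> N0 u by exact: quotmod_submod0.
have p1E u : p1 u = 0 <-> N u by exact: quotmod_submod0.
have N0N u : N0 u -> N u.
  by move=> [uU uP]; split=> //; exists 1 => [|P Pp Pn _]; [exact: oner_neq0|exact: uP].
have p0s : surjective_map p0 := @quotmod_pi_surj _ _ N0.
have [rho rhoE] := factor_surj p0s (fun u u0 => (p1E u).2 (N0N _ ((p0E u).1 u0))).
have rhos : surjective_map rho.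
  by move=> z; have [u <-] := @quotmod_pi_surj _ _ N z; exists (p0 u); rewrite rhoE.
(* [ker rho] consists of the families of residues that vanish at every P not containing some fixed s
   <> 0. *)
have kerCA : contraadjusted (ker rho).
  apply/contraadjustedP => r c.
  have /choice[u uE] n : exists u, p0 u = val (c n) by apply: p0s.
  have uN n : almost_maxlocals (iota (u n)).
    by apply/p1E; rewrite -rhoE uE kerE.
  have [x [xN xE]] := almost_maxlocals_solvable r uN.
  have /choice[w wE] n : exists w, iota w = x n by apply: mkU; case: (xN n).
  have /choice[k kE] n : exists k : ker rho, val k = p0 (w n).
    by apply: ker_mk; rewrite rhoE; apply/p1E; rewrite /N /mkset wE.
  exists k => n; apply: val_inj.
    have -> : val (k n - r *: k n.+1) = val (k n) - r *: val (k n.+1) by [].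
    rewrite !kE -uE; apply/subr0_eq.
    rewrite -(linearZ_LR p0) -!(linearB p0); apply/p0E.
  by rewrite /N0 /mkset !(linearB iota) (linearZ_LR iota) !wE.
(* The constant family [chi v], replaced by 0 where it is not local. It is linear only off the
   primes containing a denominator, which suffices modulo [N]. *)
pose w v : set R -> Q := fun P => if `[< in_loc P (chi v) >] then chi v else 0.
have wU v : locals (w v).
  move=> P Pp; rewrite /w; case: asboolP => // _.
  exact/in_maxloc_loc/in_maxloc0.
have /choice[m mE] v : exists u, iota u = w v by apply: mkU.
have ml : linear (p1 \o m).
  move=> a v v'; apply/subr0_eq; rewrite [X in X - _]/=.
  rewrite -(linearZ_LR p1) -(linearD p1) -(linearB p1).
  apply/p1E; rewrite /N /mkset; split=> //.
  rewrite (linearB iota) (linearD iota) (linearZ_LR iota) !mE.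
  have [n [d [d0 e]]] := Qmod_frac (chi v); have [n' [d' [d'0 e']]] := Qmod_frac (chi v').
  exists (d * d') => [|P Pp Pn Pdd']; first exact: mulf_neq0.
  have Pi := ideal_prime Pp.
  have h : in_loc P (chi v).
    rewrite e; apply: in_locM => //; [exact: in_locR|apply: in_locV => // Pd].
    by apply: Pdd'; apply: idealMr.
  have h' : in_loc P (chi v').
    rewrite e'; apply: in_locM => //; [exact: in_locR|apply: in_locV => // Pd].
    by apply: Pdd'; apply: idealMl.
  have -> : (w (a *: v + v') - (a *: w v + w v')) P = 0; last exact: in_maxloc0.
  have h'' : in_loc P (chi (a *: v + v')).
    rewrite linearP; apply: in_locD => //; apply: in_locM => //; exact: in_locR.
  have -> : (w (a *: v + v') - (a *: w v + w v')) P =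
    w (a *: v + v') P - (a%:F * w v P + w v' P) by [].
  by rewrite /w !asboolT // linearP subrr.
have [mu muE] := mk_linear ml.
have [psi psiE] := ext1_lift mu rhos (Vvf _ kerCA).
(* [v0] is divisible by a nonzero element of P, so its lift vanishes in the residue field of P. *)
have psi0 : psi v0 = 0.
  have [u uE] := p0s (psi v0); rewrite -uE; apply/p0E; split=> // P Pp [s Ps s0].
  have [v' v'E] := Vdiv s v0 s0; have [u' u'E] := p0s (psi v').
  have /p0E [_ /(_ P Pp)] : p0 (u - s *: u') = 0.
    by rewrite linearB linearZ_LR uE u'E -v'E linearZ_LR subrr.
  move=> /(_ (ex_intro2 _ _ s Ps s0)).
  have -> : iota (u - s *: u') P = iota u P - s%:F * iota u' P.
    by rewrite (linearB iota) (linearZ_LR iota).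
  move=> h; rewrite -[iota u P](subrK (s%:F * iota u' P)); apply: in_maxlocD => //.
  by rewrite mulrC; apply: in_maxlocM => //; [exact: iotaU|exact: in_maxlocR].
(* The constant family 1 is thus zero modulo [N]. The s witnessing this lies in every nonzero P,
   since 1 is not in P R_P. *)
have /p1E [_ [s s0 sP]] : p1 (m v0) = 0 by rewrite -[LHS]muE -psiE psi0 linear0.
exists s; split=> // P Pp Pn; apply: contrapT => Ps.
have := sP P Pp Pn Ps; rewrite mE /w chi1 asboolT; last first.
  by rewrite -(tofrac1 R); apply: in_locR.
exact: in_maxloc1.
Qed.

End LocalSupport.

(** * The submodules I V and iterates of an endomorphism *)

Section IdealMultiples.
Variable R : idomainType.
Implicit Types (I J P : set R) (V W X F : lmodType R).

Definition scale_map V (s : R) : {linear V -> V} := *:%R s.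

Definition multiples V I : set V := [set z | exists a x, I a /\ z = a *: x].

Definition imul V I : {pred V} := span (multiples (V := V) I).
Arguments imul : clear implicits.

HB.instance Definition _ V I := GRing.SubmodClosed.on (imul V I).

Lemma mem_imul V I a (x : V) : I a -> a *: x \in imul V I.
Proof. by move=> Ia; apply: span_incl; exists a, x. Qed.

Lemma imul_ind V I (S : V -> Prop) : S 0 ->
  (forall x y, S x -> S y -> S (x + y)) ->
  (forall (a : R) x, S x -> S (a *: x)) -> (forall a x, I a -> S (a *: x)) ->
  forall x, x \in imul V I -> S x.
Proof. by move=> S0 SD SZ SI; apply: span_ind => // _ [a [x [Ia ->]]]; apply: SI. Qed.

Lemma imul_map V W (f : {linear V -> W}) I x : x \in imul V I -> f x \in imul W I.
Proof.
move: x; apply: imul_ind => [|x y|a x|a x Ia].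
- by rewrite linear0 rpred0.
- by rewrite linearD; apply: rpredD.
- by rewrite linearZ_LR; apply: rpredZ.
by rewrite linearZ_LR; apply: mem_imul.
Qed.

Lemma imul_principal V s x : x \in imul V (principal s) -> exists y, x = s *: y.
Proof.
move: x; apply: imul_ind => [|_ _ [x ->] [y ->]|a _ [x ->]|_ x [b ->]].
- by exists 0; rewrite scaler0.
- by exists (x + y); rewrite scalerDr.
- by exists (a *: x); rewrite !scalerA mulrC.
by exists (b *: x); rewrite scalerA mulrC.
Qed.

Lemma imul_adjoin V I a b c (x : V) : is_ideal I -> I (a * b) ->
  adjoin I b c -> x \in imul V (adjoin I a) -> c *: x \in imul V I.
Proof.
move=> Ii Iab [i [d [Ii' ->]]]; move: x.
apply: imul_ind => [|x y|e x|_ x [j [e [Ij ->]]]].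
- by rewrite scaler0 rpred0.
- by rewrite scalerDr; apply: rpredD.
- by rewrite scalerA [_ * e]mulrC -scalerA; apply: rpredZ.
rewrite scalerA; apply: mem_imul.
have -> : (i + d * b) * (j + e * a) = (j + e * a) * i + (d * b * j + d * e * (a * b)) by ring.
by apply: idealD => //; [|apply: idealD => //]; apply: idealMl.
Qed.

(** If h^l maps V into (I + b R) V, h^k maps it into (I + a R) V and a b is in I, then h^(k+l) maps
    it into I V. For h = id: if V = P V for all nonzero primes, then V = I V for all nonzero
    ideals. *)
Lemma iter_imul V (h : {linear V -> V}) : noetherian R ->
  (forall P, Spec R P -> nonzero P -> exists k, forall x, iter k h x \in imul V P) ->
  forall I, is_ideal I -> nonzero I -> exists k, forall x, iter k h x \in imul V I.
Proof.
move=> noethR hP; apply: prime_ind => // [_|I a b Ii Iab Sa Sb In].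
  by exists 0%N => x; rewrite -[iter _ _ _]scale1r; apply: mem_imul.
have Jn c : nonzero (adjoin I c).
  by have [x Ix x0] := In; exists x => //; apply: sub_adjoin.
have [k kE] := Sa (Jn a); have [l lE] := Sb (Jn b).
exists (k + l)%N => x; rewrite iterD; move: (lE x).
have iterL m : exists g : {linear V -> V}, forall y, g y = iter m h y.
  elim: m => [|m [g gE]]; first by exists idfun.
  by exists (h \o g) => y; rewrite /= gE.
have [g gE] := iterL k; rewrite -gE; move: (iter l h x).
apply: imul_ind => [|y z|c y|c y Jc].
- by rewrite linear0 rpred0.
- by rewrite linearD; apply: rpredD.
- by rewrite linearZ_LR; apply: rpredZ.
by rewrite linearZ_LR; apply: (imul_adjoin Ii Iab Jc); rewrite gE.
Qed.

Lemma solvable0 V : solvable 0 V.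
Proof. by move=> c; exists c => n; rewrite scale0r subr0. Qed.

Lemma divisible_contraadjusted V : divisible_by_all V -> contraadjusted V.
Proof.
move=> Vd; apply/contraadjustedP => r; have [->|r0] := eqVneq r 0; first exact: solvable0.
by apply: solvable_surj => x; apply: Vd.
Qed.

Lemma Qmod_divisible_by_all : divisible_by_all (Qmod R : lmodType R).
Proof. by move=> s q s0; apply: Qmod_divisible. Qed.

Lemma flat_very_flat_goldman :
  (forall V, flat V -> very_flat V) -> goldman R.
Proof.
move=> fv; apply: (@very_flat_divisible_goldman R (Qmod R) idfun 1) => //.
  exact/fv/flat_Qmod.
exact: Qmod_divisible_by_all.
Qed.

End IdealMultiples.

Arguments imul {R} V I _.

(** * Covers and envelopes force the Goldman property *)

Section Wakamatsu.
Variable R : idomainType.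
Implicit Types C E M V Z : lmodType R.

Lemma cover_surjective M V (f : {linear V -> M}) :
  is_precover (@very_flat R) f -> surjective_map f.
Proof.
move=> [_ pre] q.
have Fvf : very_flat {freeg unit / R}.
  by move=> C _; apply/ext1_projective/projective_freeg.
have [g gE] := pre _ (fglift (fun _ : unit => q)) Fvf.
by exists (g << tt >>); rewrite -[LHS]gE /= fglift1.
Qed.

(* Adjoin to V formal solutions e_n of e_n - r e_(n+1) = c_n; the result is an
   extension of R[1/r] by V, hence very flat, and its factorization through
   the cover turns the e_n into solutions in the kernel. *)
Lemma cover_kernel_contraadjusted M V (f : {linear V -> M}) :
  is_cover (@very_flat R) f -> contraadjusted (ker f).
Proof.
move=> [[Vvf pre] min]; apply/contraadjustedP => r c.
have [E [i [e [ii eE univ norm]]]] :=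
  adjoin_solutions r (fun k : unit * nat => val (c k.2)).
have [|q [qi qe]] := univ (loc r) \0 (fun k => frac r 1 k.2).
  move=> k n /=; rewrite fracZ; apply/eqP; rewrite subr_eq0; apply/eqP/frac_eq.
  by rewrite exprS; ring.
(* Modulo M, e_n equals r^k e_(n+k); hence what vanishes in R[1/r] already comes from M. *)
have eS n k : exists m, e (tt, n) = i m + r ^+ k *: e (tt, (n + k)%N).
  elim: k => [|k [m ->]]; first by exists 0; rewrite linear0 add0r addn0 scale1r.
  exists (m + r ^+ k *: val (c (n + k)%N)).
  rewrite addnS exprSr -scalerA linearD linearZ_LR -(eE tt) scalerBr.
  by rewrite -addrA subrK.
have liftE n (v : {freeg unit / R}) :
    fglift (fun k : unit => e (k, n)) v = coeff tt v *: e (tt, n).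
  elim/freeg_ind: v => [|u v eu ev|a u eu|[]].
  - by rewrite linear0 coeff0 scale0r.
  - by rewrite coeffD scalerDl -eu -ev; apply: linearD.
  - by rewrite coeffZ -scalerA -eu; apply: linearZ_LR.
  by rewrite fglift1 coeffU eqxx mulr1 scale1r.
have iq : short_exact i q.
  split=> [//|y|x].
    split=> [|[m <-]]; last exact: qi.
    have [n [v [m ->]]] := norm y; rewrite liftE linearD qi add0r linearZ_LR qe.
    rewrite fracZ mulr1 => /fracP[k]; rewrite expr0 mul0r mulr0 mulr1 => rv.
    have [m' ->] := eS n k; exists (m + coeff tt v *: m').
    by rewrite scalerDr scalerA mulrC rv scale0r addr0 linearD linearZ_LR.
  have [a [n ->]] := frac_surj x; exists (a *: e (tt, n)).
  by rewrite linearZ_LR qe fracZ mulr1.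
have Evf : very_flat E.
  by move=> C CC; apply: (ext1_ext iq); [exact: Vvf|exact: CC].
have [|h [hi he]] := univ M f (fun _ => 0).
  by move=> k n /=; rewrite scaler0 subr0 kerE.
have [g gE] := pre E h Evf.
have [|psi psiK Kpsi] := min (g \o i); first by move=> x /=; rewrite -[RHS]gE hi.
have fpsi x : f (psi x) = f x.
  by rewrite -[in RHS](Kpsi x) /= -[RHS]gE hi.
(* [psi] is inverse to g i. It keeps the g e_n in the kernel of f and restores the right-hand sides
   c_n. *)
have /choice[x xE] n : exists k : ker f, val k = psi (g (e (tt, n))).
  by apply: ker_mk; rewrite fpsi -[LHS]gE he.
exists x => n; apply: val_inj; apply: (can_inj psiK).
have -> : val (x n - r *: x n.+1) = val (x n) - r *: val (x n.+1) by [].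
have giE m : g (i (psi m)) = m := Kpsi m.
rewrite !xE /= (linearB i) (linearB g) (linearZ_LR i) (linearZ_LR g) !giE.
by rewrite -(linearZ_LR g) -(linearB g) eE.
Qed.

(** The dual of Wakamatsu's lemma. An extension Z of the cokernel by C is pulled back to E; the
    pullback is contraadjusted, so (0, i) extends from M to E. The E-component of the extension is
    an automorphism by minimality, and its Z-component kills M; together they give a section of
    Z. *)
Lemma envelope_cokernel_very_flat M E (i : {linear M -> E}) :
  is_envelope (@contraadjusted R) i -> very_flat (quotmod (range i)).
Proof.
move=> [[CE pre] min] C CC.
pose V : lmodType R := quotmod (range i).
pose pi : {linear E -> V} := quotmod_pi (range i).
have pis : surjective_map pi := @quotmod_pi_surj _ _ (range i).
have pi0 x : pi x = 0 <-> exists m, i m = x by exact: quotmod_range0.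
apply: ext1_split => Z j q jq; have [ji ex qs] := jq.
have dl : linear (fun z : Z * E => q z.1 - pi z.2).
  by move=> a z w /=; rewrite (linearP q) (linearP pi) scalerBr opprD addrACA.
have [d dE] := mk_linear dl.
pose b : {linear ker d -> E} := snd \o inclusion d.
pose z1 : {linear ker d -> Z} := fst \o inclusion d.
have qz1 y : q (z1 y) = pi (b y).
  by apply/subr0_eq; have := inclusionE y; rewrite dE.
have jl : linear (fun c : C => (j c, 0) : Z * E).
  by move=> a x y; congr (_, _); rewrite ?linearP //= scaler0 addr0.
have [j' j'E] := mk_linear jl.
have [|a aE] := ker_lift (f := d) (h := j').
  by move=> x; rewrite dE j'E /= (short_exact0 _ jq) linear0 subr0.
have ab : short_exact a b.
  split=> [x y e|y|y].
  - apply: ji; have := aE x; rewrite e aE !j'E => e'.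
    by have := congr1 fst e'.
  - split=> [by0|[x <-]]; last by rewrite /b /= /inclusion aE j'E.
    have /ex[x xE] : q (z1 y) = 0 by rewrite qz1 by0 linear0.
    exists x; apply: val_inj; rewrite aE j'E xE.
    by rewrite [RHS]surjective_pairing; congr (_, _); apply/esym.
  have [x xE] := qs (pi y).
  have [|k kE] := @ker_mk _ _ _ d (x, y); first by rewrite dE /= xE subrr.
  by exists k; rewrite /b /= /inclusion kE.
have CK : contraadjusted (ker d).
  apply/contraadjustedP => r; apply: (solvable_ext ab).
    by move/contraadjustedP: CC.
  by move/contraadjustedP: CE.
have il : linear (fun m : M => (0, i m) : Z * E).
  by move=> c x y; congr (_, _); rewrite ?linearP //= scaler0 addr0.
have [i1 i1E] := mk_linear il.
have [|i' i'E] := ker_lift (f := d) (h := i1).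
  move=> x; rewrite dE i1E /= linear0 sub0r.
  by have /pi0 -> : exists m, i m = i x; [exists x|rewrite oppr0].
have [g gE] := pre _ i' CK.
have zgi m : z1 (g (i m)) = 0.
  by have := i'E m; rewrite (gE m) i1E => e; have := congr1 fst e.
have bgi m : b (g (i m)) = i m.
  by have := i'E m; rewrite (gE m) i1E => e; have := congr1 snd e.
have phib : bijective (b \o g) by apply: min => m; exact/esym/bgi.
have [psi psiK Kpsi] := phib.
have [||s sE] := @factor_surj _ _ _ _ (pi \o (b \o g)) (z1 \o g).
- by move=> v; have [e <-] := pis v; exists (psi e); rewrite -[in RHS](Kpsi e).
- move=> e /= /pi0[m mE]; suff -> : e = i m by exact: zgi.
  by apply: (can_inj psiK); exact: etrans (esym mE) (esym (bgi m)).
exists s => v; have [e <-] := pis v; rewrite -(Kpsi e).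
exact: etrans (congr1 q (sE (psi e))) (qz1 _).
Qed.

Lemma covering_goldman : covering (@very_flat R) -> goldman R.
Proof.
move=> /(_ (Qmod R))[V [f cov]].
have KC := cover_kernel_contraadjusted cov.
have [pre min] := cov; have fs := cover_surjective pre; have [Vvf _] := pre.
have [v0 v01] := fs (1 : Qmod R).
apply: (very_flat_divisible_goldman Vvf _ v01) => s v s0.
pose G := range (scale_map V s).
pose pi : {linear V -> quotmod G} := quotmod_pi G.
have pi0 x : pi x = 0 <-> exists y, x = s *: y.
  by apply: iff_trans (quotmod_range0 _ _) _; split=> -[y]; exists y.
pose k : {linear ker f -> quotmod G} := pi \o inclusion f.
have ks : surjective_map k.
  move=> z; have [x <-] := @quotmod_pi_surj _ _ G z.
  have [q qE] := Qmod_divisible (f x) s0; have [y yE] := fs q.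
  have [|w wE] := @ker_mk _ _ _ f (x - s *: y).
    by rewrite linearB linearZ_LR yE -qE subrr.
  exists w; apply/subr0_eq; have -> : k w = pi (val w) by [].
  rewrite wE -(linearB pi).
  by apply/pi0; exists (- y); rewrite addrAC subrr sub0r scalerN.
(* The fraction field is torsion free, so this kernel is s times [ker f]; solutions in [ker f] are
   multiplied by s. *)
have kC : contraadjusted (ker k).
  apply/contraadjustedP => r c.
  have /choice[u uE] n : exists u : ker f, val (val (c n)) = s *: val u.
    have /pi0[y yE] := kerE (c n).
    have [|w wE] := @ker_mk _ _ _ f y; last by exists w; rewrite wE.
    apply: (Qmod_torsion_free s0); rewrite -linearZ_LR -yE; exact: kerE.
  have [z zE] := (contraadjustedP (ker f)).1 KC r u.
  have /choice[x xE] n : exists x : ker k, val x = s *: z n.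
    by apply: ker_mk; apply/pi0; exists (val (z n)).
  exists x => n; apply: val_inj; apply: val_inj.
  have -> : val (val (x n - r *: x n.+1)) = val (val (x n) - r *: val (x n.+1)) by [].
  by rewrite !xE uE -zE scalerA mulrC -scalerA -scalerBr.
have [h hE] := ext1_lift pi ks (Vvf _ kC).
pose g : {linear V -> V} := idfun \- (inclusion f \o h).
have [|psi _ Kpsi] := min g.
  by move=> x; rewrite /g /= linearB inclusionE subr0.
have /pi0[y yE] : pi v = 0.
  rewrite -(Kpsi v) /g /= (linearB pi); apply/eqP; rewrite subr_eq0; apply/eqP.
  exact/esym/hE.
by exists y.
Qed.

End Wakamatsu.

(** * Envelopes of a direct sum of localizations at a height one prime *)

Section EnvelopingGoldman.
Variables (R : idomainType) (p : set R).
Local Notation Q := (Qmod R).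
Hypotheses (noethR : noetherian R) (ph1 : height1 p).

Lemma height1_prime : Spec R p. Proof. by case: ph1. Qed.
Local Notation pp := height1_prime.

Definition loc_sums : set (nat -> Q) :=
  [set g | (exists N, forall n, (N <= n)%N -> g n = 0) /\ forall n, in_loc p (g n)].

Lemma loc_sums_submodule : submodule loc_sums.
Proof.
apply: submoduleP => [|x y [[N xN] xp] [[N' yN] yp]|a x [[N xN] xp]].
- by split=> [|n]; [exists 0%N|exact/in_maxloc_loc/in_maxloc0/pp].
- split=> [|n]; last by apply: in_locD; [exact: pp|exact: xp|exact: yp].
  exists (maxn N N') => n; rewrite geq_max => /andP[Nn N'n].
  have -> : (x + y) n = x n + y n by [].
  by rewrite xN // yN //; exact: addr0.
split=> [|n]; last by apply: in_locM; [exact: pp|exact/in_locR/pp|exact: xp].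
exists N => n Nn; have -> : (a *: x) n = a *: x n by [].
by rewrite xN // scaler0.
Qed.

Definition loc_sum : lmodType R := submod_of loc_sums.
Definition coords : {linear loc_sum -> (nat -> Q)} := inclusion _.

Lemma coords_inj : injective coords. Proof. exact: val_inj. Qed.

Lemma coordsP x : loc_sums (coords x).
Proof. exact: (submod_ofP loc_sums_submodule x). Qed.

Lemma coords_mk g : loc_sums g -> exists x, coords x = g.
Proof. exact: submod_of_mk. Qed.

Lemma p_unit_neq0 t : ~ p t -> t != 0.
Proof.
by move=> pt; apply/eqP => t0; apply: pt; rewrite t0; apply: ideal0; exact: ideal_prime pp.
Qed.

Lemma loc_sum_torsion_free t (x : loc_sum) : t != 0 -> t *: x = 0 -> x = 0.
Proof.
move=> t0 tx; apply: coords_inj; rewrite linear0; apply/funext => n.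
apply: (Qmod_torsion_free t0).
have -> : t *: coords x n = coords (t *: x) n by rewrite (linearZ_LR coords).
by rewrite tx linear0.
Qed.

Lemma loc_sum_unit_surj t (x : loc_sum) : ~ p t -> exists y : loc_sum, t *: y = x.
Proof.
move=> pt; have [[N xN] xp] := coordsP x.
have [|y yE] := @coords_mk (fun n => (tofrac t)^-1 * coords x n).
  split=> [|n]; first by exists N => n Nn; rewrite xN // mulr0.
  by apply: in_locM; [exact: pp|apply: in_locV => //; exact: pp|].
exists y; apply: coords_inj; rewrite (linearZ_LR coords) yE; apply/funext => n.
exact/QscaleVK/p_unit_neq0.
Qed.

(** Take r <> 0 in p and for c_n the n-th unit vector. Then the n-th coordinate of x_0 is r^n (1 + r
    y) with y in R_p, which is never zero, against finite support. *)
Lemma loc_sum_not_contraadjusted : ~ contraadjusted loc_sum.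
Proof.
move=> /contraadjustedP CM; have [_ [r pr r0] _] := ph1.
have /choice[c cE] n : exists x, coords x = (fun k => if k == n then 1 else 0 : Q).
  apply: coords_mk; split=> [|k].
    by exists n.+1 => k nk; rewrite gtn_eqF.
  case: eqP => _; first by rewrite -(tofrac1 R); apply/in_locR/pp.
  exact/in_maxloc_loc/in_maxloc0/pp.
have [x xE] := CM r c.
have xS k n : coords (x k) n = coords (c k) n + tofrac r * coords (x k.+1) n.
  rewrite -xE (linearB coords) (linearZ_LR coords).
  by rewrite [X in X + _]/(coords (x k) n - tofrac r * coords (x k.+1) n) subrK.
have x0 n k : (k <= n)%N -> coords (x 0%N) n = tofrac r ^+ k * coords (x k) n.
  elim: k => [|k IH] kn; first by rewrite expr0 mul1r.
  by rewrite IH ?(ltnW kn) // xS cE gtn_eqF // add0r mulrA exprSr.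
have [[N xN] _] := coordsP (x 0%N).
have := xN N (leqnn N); rewrite (x0 N N) // xS cE eqxx.
move=> /eqP; rewrite mulf_eq0 expf_eq0 tofrac_eq0 (negPf r0) andbF /=.
rewrite addr_eq0 => /eqP e; apply: (in_maxloc1 pp); rewrite e.
have -> : - (tofrac r * coords (x N.+1) N) = coords (x N.+1) N * tofrac (- r).
  by rewrite tofracN; ring.
apply: in_maxlocM; [exact: pp|exact: (coordsP _).2|apply: in_maxlocR; first exact: pp].
by apply: idealN => //; exact: ideal_prime pp.
Qed.

Lemma iter_scale (V : lmodType R) r k (x : V) (s : {linear V -> V}) :
  (forall y, s y = r *: y) -> iter k s x = r ^+ k *: x.
Proof.
move=> sE; elim: k => [|k IH]; first by rewrite expr0 scale1r.
by rewrite iterS IH sE scalerA exprS.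
Qed.

(** An r outside p acts surjectively. An r in p acts nilpotently modulo s by [iter_imul], since M =
    P M for every nonzero prime P other than p. *)
Lemma loc_sum_quot_solvable s r (G := range (scale_map loc_sum s)) :
  s != 0 -> solvable r (quotmod G).
Proof.
move=> s0.
have pi0 x : quotmod_pi G x = 0 <-> exists y, x = s *: y.
  by apply: iff_trans (quotmod_range0 _ _) _; split=> -[y]; exists y.
have [pr|pr] := pselect (p r); last first.
  apply: solvable_surj => x; have [v ->] := quotmod_surj x.
  have [w <-] := loc_sum_unit_surj v pr; exists (quotmod_pi G w).
  by rewrite -[LHS](linearZ_LR (quotmod_pi G)).
have [|||k kE] := @iter_imul R loc_sum (scale_map loc_sum r) noethR _ (principal s).
- move=> P Pp Pn; have [Pq|] := pselect (P `<=` p).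
    exists 1%N => x; apply: mem_imul.
    by have [_ _ /(_ P Pp Pn Pq) ->] := ph1.
  move=> /existsNP[t /not_implyP[Pt pt]]; exists 0%N => x.
  by have [y <-] := loc_sum_unit_surj x pt; apply: mem_imul.
- exact: principal_ideal.
- by exists s => //; apply: mem_principal.
apply: (@solvable_nilp _ _ _ k) => x; have [v ->] := quotmod_surj x.
rewrite -[LHS](linearZ_LR (quotmod_pi G)); apply/pi0/imul_principal.
by rewrite -(@iter_scale _ _ _ _ (scale_map loc_sum r)).
Qed.

Lemma height1_enveloping_goldman : enveloping (@contraadjusted R) -> goldman R.
Proof.
move=> /(_ loc_sum)[E [i env]]; have [[CE pre] min] := env.
pose V : lmodType R := quotmod (range i).
pose pi : {linear E -> V} := quotmod_pi (range i).
have Vvf : very_flat V := envelope_cokernel_very_flat env.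
have pis : surjective_map pi := @quotmod_pi_surj _ _ (range i).
have pi0 x : pi x = 0 <-> exists m, i m = x by exact: quotmod_range0.
have pii m : pi (i m) = 0 by apply/pi0; exists m.
(* M embeds into the divisible module of all sequences in Q, and this embedding factors through
   i. *)
have ii : injective i.
  have Yd : contraadjusted (nat -> Q : Type).
    apply: divisible_contraadjusted => s g s0; exists (fun n => (tofrac s)^-1 * g n).
    by apply/funext => n; apply: QscaleVK.
  have [g gE] := pre _ coords Yd.
  by move=> x y e; apply: coords_inj; rewrite !gE /= e.
have Vdiv : divisible_by_all V.
  move=> s v s0; have [e0 <-] := pis v.
  pose G := range (scale_map V s).
  pose rho : {linear V -> quotmod G} := quotmod_pi G.
  have rho0 x : rho x = 0 <-> exists y, x = s *: y.
    by apply: iff_trans (quotmod_range0 _ _) _; split=> -[y]; exists y.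
  pose k : {linear E -> quotmod G} := rho \o pi.
  have ks : surjective_map k.
    by move=> z; have [w <-] := @quotmod_pi_surj _ _ G z; have [x <-] := pis w; exists x.
  have ksplit e : k e = 0 -> exists m e', e = i m + s *: e'.
    move=> /rho0[w]; have [e' <-] := pis w; rewrite -(linearZ_LR pi) => h.
    have /pi0[m mE] : pi (e - s *: e') = 0 by rewrite (linearB pi) h subrr.
    by exists m, e'; rewrite mE subrK.
  (* The kernel is i M + s E. The equations are solved first for the components in M / s M; the
     remaining multiples of s are then treated in E. *)
  have kC : contraadjusted (ker k).
    apply/contraadjustedP => r c.
    have /choice[a /choice[b abE]] n : exists m e', val (c n) = i m + s *: e'.
      exact/ksplit/(kerE (c n)).
    pose H := range (scale_map loc_sum s); have HS : submodule H := range_submodule _.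
    pose eta : {linear loc_sum -> quotmod H} := quotmod_pi H.
    have [y yE] := @loc_sum_quot_solvable s r s0 (fun n => eta (a n)).
    have /choice[m mE] n : exists m, eta m = y n.
      by have [m ->] := quotmod_surj (y n); exists m.
    have /choice[d dE] n : exists d, a n = (m n - r *: m n.+1) + s *: d.
      have : a n - (m n - r *: m n.+1) \in span H.
        apply/quotmod_eq0; rewrite -/eta (linearB eta) -yE (linearB eta).
        by rewrite (linearZ_LR eta) !mE subrr.
      move=> /(spanP _ HS)[d _ dE]; exists d.
      by have -> : s *: d = a n - (m n - r *: m n.+1) by []; rewrite addrC subrK.
    have [z zE] := (contraadjustedP E).1 CE r (fun n => b n + i (d n)).
    have /choice[x xE] n : exists x : ker k, val x = i (m n) + s *: z n.
      apply: ker_mk; apply/rho0; exists (pi (z n)).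
      by rewrite (linearD pi) pii add0r (linearZ_LR pi).
    exists x => n; apply: val_inj.
    have -> : val (x n - r *: x n.+1) = val (x n) - r *: val (x n.+1) by [].
    rewrite !xE abE dE scalerDr opprD addrACA !scalerA (mulrC r s) -scalerA -scalerBr zE.
    rewrite scalerDr (linearD i) (linearB i) !(linearZ_LR i) -[in RHS]addrA.
    by congr (_ + _); exact: addrC.
  have [h hE] := ext1_lift rho ks (Vvf _ kC).
  pose g : {linear E -> E} := idfun \- (h \o pi).
  have [|psi _ Kpsi] := min g.
    by move=> x; rewrite /g /= pii linear0 subr0.
  have /rho0[y yE] : rho (pi e0) = 0.
    rewrite -(Kpsi e0) /g /= (linearB pi) (linearB rho); apply/eqP; rewrite subr_eq0.
    exact/eqP/esym/hE.
  by exists y.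
(* Division by t on M extends to an endomorphism w of E. As w t fixes M, it is an automorphism, so t
   is injective. *)
have Einj t (e : E) : ~ p t -> t *: e = 0 -> e = 0.
  move=> pt te.
  have /choice[u uE] (x : loc_sum) := loc_sum_unit_surj x pt.
  have ul : linear u.
    move=> a x y; apply/subr0_eq/(loc_sum_torsion_free (p_unit_neq0 pt)).
    rewrite scalerBr uE scalerDr scalerA mulrC -scalerA !uE.
    exact: subrr.
  have [u' u'E] := mk_linear ul.
  have [w wE] := pre E (i \o u') CE.
  have [|psi psiK _] := min (w \o scale_map E t).
    move=> m; have := wE (t *: m); rewrite /= u'E => wE'.
    rewrite /= -(linearZ_LR i) -wE'; congr (i _).
    apply/subr0_eq/(loc_sum_torsion_free (p_unit_neq0 pt)).
    by rewrite scalerBr uE subrr.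
  by apply: (can_inj psiK); rewrite /= te scaler0.
have Vinj t (v : V) : ~ p t -> t *: v = 0 -> v = 0.
  move=> pt; have [e <-] := pis v; rewrite -(linearZ_LR pi) => /pi0[m mE].
  have [m' m'E] := loc_sum_unit_surj m pt.
  apply/pi0; exists m'; apply/subr0_eq/(Einj t) => //.
  by rewrite scalerBr -(linearZ_LR i) m'E mE subrr.
(* Let X be the s-torsion of V. Since V = s V is very flat, X -> X / p X extends to V, and the
   extension vanishes because V = s V and s is in p. So X = p X, whence X = s X = 0. *)
have Vtf s (v : V) : s != 0 -> s *: v = 0 -> v = 0.
  move=> s0 sv; have [ps|ps] := pselect (p s); last exact: Vinj sv.
  pose X : lmodType R := ker (scale_map V s).
  pose G := multiples (V := X) p.
  pose q : {linear X -> quotmod G} := quotmod_pi G.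
  have Xsurj t (x : X) : ~ p t -> exists y : X, t *: y = x.
    move=> pt; have [w wE] := Vdiv t (val x) (p_unit_neq0 pt).
    have [|y yE] := @ker_mk _ _ _ (scale_map V s) w.
      apply: (Vinj t) => //; rewrite /= scalerA mulrC -scalerA wE.
      exact: (kerE x).
    by exists y; apply: val_inj; rewrite -wE -yE.
  have BC : contraadjusted (quotmod G).
    apply/contraadjustedP => r; have [pr|pr] := pselect (p r).
      apply: (@solvable_nilp _ _ _ 1) => x; have [y ->] := quotmod_surj x.
      rewrite expr1 -[LHS](linearZ_LR (quotmod_pi G)); apply/quotmod_eq0.
      by apply: span_incl; exists r, y.
    apply: solvable_surj => x; have [y ->] := quotmod_surj x.
    have [w <-] := Xsurj r y pr; exists (quotmod_pi G w).
    by rewrite -[LHS](linearZ_LR (quotmod_pi G)).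
  have ss : surjective_map (scale_map V s) by move=> x; apply: Vdiv.
  have [w wE] := ext1_extend (Vvf _ BC) (short_exact_ker ss) q.
  have Xp x : x \in imul X p.
    apply/quotmod_eq0; rewrite -[LHS]wE; have [y <-] := ss (inclusion _ x).
    rewrite [scale_map _ _ _]/(s *: y) (linearZ_LR w); have [z <-] := @quotmod_pi_surj _ _ G (w y).
    rewrite -[LHS](linearZ_LR (quotmod_pi G)); apply/quotmod_eq0.
    by apply: span_incl; exists s, z.
  have [|||k kE] := @iter_imul R X idfun noethR _ (principal s).
  - move=> P Pp Pn; exists 0%N => x; have [Pq|] := pselect (P `<=` p).
      by have [_ _ /(_ P Pp Pn Pq) ->] := ph1; apply: Xp.
    move=> /existsNP[t /not_implyP[Pt pt]].
    by have [y <-] := Xsurj t x pt; apply: mem_imul.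
  - exact: principal_ideal.
  - by exists s => //; apply: mem_principal.
  have [x <-] : exists x : X, val x = v by apply: ker_mk.
  have [y yE] := imul_principal (kE x).
  have -> : x = s *: y by rewrite -yE; elim: (k) => //= n ->.
  have := kerE y; exact.
have [[v vn0]|V0] := pselect (exists v : V, v <> 0).
  have [|chi chiE] := @functional R V v.
    by move=> r r0 rv; apply: vn0; apply: Vtf rv.
  exact: very_flat_divisible_goldman chiE.
(* If E / M is zero then i is onto, and M would be contraadjusted. *)
case: loc_sum_not_contraadjusted; apply/contraadjustedP => r c.
have [x xE] := (contraadjustedP E).1 CE r (i \o c).
have /choice[y yE] n : exists m, i m = x n.
  by apply/pi0; apply: contrapT => h; apply: V0; exists (pi (x n)).
exists y => n; apply: ii; rewrite (linearB i) (linearZ_LR i) !yE; exact: xE.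
Qed.

End EnvelopingGoldman.

Lemma enveloping_goldman (R : idomainType) :
  noetherian R -> enveloping (@contraadjusted R) -> goldman R.
Proof.
move=> noethR env.
have [[P [Pp [x Px x0]]]|nP] := pselect (exists P, Spec R P /\ nonzero P).
  have [Q [Qh _ _]] := height1_between noethR Pp Px x0.
  exact: (height1_enveloping_goldman noethR Qh env).
(* Without nonzero primes any nonzero s will do. *)
exists 1; split; first exact: oner_neq0.
by move=> P Pp Pn; case: nP; exists P.
Qed.

(** * Finite spectrum and dimension at most one *)

Section SemilocalDimensionOne.
Variable R : idomainType.
Hypotheses (noethR : noetherian R) (dimR : krull_dim_le R 1).

Lemma nonzero_prime_maximal P a :
  Spec R P -> nonzero P -> ~ P a -> exists b, P (1 - b * a).
Proof.
move=> Pp [x Px x0] Pa; have Pi := ideal_prime Pp.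
have [[i [b [Pi' e]]]|na] := pselect (adjoin P a 1).
  by exists b; rewrite e addrK.
have [Q [Qp PQ]] := proper_sub_prime noethR (adjoin_ideal a Pi) na.
pose chain n := if n is m.+1 then (if m is 0 then P else Q) else [set (0 : R)].
suff : (2 <= 1)%N by [].
apply: (dimR (P := chain)) => [[|[|n]] _ //=|[|[|n]] //= _].
- exact: zero_prime.
- split; first by move=> _ ->; apply: ideal0.
  by move=> /(_ _ Px) /eqP; apply/negP.
- split; first by apply: subset_trans PQ; apply: sub_adjoin.
  by move=> QP; apply/Pa/QP/PQ/mem_adjoin.
Qed.

Lemma finite_spec_enum : finite_set (Spec R) ->
  exists (N : nat) (m : 'I_N -> set R), [/\ forall i, Spec R (m i),
    forall i, nonzero (m i), injective m &
    forall P, Spec R P -> nonzero P -> exists i, P = m i].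
Proof.
move=> finS; pose A := [set P | Spec R P /\ nonzero P].
have /finite_setP[N] : finite_set A by apply: sub_finite_set finS => P [].
rewrite card_eq_sym => /card_set_bijP[f [fA fi fs]].
exists N, (fun i : 'I_N => f i).
have fI (i : 'I_N) : A (f i) by exact: fA (ltn_ord i).
split=> [i|i|i j e|P Pp Pn]; try by case: (fI i).
  by apply: val_inj; apply: fi e; apply/mem_set/ltn_ord.
have [n nN <-] := fs P (conj Pp Pn).
by exists (Ordinal nN).
Qed.

End SemilocalDimensionOne.

(** * Reduction modulo finitely many maximal ideals *)

Section MaximalIdeals.
Variables (R : idomainType) (N : nat) (m : 'I_N -> set R).
Hypotheses (mP : forall i, Spec R (m i)) (m_inj : injective m).
Hypothesis mmax : forall i a, ~ m i a -> exists b, m i (1 - b * a).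
Implicit Types M : lmodType R.

Lemma max_incomparable i j : j != i -> exists2 x, m j x & ~ m i x.
Proof.
move=> ji; apply: contrapT => nx.
have ji' : m j `<=` m i.
  by move=> x mx; apply: contrapT => nmx; apply: nx; exists x.
have [ij|/existsNP[a /not_implyP[ia ja]]] := pselect (m i `<=` m j).
  by move/eqP: ji; apply; apply: m_inj; apply/seteqP.
have [b /ji' mb] := mmax ja; apply: (prime1 (mP i)).
have mi := ideal_prime (mP i).
by rewrite -[1](subrK (b * a)); apply: idealD => //; apply: idealMl.
Qed.

Lemma chinese_unit i : exists e, m i (1 - e) /\ forall j, j != i -> m j e.
Proof.
have /choice[x xE] j : exists x, ~ m i x /\ (j != i -> m j x).
  have [->|ji] := eqVneq j i; first by exists 1; split=> //; apply: prime1.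
  by have [x jx ix] := max_incomparable ji; exists x.
pose y := \prod_(j : 'I_N) x j.
have iy : ~ m i y.
  apply: (big_ind (fun z => ~ m i z)) => [|a b ia ib /(primeM (mP i))[]//|j _]; first exact: prime1.
  by case: (xE j).
have [b ib] := mmax iy; exists (b * y); split=> // j ji.
rewrite /y (bigD1 j) //=; have mi := ideal_prime (mP j).
by apply: idealMl => //; apply: idealMr => //; case: (xE j) => _; apply.
Qed.

(** A basis of M / m_i M is lifted to M. [max_independent] only reaches r x with r outside m_i, and
    r is inverted modulo m_i by [mmax]. *)
Lemma basis_mod i M : exists (K : choiceType) (t : K -> M),
  (forall u : {freeg K / R}, fglift t u \in imul M (m i) -> forall k, m i (coeff k u)) /\
  (forall x, exists u : {freeg K / R}, x - fglift t u \in imul M (m i)).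
Proof.
pose G := multiples (V := M) (m i).
pose pi : {linear M -> quotmod G} := quotmod_pi G.
have pi0 x : pi x = 0 <-> x \in imul M (m i) by exact: quotmod_eq0.
have mi := ideal_prime (mP i).
have [|K [t [ti ts]]] := @max_independent R (m i) (quotmod G) (mP i).
  move=> r x mr; have [v <-] := @quotmod_pi_surj _ _ G x.
  by rewrite -[LHS](linearZ_LR pi); apply/pi0/mem_imul.
have /choice[v vE] k : exists v, pi v = t k by apply: quotmod_pi_surj.
have liftE u : pi (fglift v u) = fglift t u.
  apply: (freeg_linear_ext (g := pi \o fglift v) (h := fglift t)) => k.
  by rewrite /= !fglift1; apply: vE.
exists K, v; split=> [u /pi0|x]; first by rewrite liftE => /ti.
have [r [u [mr e]]] := ts (pi x); have [b bE] := mmax mr.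
have h : r *: x - fglift v u \in imul M (m i).
  by apply/pi0; rewrite (linearB pi) (linearZ_LR pi) liftE e subrr.
exists (b *: u).
have -> : x - fglift v (b *: u) = (1 - b * r) *: x + b *: (r *: x - fglift v u).
  rewrite (linearZ_LR (fglift v)) scalerBl scale1r scalerBr scalerA.
  by rewrite -addrA (addrA (- _)) addNr add0r.
by apply: rpredD; [apply: mem_imul|apply: rpredZ].
Qed.

Lemma imul_coeff (K : choiceType) (I : set R) (u : {freeg K / R}) k :
  is_ideal I -> u \in imul {freeg K / R} I -> I (coeff k u).
Proof.
move=> Ii; move: u; apply: imul_ind => [|u v uI vI|a u uI|a u Ia].
- by rewrite coeff0; apply: ideal0.
- by rewrite coeffD; apply: idealD.
- by rewrite coeffZ; apply: idealMl.
by rewrite coeffZ; apply: idealMr.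
Qed.

Lemma coeff_imul (K : choiceType) (I : set R) (u : {freeg K / R}) :
  (forall k, I (coeff k u)) -> u \in imul {freeg K / R} I.
Proof.
move=> uI; rewrite -(freeg_sumE u); apply: rpred_sum => k _.
have -> : << coeff k u *g k >> = coeff k u *: << k >> :> {freeg K / R}.
  by apply/eqP/freeg_eqP => x; rewrite coeffZ !coeffU mul1r.
exact: mem_imul.
Qed.

(* The ranks of M at the various maximal ideals differ; after adding a large
   free module they agree, by the shift n |-> n + 1 on the index set
   [nat * sum of the bases], and the Chinese remainder theorem glues. *)
Lemma equalize_ranks M : exists (K : choiceType) (P : lmodType R)
    (beta : {linear {freeg K / R} -> (M * P)%type}),
  [/\ projective P, K -> (0 < N)%N,
      forall i u, beta u \in imul (M * P)%type (m i) -> forall k, m i (coeff k u) &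
      forall i x, exists u, x - beta u \in imul (M * P)%type (m i)].
Proof.
pose Kf i := sval (cid (basis_mod i M)).
pose t i : Kf i -> M := sval (cid (svalP (cid (basis_mod i M)))).
have tP i := svalP (cid (svalP (cid (basis_mod i M)))).
have tind i : forall u : {freeg (Kf i) / R}, fglift (@t i) u \in imul M (m i) ->
    forall k, m i (coeff k u).
  exact: (tP i).1.
have tgen i : forall x, exists u : {freeg (Kf i) / R}, x - fglift (@t i) u \in imul M (m i).
  exact: (tP i).2.
pose K : choiceType := (nat * {i : 'I_N & Kf i})%type.
pose P : lmodType R := {freeg K / R}.
(* Indices of tag i in row 0 go to the basis of M modulo m_i, those in row n + 1 to the generators
   in row n; all other indices are kept. *)
pose bi i (k : K) : (M * P)%type :=
  if tag k.2 == i then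
    if k.1 is n.+1 then (0, << (n, k.2) >>) else (t (tag k.2) (tagged k.2), 0)
  else (0, << k >>).
pose b i : {linear P -> (M * P)%type} := fglift (bi i).
pose sh i (k : K) : K := if tag k.2 == i then (k.1.+1, k.2) else k.
pose io i (x : Kf i) : K := (0%N, Tagged Kf x).
have b1 i k : b i << k >> = bi i k by exact: fglift1.
have b_sh i k : b i << sh i k >> = (0, << k >>).
  by rewrite b1 /bi /sh; case ki: (tag k.2 == i); rewrite /= ki -?surjective_pairing.
have b_io i x : b i << io i x >> = (t i x, 0) by rewrite b1 /bi /io /= eqxx.
have coeff_b i k u : coeff k (b i u).2 = coeff (sh i k) u.
  elim/freeg_ind: u => [|u v eu ev|a u eu|l]; first by rewrite linear0 !coeff0.
  - by rewrite linearD /= !coeffD eu ev.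
  - by rewrite (linearZ_LR (b i)) /= !coeffZ eu.
  rewrite b1 /bi /sh; case: l k => [n [j x]] [n' [j' x']] /=.
  have [ji|ji] := eqVneq j i; have [j'i|j'i] := eqVneq j' i; rewrite /= ?coeffU.
  + by case: n => [|n] /=; rewrite ?coeff0 ?coeffU ?xpair_eqE /= ?mulr0 ?eqSS.
  + have ne : (existT Kf j x == existT Kf j' x') = false.
      by apply/eqP => e; move/eqP: j'i; apply; rewrite -ji; have := congr1 (@projT1 _ _) e.
    by case: n => [|n] /=; rewrite ?coeff0 ?coeffU ?xpair_eqE ne /= ?andbF ?mulr0.
  + have ne : (existT Kf j x == existT Kf j' x') = false.
      by apply/eqP => e; move/eqP: ji; apply; rewrite -j'i; have := congr1 (@projT1 _ _) e.
    by rewrite !xpair_eqE ne !andbF.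
  by [].
(* [rho i] keeps the coefficients of tag i in row 0, which determine the component in M; [sh i]
   locates the others. *)
pose rho i : {linear P -> {freeg (Kf i) / R}} :=
  fglift (fun k : K => if k.1 == 0%N then untag 0 (fun x => << x >>) k.2 else 0).
have rho1 i (k : K) : rho i << k >> =
    if k.1 == 0%N then untag 0 (fun x => << x >>) k.2 else 0 by exact: fglift1.
have fst_b i u : (b i u).1 = fglift (@t i) (rho i u).
  apply: (freeg_linear_ext (g := fst \o b i) (h := fglift (@t i) \o rho i)) => -[n [j x]].
  rewrite /= [b i _]b1 [rho i _]rho1 /bi /=; have [ji|ji] := eqVneq j i; last first.
    by rewrite untag_dflt // if_same linear0.
  case: n => [|n] /=; last by rewrite linear0.
  case: _ / ji; rewrite /untag; case: eqP => //= e.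
  by rewrite (eq_axiomK e) /= fglift1.
have coeff_rho i x u : coeff x (rho i u) = coeff (io i x) u.
  elim/freeg_ind: u => [|u v eu ev|a u eu|[n [j y]]]; first by rewrite linear0 !coeff0.
  - by rewrite linearD !coeffD eu ev.
  - by rewrite (linearZ_LR (rho i)) !coeffZ eu.
  rewrite rho1 /io /= coeffU mul1r xpair_eqE; have [ji|ji] := eqVneq j i; last first.
    rewrite untag_dflt // if_same coeff0.
    have -> : (existT Kf j y == Tagged Kf x) = false; last by rewrite andbF.
    by apply/eqP => e; move/eqP: ji; apply; have := congr1 (@projT1 _ _) e.
  case: n => [|n] /=; last by rewrite coeff0.
  case: _ / ji x => x; rewrite /untag; case: eqP => //= e'.
  by rewrite (eq_axiomK e') /= coeffU mul1r eq_Tagged.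
have b_ind i u : b i u \in imul (M * P)%type (m i) -> forall k, m i (coeff k u).
  move=> bu; have mi := ideal_prime (mP i).
  have snd_u k : m i (coeff (sh i k) u).
    by rewrite -coeff_b; apply: imul_coeff => //; exact: (imul_map snd bu).
  have fst_u x : m i (coeff (io i x) u).
    rewrite -coeff_rho; apply: tind; rewrite -fst_b; exact: (imul_map fst bu).
  move=> [n [j x]]; have [ji|ji] := eqVneq j i; last first.
    by have := snd_u (n, existT Kf j x); rewrite /sh /= (negPf ji).
  case: n => [|n]; last by have := snd_u (n, existT Kf j x); rewrite /sh /= (introT eqP ji).
  by case: _ / ji fst_u => h; apply: (h x).
have b_gen i x : exists u, x - b i u \in imul (M * P)%type (m i).
  case: x => y v; have [w wE] := tgen i y.
  pose lam : {linear P -> P} := fglift (fun k => << sh i k >> : P).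
  pose mu : {linear {freeg (Kf i) / R} -> P} := fglift (fun x => << io i x >> : P).
  have lamE : b i (lam v) = (0, v).
    have l2 : linear (fun u : P => (0, u) : (M * P)%type).
      by move=> a p q; congr (_, _); rewrite //= scaler0 addr0.
    have [i2 i2E] := mk_linear l2; rewrite -[RHS]i2E.
    apply: (freeg_linear_ext (g := b i \o lam) (h := i2)) => k.
    by rewrite /= [lam _]fglift1 b_sh i2E.
  have muE : b i (mu w) = (fglift (@t i) w, 0).
    have l1 : linear (fun u : M => (u, 0) : (M * P)%type).
      by move=> a p q; congr (_, _); rewrite //= scaler0 addr0.
    have [i1 i1E] := mk_linear l1; rewrite -[RHS]i1E.
    apply: (freeg_linear_ext (g := b i \o mu) (h := i1 \o fglift (@t i))) => k.
    by rewrite /= [mu _]fglift1 b_io i1E fglift1.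
  have l1 : linear (fun u : M => (u, 0) : (M * P)%type).
    by move=> a p q; congr (_, _); rewrite //= scaler0 addr0.
  have [i1 i1E] := mk_linear l1.
  exists (lam v + mu w); rewrite (linearD (b i)) lamE muE.
  have -> : (y, v) - ((0, v) + (fglift (@t i) w, 0)) = i1 (y - fglift (@t i) w).
    by rewrite i1E; congr (_, _) => /=; rewrite ?add0r // addr0 subrr.
  exact: imul_map.
have /choice[e eP] := chinese_unit.
pose beta : {linear P -> (M * P)%type} :=
  fglift (fun k => \sum_(i < N) e i *: bi i k).
have betaE u : beta u = \sum_(i < N) e i *: b i u.
  elim/freeg_ind: u => [|u v eu ev|a u eu|k].
  - by rewrite linear0 big1 // => i _; rewrite linear0 scaler0.
  - rewrite linearD eu ev -big_split; apply: eq_bigr => i _.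
    by rewrite linearD scalerDr.
  - rewrite (linearZ_LR beta) eu scaler_sumr; apply: eq_bigr => i _.
    by rewrite (linearZ_LR (b i)) !scalerA mulrC.
  by rewrite [LHS]fglift1; apply: eq_bigr => i _; rewrite b1.
have beta_b i u : beta u - b i u \in imul (M * P)%type (m i).
  rewrite betaE (bigD1 i) //=.
  have -> : e i *: b i u + \sum_(j < N | j != i) e j *: b j u - b i u =
      - ((1 - e i) *: b i u) + \sum_(j < N | j != i) e j *: b j u.
    by rewrite addrAC scalerBl scale1r opprB.
  apply: rpredD; first by rewrite rpredN; apply: mem_imul; case: (eP i).
  by apply: rpred_sum => j ji; apply: mem_imul; case: (eP j) => _; apply; rewrite eq_sym.
exists K, P, beta; split.
- exact: projective_freeg.
- by case=> _ [i _]; apply: leq_ltn_trans (ltn_ord i).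
- move=> i u bu; apply: b_ind.
  by rewrite -[b i u](subrK (beta u)) rpredD // -opprB rpredN.
move=> i x; have [u uE] := b_gen i x; exists u.
have -> : x - beta u = (x - b i u) - (beta u - b i u).
  by rewrite opprB addrA subrK.
by apply: rpredB.
Qed.

End MaximalIdeals.

(** * Completion along an element *)

Section Completion.
Variables (R : comNzRingType) (B M : lmodType R) (beta : {linear B -> M}) (s : R).

(* A pair (b, y) encodes the formal sum of the [s ^+ n *: b n], where [y n] is
   the image in M of its n-th tail. *)
Definition tails : set ((nat -> B) * (nat -> M)) :=
  [set g | forall n, g.2 n = beta (g.1 n) + s *: g.2 n.+1].

(** Formal sums that telescope to z_0 = 0, with z_n as the value of the n-th tail. *)
Definition null_tails : set ((nat -> B) * (nat -> M)) :=
  [set g | exists z : nat -> B, z 0%N = 0 /\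
     forall n, g.1 n = z n - s *: z n.+1 /\ g.2 n = beta (z n)].

Lemma tails_submodule : submodule tails.
Proof.
apply: submoduleP => [n|x y tx ty n|a x tx n].
- have -> : (0 : (nat -> B) * (nat -> M)).1 n = 0 by [].
  have z m : (0 : (nat -> B) * (nat -> M)).2 m = 0 by [].
  by rewrite !z linear0 scaler0 add0r.
- suff : x.2 n + y.2 n = beta (x.1 n + y.1 n) + s *: (x.2 n.+1 + y.2 n.+1) by [].
  by rewrite (linearD beta) scalerDr addrACA -tx -ty.
suff : a *: x.2 n = beta (a *: x.1 n) + s *: (a *: x.2 n.+1) by [].
by rewrite (linearZ_LR beta) scalerA mulrC -scalerA -scalerDr -tx.
Qed.

Lemma null_tails_submodule : submodule null_tails.
Proof.
apply: submoduleP => [|x y [z [z0 zx]] [w [w0 wy]]|a x [z [z0 zx]]].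
- exists (fun=> 0); split=> // n; split.
    by suff : 0 = 0 - s *: 0 :> B by []; rewrite scaler0 subr0.
  by suff : 0 = beta 0 by []; rewrite linear0.
- exists (fun n => z n + w n); rewrite z0 w0 addr0; split=> // n.
  have [[e1 e2] [e3 e4]] := (zx n, wy n); split.
    suff : x.1 n + y.1 n = z n + w n - s *: (z n.+1 + w n.+1) by [].
    by rewrite e1 e3 scalerDr opprD addrACA.
  suff : x.2 n + y.2 n = beta (z n + w n) by [].
  by rewrite e2 e4 (linearD beta).
exists (fun n => a *: z n); rewrite z0 scaler0; split=> // n.
have [e1 e2] := zx n; split.
  suff : a *: x.1 n = a *: z n - s *: (a *: z n.+1) by [].
  by rewrite e1 scalerBr !scalerA mulrC.
suff : a *: x.2 n = beta (a *: z n) by [].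
by rewrite e2 (linearZ_LR beta).
Qed.

(** F is [tails] modulo [null_tails], f reads off y_0, and iota puts b in degree 0. Dropping the
    term b_0 divides by s up to iota b_0. On the kernel y_0 = 0, which allows infinite series to be
    summed coefficientwise. *)
Lemma completion : exists (F : lmodType R) (f : {linear F -> M}) (iota : {linear B -> F}),
  [/\ forall b, f (iota b) = beta b,
      (forall x, exists b y, x = beta b + s *: y) -> surjective_map f,
      (forall z : nat -> B, (forall n, z n = s *: z n.+1) -> z 0%N = 0) -> injective iota,
      forall x, exists b y, x = iota b + s *: y &
      forall x b, s *: x = iota b -> exists b', x = iota b'] /\
  solvable s (ker f) /\
  forall x : nat -> F, (forall n, f (x n) = 0) -> (forall n, x n = s *: x n.+1) -> x 0%N = 0.
Proof.
pose W : lmodType R := ((nat -> B) * (nat -> M))%type.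
pose T : lmodType R := submod_of tails.
pose inT : {linear T -> W} := inclusion _.
have inTP g : tails (inT g) := submod_ofP tails_submodule g.
have inT_inj : injective inT by exact: val_inj.
have mkT (w : W) : tails w -> exists g, inT g = w by move=> /submod_of_mk.
pose S : set T := [set g | null_tails (inT g)].
have NS : forall w, w \in span null_tails <-> null_tails w.
  by move=> w; apply: spanP; exact: null_tails_submodule.
have SS : submodule S.
  apply: submoduleP => [|x y|a x]; rewrite /S /mkset.
  - by rewrite (linear0 inT); apply/NS; rewrite rpred0.
  - by move=> /NS Sx /NS Sy; apply/NS; rewrite (linearD inT) rpredD.
  by move=> /NS Sx; apply/NS; rewrite (linearZ_LR inT) rpredZ.
pose F : lmodType R := quotmod S.
pose pi : {linear T -> F} := quotmod_pi S.
have pis : surjective_map pi := @quotmod_pi_surj _ _ S.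
have pi0 g : pi g = 0 <-> null_tails (inT g).
  by exact: quotmod_submod0.
pose rep (x : F) (b : nat -> B) (y : nat -> M) := exists g, inT g = (b, y) /\ pi g = x.
have rep_ex x : exists b y, rep x b y.
  have [g <-] := pis x; exists (inT g).1, (inT g).2, g.
  by rewrite -surjective_pairing.
have rep_tails x b y : rep x b y -> forall n, y n = beta (b n) + s *: y n.+1.
  by move=> [g [e _]] n; have := inTP g n; rewrite e.
have rep_mk b y : (forall n, y n = beta (b n) + s *: y n.+1) -> exists x, rep x b y.
  by move=> t; have [|g gE] := mkT (b, y); [exact: t|exists (pi g), g].
have repD a x x' b b' y y' : rep x b y -> rep x' b' y' ->
    rep (a *: x + x') (fun n => a *: b n + b' n) (fun n => a *: y n + y' n).
  move=> [g [e <-]] [g' [e' <-]]; exists (a *: g + g').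
  by rewrite (linearP inT) (linearP pi) e e'.
have rep0 x b y : rep x b y -> x = 0 <-> exists z : nat -> B, z 0%N = 0 /\
    forall n, b n = z n - s *: z n.+1 /\ y n = beta (z n).
  by move=> [g [e <-]]; apply: iff_trans (pi0 _) _; rewrite e.
pose ev0 (g : T) : M := (inT g).2 0%N.
have evl : linear ev0 by move=> a g h; rewrite /ev0 (linearP inT).
have [ev evE] := mk_linear evl.
have [|f fE] := factor_surj pis (g := ev).
  by move=> g /pi0[z [z0 /(_ 0%N)[_ e]]]; rewrite evE /ev0 e z0 linear0.
have repf x b y : rep x b y -> f x = y 0%N.
  by move=> [g [e <-]]; rewrite fE evE /ev0 e.
pose one (b : B) (n : nat) : B := if n is 0 then b else 0.
pose oneM (x : M) (n : nat) : M := if n is 0 then x else 0.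
have /choice[io ioE] b : exists x, rep x (one b) (oneM (beta b)).
  by apply: rep_mk => -[|n] /=; rewrite !linear0 addr0.
have rep_inj x x' b y : rep x b y -> rep x' b y -> x = x'.
  by move=> [g [e <-]] [g' [e' <-]]; congr (pi _); apply: inT_inj; rewrite e e'.
have iol : linear io.
  move=> a b b'; apply: (rep_inj _ _ (one (a *: b + b')) (oneM (beta (a *: b + b')))) => //.
  have -> : one (a *: b + b') = (fun n => a *: one b n + one b' n).
    apply/funext => -[//|n].
    by suff : 0 = a *: 0 + 0 :> B by []; rewrite scaler0 addr0.
  have -> : oneM (beta (a *: b + b')) = (fun n => a *: oneM (beta b) n + oneM (beta b') n).
    apply/funext => -[|n]; first exact: linearP.
    by suff : 0 = a *: 0 + 0 :> M by []; rewrite scaler0 addr0.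
  exact: repD.
have [iota iotaE] := mk_linear iol.
have rep_iota b : rep (iota b) (one b) (oneM (beta b)) by rewrite iotaE.
have rep_eq x x' b b' y y' : rep x b y -> rep x' b' y' -> x = x' <->
    exists z : nat -> B, z 0%N = 0 /\
      forall n, b n = b' n + (z n - s *: z n.+1) /\ y n = y' n + beta (z n).
  move=> rx rx'; have := rep0 _ _ _ (repD (-1) _ _ _ _ _ _ rx' rx).
  rewrite scaleN1r => h; split=> [e|[z [z0 zE]]].
    have /h[z [z0 zE]] : - x' + x = 0 by rewrite e addNr.
    exists z; split=> // n; have [<- <-] := zE n.
    by rewrite !scaleN1r !addrA !subrr !add0r.
  apply/subr0_eq; rewrite addrC; apply/h; exists z; split=> // n.
  by have [-> ->] := zE n; rewrite !scaleN1r !addrA !addNr !add0r.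
(* A witness in [null_tails] has to start with 0, hence the change at 0. *)
pose cut (z : nat -> B) (n : nat) : B := if n is 0 then 0 else z n.
have shift x b y x' : rep x b y -> rep x' (fun n => b n.+1) (fun n => y n.+1) ->
    x = s *: x' + iota (b 0%N).
  move=> rx rx'; have ty := rep_tails _ _ _ rx.
  apply/(rep_eq _ _ _ _ _ _ rx (repD s _ _ _ _ _ _ rx' (rep_iota (b 0%N)))).
  exists (cut b); split=> // -[|n] /=; split.
  - by rewrite sub0r addrC addrA addNr add0r.
  - by rewrite linear0 addr0 ty addrC.
  - by rewrite addr0 addrC subrK.
  by rewrite addr0 ty addrC.
exists F, f, iota; split; [split|split].
- by move=> b; rewrite (repf _ _ _ (rep_iota b)).
- move=> h x; have /choice[bf /choice[yf byE]] := h.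
  have [|z /repf zE] := rep_mk (fun n => bf (iter n yf x)) (fun n => iter n yf x).
    by move=> n; rewrite iterS -byE.
  by exists z.
(* From a witness z, the sequence b - b', - z_1, - z_2, ... consists of successive quotients by
   s. *)
- move=> sep b b' /eqP; rewrite -subr_eq0 -linearB => /eqP ib; apply: subr0_eq.
  have /(rep0 _ _ _ (rep_iota _))[z [z0 zE]] := ib.
  apply: (sep (fun n => if n is m.+1 then - z m.+1 else b - b')) => -[|n].
    by have -> : b - b' = z 0%N - s *: z 1%N := (zE 0%N).1; rewrite z0 sub0r scalerN.
  have /esym/subr0_eq -> : 0 = z n.+1 - s *: z n.+2 := (zE n.+1).1.
  by rewrite scalerN.
- move=> x; have [b [y rx]] := rep_ex x; have ty := rep_tails _ _ _ rx.
  have [x' rx'] := rep_mk (fun n => b n.+1) (fun n => y n.+1) (fun n => ty n.+1).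
  by exists (b 0%N), x'; rewrite addrC; exact: shift rx rx'.
- move=> x b sx; have [b' [y rx]] := rep_ex x; have ty := rep_tails _ _ _ rx.
  have := rep0 _ _ _ (repD s _ _ _ _ _ _ rx (rep_iota (- b))).
  rewrite linearN sx subrr => -[/(_ erefl)[z [z0 zE]] _].
  pose w n := b' n + z n.+1.
  have zS n : z n.+1 = s *: w n.+1.
    have [e _] := zE n.+1; move: e; rewrite /= addr0 => e.
    by rewrite /w scalerDr e subrK.
  have yS n : y n = beta (w n).
    rewrite ty /w (linearD beta); congr (_ + _).
    by have [_ e] := zE n.+1; rewrite -e /= addr0.
  exists (w 0%N); apply/(rep_eq _ _ _ _ _ _ rx (rep_iota (w 0%N))).
  exists (cut w); split=> // -[|n] /=; split.
  + by rewrite sub0r -zS /w addrK.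
  + by rewrite linear0 addr0 yS.
  + by rewrite add0r -zS /w addrK.
  by rewrite add0r yS.
- move=> c; have /choice[b /choice[y byE]] n : exists b y, rep (val (c n)) b y.
    exact: rep_ex.
  have y0 n : y n 0%N = 0 by rewrite -(repf _ _ _ (byE n)); apply: (kerE (c n)).
  have ty n := rep_tails _ _ _ (byE n).
  (* [Bx k n] is the coefficient of s^k in the sum of the s^j c_(n+j), that is, a sum over an
     antidiagonal; [Y] does the same for the tails. *)
  pose Bx := fix Bx k n := if k is l.+1 then b n l.+1 + Bx l n.+1 else b n 0%N.
  pose Y := fix Y k n := if k is l.+1 then y n l.+1 + Y l n.+1 else y n 0%N.
  have Y0 n : Y 0%N n = 0 by exact: y0.
  have B0 n : Bx 0%N n = b n 0%N by [].
  have YS k n : Y k.+1 n = y n k.+1 + Y k n.+1 by [].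
  have BS k n : Bx k.+1 n = b n k.+1 + Bx k n.+1 by [].
  clearbody Y Bx.
  have Yt k n : Y k n = beta (Bx k n) + s *: Y k.+1 n.
    elim: k n => [|k IH] n; first by rewrite YS !Y0 addr0 B0 -ty y0.
    by rewrite YS IH ty BS (YS k.+1) (linearD beta) [in RHS]scalerDr addrACA.
  have /choice[x' rx'] n : exists x, rep x (Bx^~ n) (Y^~ n) by apply: rep_mk => k; apply: Yt.
  have /choice[x xE] n : exists x : ker f, val x = x' n.
    by apply: ker_mk; rewrite (repf _ _ _ (rx' n)) Y0.
  exists x => n; apply: val_inj.
  have -> : val (x n - s *: x n.+1) = val (x n) - s *: val (x n.+1) by [].
  rewrite !xE; apply/eqP; rewrite subr_eq addrC; apply/eqP.
  apply/(rep_eq _ _ _ _ _ _ (rx' n) (repD s _ _ _ _ _ _ (rx' n.+1) (byE n))).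
  exists (fun k => if k is l.+1 then Bx l n.+1 else 0); split=> // -[|k]; split.
  + by rewrite sub0r !B0 addrAC subrr add0r.
  + by rewrite linear0 addr0 !Y0 y0 scaler0 addr0.
  + suff : Bx k.+1 n =
        s *: Bx k.+1 n.+1 + b n k.+1 + (Bx k n.+1 - s *: Bx k.+1 n.+1) by [].
    by rewrite BS [RHS]addrC addrA subrK addrC.
  suff : Y k.+1 n = s *: Y k.+1 n.+1 + y n k.+1 + beta (Bx k n.+1) by [].
  by rewrite YS Yt addrCA [LHS]addrC [y n _ + _]addrC.
move=> x fx xs.
have /choice[b /choice[y byE]] n : exists b y, rep (x n) b y by exact: rep_ex.
have y0 n : y n 0%N = 0 by rewrite -(repf _ _ _ (byE n)).
have ty n := rep_tails _ _ _ (byE n).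
have rep00 : rep 0 (fun=> 0) (fun=> 0).
  by exists 0; rewrite (linear0 inT) (linear0 pi).
have /choice[z zE] n : exists z : nat -> B, z 0%N = 0 /\ forall k,
    b n k = s *: b n.+1 k + (z k - s *: z k.+1) /\ y n k = s *: y n.+1 k + beta (z k).
  have := rep_eq _ _ _ _ _ _ (byE n) (repD s _ _ _ _ _ _ (byE n.+1) rep00).
  rewrite addr0 -xs => -[/(_ erefl)[z [z0 h]] _]; exists z; split=> // k.
  by have [-> ->] := h k; rewrite !addr0.
have z0 n : z n 0%N = 0 by case: (zE n).
(* The term z_n(l+1) - b_(n+1)(l) witnesses that x_n is also represented by b_(n+1) shifted one
   place up. Repeated shifts clear every coordinate, and in each only finitely many witnesses add
   up. *)
pose w := fix w k n := if k is l.+1 then (z n l.+1 - b n.+1 l) + w l n.+1 else 0.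
have w0 n : w 0%N n = 0 by [].
have wS l n : w l.+1 n = (z n l.+1 - b n.+1 l) + w l n.+1 by [].
clearbody w.
have wE k n : b n k = w k n - s *: w k.+1 n /\ y n k = beta (w k n).
  elim: k n => [|k IH] n.
    split; last by rewrite y0 w0 linear0.
    have [_ /(_ 0%N)[e _]] := zE n; rewrite e z0 wS !w0 addr0 !sub0r scalerBr opprB.
    by [].
  have [_ /(_ k.+1)[e1 e2]] := zE n; have [e3 e4] := IH n.+1.
  have w1 : w k.+1 n = z n k.+1 + s *: w k.+1 n.+1.
    by rewrite wS e3 opprB addrA subrK.
  split.
    rewrite e1 w1 [w k.+2 n]wS scalerDr opprD addrACA subrr addr0.
    by rewrite scalerBr opprB addrCA.
  by rewrite wS (linearD beta) (linearB beta) -e4 (ty n.+1 k) addrA subrK e2 addrC.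
apply/(rep0 _ _ _ (byE 0%N)); by exists (w^~ 0%N); split=> // k; apply: wE.
Qed.

End Completion.

(** The vanishing of Tor_1(M, R/I) for all ideals I, in elementary terms. *)
Definition tor_free (R : idomainType) (M : lmodType R) : Prop :=
  forall (F : lmodType R) (f : {linear F -> M}) (I : set R),
    surjective_map f -> is_ideal I ->
    forall x : ker f, val x \in imul F I -> x \in imul (ker f) I.

(** * Special covers when the nonzero primes are finitely many and maximal *)

Section SemilocalCovers.
Variables (R : idomainType) (N : nat) (m : 'I_N -> set R) (s : R).
Hypotheses (noethR : noetherian R) (mP : forall i, Spec R (m i)).
Hypotheses (m_inj : injective m) (s_neq0 : s != 0) (ms : forall i, m i s).
Hypothesis mall : forall P, Spec R P -> nonzero P -> exists i, P = m i.
Hypothesis mmax : forall i a, ~ m i a -> exists b, m i (1 - b * a).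
Implicit Types B C D E F M P V : lmodType R.

(** By [prime_ind] every nonzero ideal contains a power of s; so inverting s gives the fraction
    field. *)
Lemma power_multiple r : r != 0 -> exists k b, s ^+ k = b * r.
Proof.
move=> r0; suff : nonzero (principal r) -> exists k, principal r (s ^+ k).
  by case=> [|k [b e]]; [exists r => //; apply: mem_principal|exists k, b].
apply: (prime_ind noethR (S := fun I => nonzero I -> exists k, I (s ^+ k))).
- by move=> _; exists 0%N.
- by move=> P Pp Pn; have [i ->] := mall Pp Pn; exists 1%N; apply: ms.
- move=> I a b Ii Iab Sa Sb [x Ix x0].
  have n c : nonzero (adjoin I c) by exists x => //; apply: sub_adjoin.
  have [k [i [c [Ic e]]]] := Sa (n a); have [l [j [d [Jd e']]]] := Sb (n b).
  exists (k + l)%N; rewrite exprD e e'.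
  have -> : (i + c * a) * (j + d * b) = (j + d * b) * i + (c * a * j + c * d * (a * b)) by ring.
  by apply: idealD => //; [|apply: idealD => //]; apply: idealMl.
exact: principal_ideal.
Qed.

(** D is a vector space over the fraction field. For a basis t, the elements s^(-n) t_k present it
    as a telescope for s. *)
Lemma vector_space_ext1 D C : (forall x : D, exists y, s *: y = x) ->
  (forall x : D, s *: x = 0 -> x = 0) -> solvable s C -> Ext1_eq0 D C.
Proof.
move=> /choice[h hE] sD sC.
have [|K [t [ti ts]]] := @max_independent R [set 0] D (zero_prime R).
  by move=> r x ->; rewrite scale0r.
have sDn n (x : D) : s ^+ n *: x = 0 -> x = 0.
  by elim: n => [|n IH]; [rewrite scale1r|rewrite exprS -scalerA => /sD].
have hn n x : s ^+ n *: iter n h x = x.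
  elim: n => [|n IH]; first by rewrite scale1r.
  by rewrite iterS exprSr -scalerA hE.
have lE n v : s ^+ n *: fglift (fun k => iter n h (t k)) v = fglift t v.
  apply: (freeg_linear_ext (g := scale_map D (s ^+ n) \o fglift _) (h := fglift t)) => k.
  by rewrite /= !fglift1.
apply: (ext1_tel (r := s) (t := fun k : K * nat => iter k.2 h (t k.1))) => //.
apply: tel_exact => /= [k n|x|n v v0].
- by rewrite hE.
- have [r [u [/eqP r0 ru]]] := ts x; have [n [b sb]] := power_multiple r0.
  exists n, (b *: u); apply/subr0_eq/(sDn n); rewrite scalerBr lE.
  by rewrite sb -scalerA ru linearZ_LR subrr.
exists 0%N; rewrite scale1r; apply: freeg_coeff0 => k.
by apply: ti; rewrite -(lE n) v0 scaler0.
Qed.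

(** A nonzero coefficient divides some s^n. Being divisible by s^(n+1) as well, it would make s a
    unit, although s lies in some m_i. *)
Lemma freeg_separated (K : choiceType) (z : nat -> {freeg K / R}) :
  (K -> (0 < N)%N) -> (forall n, z n = s *: z n.+1) -> z 0%N = 0.
Proof.
move=> KN zs; apply: freeg_coeff0 => k; have [j i0] := (KN k, Ordinal (KN k)).
have zn n : coeff k (z 0%N) = s ^+ n * coeff k (z n).
  elim: n => [|n ->]; first by rewrite mul1r.
  by rewrite zs coeffZ mulrA exprSr.
apply: contrapT => /eqP /power_multiple[n [b]].
rewrite (zn n.+1) mulrCA exprSr -[LHS]mulr1 -!mulrA => /(mulfI (expf_neq0 _ s_neq0)) e.
apply: (prime1 (mP i0)); rewrite e; have mi := ideal_prime (mP i0).
exact: idealMr.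
Qed.

(** The completion is first built over M + P. As P is projective, the part lying over M is a direct
    summand and inherits the properties. *)
Lemma special_cover M : exists F (f : {linear F -> M}),
  [/\ surjective_map f, forall C, solvable s C -> Ext1_eq0 F C,
      forall i (x : F), f x = 0 -> x \in imul F (m i) &
      forall x : F, s *: x = 0 -> x = 0] /\
  solvable s (ker f) /\
  forall x : nat -> F, (forall n, f (x n) = 0) -> (forall n, x n = s *: x n.+1) -> x 0%N = 0.
Proof.
have [K [P [beta [Pp KN b_ind b_gen]]]] := equalize_ranks mP m_inj mmax M.
have [F [f [iota [[fi fs ii iF iD] [fsolv funiq]]]]] := completion beta s.
have imul_s V i (x : V) : s *: x \in imul V (m i) by apply/mem_imul/ms.
(* The cokernel of beta equals m_i times itself for all i, hence s times itself; so beta is onto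
   modulo s. *)
have {}fs : surjective_map f.
  apply: fs => x; pose S := range beta.
  pose pi : {linear (M * P)%type -> quotmod S} := quotmod_pi S.
  have pi0 y : pi y = 0 <-> exists u, beta u = y by exact: quotmod_range0.
  have [|||k kE] := @iter_imul R (quotmod S) idfun noethR _ (principal s).
  - move=> Q Qp Qn; exists 0%N => y; have [i ->] := mall Qp Qn.
    have [v <-] := @quotmod_pi_surj _ _ S y; have [u uE] := b_gen i v.
    have -> : quotmod_pi S v = pi (v - beta u).
      by rewrite (linearB pi) (_ : pi (beta u) = 0) ?subr0 //; apply/pi0; exists u.
    exact: imul_map.
  - exact: principal_ideal.
  - by exists s => //; apply: mem_principal.
  have [y yE] := imul_principal (kE (pi x)).
  have [w wE] := @quotmod_pi_surj _ _ S y.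
  have /pi0[u uE] : pi (x - s *: w) = 0.
    rewrite (linearB pi) (linearZ_LR pi) [pi w]wE -yE.
    by rewrite (_ : iter k idfun (pi x) = pi x) ?subrr //; elim: (k) => //= n ->.
  by exists u, w; rewrite uE subrK.
have {}ii : injective iota by apply: ii => z; apply: freeg_separated.
have Fs (x : F) : s *: x = 0 -> x = 0.
  move=> sx; have [|b bE] := iD x 0; first by rewrite linear0.
  have : s *: b = 0 by apply: ii; rewrite linear0 linearZ_LR -bE.
  move=> sb; rewrite bE (_ : b = 0) ?linear0 //; apply: freeg_coeff0 => k.
  have := congr1 (coeff k) sb; rewrite coeffZ coeff0 => /eqP.
  by rewrite mulf_eq0 (negPf s_neq0) => /eqP.
(* F is an extension of F / iota B, on which s is bijective, by the free module B. *)
have Fext C : solvable s C -> Ext1_eq0 F C.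
  move=> sC; pose S := range iota.
  pose pi : {linear F -> quotmod S} := quotmod_pi S.
  have pi0 y : pi y = 0 <-> exists u, iota u = y by exact: quotmod_range0.
  have se : short_exact iota pi by split=> //; apply: quotmod_pi_surj.
  apply: (ext1_ext se); first exact/ext1_projective/projective_freeg.
  apply: vector_space_ext1 => // x; have [y <-] := @quotmod_pi_surj _ _ S x.
    have [b [w ->]] := iF y; exists (pi w).
    rewrite -(linearZ_LR pi) [RHS](linearD pi) (_ : pi (iota b) = 0) ?add0r //.
    by apply/pi0; exists b.
  rewrite -[_ *: _](linearZ_LR pi) => /pi0[b bE].
  by apply/pi0; have [b' ->] := iD _ _ (esym bE); exists b'.
(* If iota b + s y is in the kernel, then beta b is zero modulo m_i, and so are the coefficients of
   b. *)
have Fker i (x : F) : f x = 0 -> x \in imul F (m i).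
  have [b [y ->]] := iF x; rewrite linearD linearZ_LR fi => /eqP.
  rewrite addr_eq0 => /eqP e; apply: rpredD; [|exact: imul_s].
  apply: (imul_map iota); apply: coeff_imul.
  by apply: b_ind; rewrite e rpredN; apply: imul_s.
pose p2 : {linear F -> P} := snd \o f.
have p2s : surjective_map p2 by move=> y; have [x xE] := fs (0, y); exists x; rewrite /p2 /= xE.
have [g gE] := Pp _ _ p2 idfun p2s.
have p2g y : p2 (g y) = y by exact/esym/gE.
pose F1 : lmodType R := ker p2; pose inc : {linear F1 -> F} := inclusion p2.
have inc_inj : injective inc by exact: val_inj.
pose f1 : {linear F1 -> M} := fst \o (f \o inc).
have f1E x : f1 x = 0 <-> f (inc x) = 0.
  split=> [e|e]; last by rewrite /f1 /= [f _]e.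
  by rewrite [LHS]surjective_pairing [X in (X, _)]e [X in (_, X)](kerE x).
have [|ret retE] := ker_lift (f := p2) (h := idfun \- (g \o p2)).
  by move=> x; rewrite linearB [p2 (g _)]p2g subrr.
have ret_inc x : ret (inc x) = x.
  apply: inc_inj.
  have -> : inc (ret (inc x)) = inc x - g (p2 (inc x)) by exact: retE.
  have -> : p2 (inc x) = 0 by exact: (kerE x).
  by rewrite linear0 subr0.
exists F1, f1; split; [split|split].
- move=> y; have [x xE] := fs (y, 0).
  have [|x1 x1E] := @ker_mk _ _ _ p2 x; first by rewrite /p2 /= xE.
  by exists x1; have -> : f1 x1 = (f (inc x1)).1 by []; rewrite [inc x1]x1E xE.
- by move=> C /Fext; apply: ext1_retract ret_inc.
- by move=> i x /f1E /(Fker i) /(imul_map ret); rewrite ret_inc.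
- by move=> x sx; apply: inc_inj; rewrite linear0; apply: Fs; rewrite -linearZ_LR sx linear0.
- move=> c; have /choice[d dE] n : exists d : ker f, val d = inc (val (c n)).
    by apply: ker_mk; apply/f1E/(kerE (c n)).
  have [x xE] := fsolv d.
  have /choice[y yE] n : exists y : F1, inc y = val (x n).
    by apply: ker_mk; rewrite /p2 /= kerE.
  have /choice[z zE] n : exists z : ker f1, val z = y n.
    by apply: ker_mk; apply/f1E; rewrite yE kerE.
  exists z => n; apply: val_inj; apply: inc_inj; rewrite -dE -xE.
  have -> : val (z n - s *: z n.+1) = val (z n) - s *: val (z n.+1) by [].
  by rewrite !zE (linearB inc) (linearZ_LR inc) !yE.
move=> x fx xs; apply: inc_inj; rewrite linear0.
apply: (funiq (fun n => inc (x n))) => n; first exact/f1E.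
by rewrite -linearZ_LR -xs.
Qed.

(** The kernel K of the special cover lies in m_i F, so K = m_i K for all i by Tor-freeness, and K =
    s K. Uniqueness of s-divisible chains gives K = 0, so M is isomorphic to F. *)
Lemma tor_free_ext1 M C : tor_free M -> solvable s C -> Ext1_eq0 M C.
Proof.
move=> tM sC; have [F [f [[fs Fext Fker Fs] [_ funiq]]]] := special_cover M.
have [|||k kE] := @iter_imul R (ker f) idfun noethR _ (principal s).
- move=> Q Qp Qn; exists 0%N => x; have [i ->] := mall Qp Qn.
  apply: (tM F f (m i)) => //; first exact: ideal_prime.
  exact/Fker/(kerE x).
- exact: principal_ideal.
- by exists s => //; apply: mem_principal.
have /choice[h hE] (x : ker f) : exists y, x = s *: y.
  have [y yE] := imul_principal (kE x); exists y; rewrite -yE.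
  by elim: (k) => //= n <-.
have ker0 (x : ker f) : x = 0.
  apply: val_inj; apply: (funiq (fun n => val (iter n h x))) => n; first exact: kerE.
  by rewrite iterS {1}(hE (iter n h x)).
have [|g gE] := factor_surj fs (g := idfun).
  by move=> x /ker_mk[y <-]; rewrite (ker0 y).
apply: (ext1_retract (i := g) (p := f)); last exact: Fext.
by move=> x; have [y <-] := fs x; rewrite gE.
Qed.

(** Sending (y, a) to a times a lift of y is a bilinear map from M and I to F / (I ker f). An x in I
    F comes from a T in M tensor I whose image in M tensor R is f x tensor 1 = 0. By flatness T = 0,
    so x is in I ker f. *)
Lemma flat_tor_free M : flat M -> tor_free M.
Proof.
move=> Mfl F f I fs Ii x xI.
pose Io : set (R^o : lmodType R) := I.
have IS : submodule Io.
  by apply: submoduleP => [|a b|a b]; [apply: ideal0|apply: idealD|apply: idealMl].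
pose A : lmodType R := submod_of Io.
pose inc : {linear A -> (R^o : lmodType R)} := inclusion _.
have inc_inj : injective inc by exact: val_inj.
have incP a : I (inc a) := submod_ofP IS a.
have mkA (a : R) : I a -> exists b, inc b = a by exact: (@submod_of_mk _ _ Io a).
pose S := [set z : F | exists2 k : ker f, k \in imul (ker f) I & z = val k].
have SS : submodule S.
  apply: submoduleP => [|_ _ [k kI ->] [l lI ->]|a _ [k kI ->]].
  - by exists 0; rewrite ?rpred0.
  - by exists (k + l); rewrite ?rpredD.
  by exists (a *: k); rewrite ?rpredZ.
pose pi : {linear F -> quotmod S} := quotmod_pi S.
have pi0 z : pi z = 0 <-> S z.
  by exact: quotmod_submod0.
have [sec secE] := choice fs.
have piI a z : I a -> f z = 0 -> pi (a *: z) = 0.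
  by move=> Ia /ker_mk[k <-]; apply/pi0; exists (a *: k); rewrite ?mem_imul.
pose b (y : M) (a : A) := pi ((inc a : R) *: sec y).
have bil : bilinear_map b.
  split=> [a c y y'|y c a a'].
    apply/subr0_eq; rewrite /b -(linearZ_LR pi) -(linearD pi) -(linearB pi).
    rewrite scalerA mulrC -scalerA -scalerDr -scalerBr piI //.
    by rewrite (linearB f) (linearD f) (linearZ_LR f) !secE subrr.
  rewrite /b (linearP inc) -(linearZ_LR pi) -(linearD pi); congr (pi _).
  by rewrite scalerDl scalerA.
have [L LE] := mk_linear (tensor_lift_linear bil).
pose tm : {linear tensor M A -> tensor M (R^o : lmodType R)} := tensor_map inc.
have main z : z \in imul F I -> exists T : tensor M A,
    L T = pi z /\ tm T = tens (f z) (1 : R^o).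
  move: z; apply: imul_ind => [|z w [T [e1 e2]] [T' [e3 e4]]|a z [T [e1 e2]]|a z Ia].
  - by exists 0; rewrite !linear0 tens0l.
  - exists (T + T'); rewrite (linearD L) (linearD tm) (linearD pi) (linearD f) tensDl.
    by rewrite e1 e2 e3 e4.
  - exists (a *: T); rewrite (linearZ_LR L) (linearZ_LR tm) (linearZ_LR pi) (linearZ_LR f).
    by rewrite tensZl e1 e2.
  have [a' a'E] := mkA a Ia; exists (tens (f z) a'); split.
    rewrite LE (tensor_lift_tens bil) /b a'E; apply/subr0_eq.
    by rewrite -(linearB pi) -scalerBr piI // (linearB f) secE subrr.
  rewrite [tm _]tensor_map_tens a'E (linearZ_LR f) tensZl -tensZr.
  by congr (tens _ _); rewrite [RHS]mulr1.
have [T [e1 e2]] := main _ xI.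
have T0 : T = 0.
  by apply: (Mfl _ _ _ inc_inj); rewrite -[LHS]/(tm T) e2 (kerE x) tens0l linear0.
have /pi0[k kI xk] : pi (val x) = 0 by rewrite -e1 T0 linear0.
by have -> : x = k by apply: val_inj.
Qed.

(** Elements of I F have the form a y + k with a in I, k in I ker f and y any preimage of 1 / r^n, n
    large. If such an element is in the kernel, then a / r^n = 0 and a = 0. *)
Lemma loc_tor_free r : r != 0 -> tor_free (loc r : lmodType R).
Proof.
move=> r0 F f I fs Ii x xI.
have main z : z \in imul F I -> exists n0, forall n y, (n0 <= n)%N -> f y = frac r 1 n ->
    exists a k, [/\ I a, k \in imul (ker f) I & z = a *: y + val k].
  move: z; apply: imul_ind => [|z w [n0 zE] [n1 wE]|a z [n0 zE]|a z Ia].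
  - by exists 0%N => n y _ _; exists 0, 0; split; rewrite ?rpred0 ?scale0r ?addr0 //; apply: ideal0.
  - exists (maxn n0 n1) => n y; rewrite geq_max => /andP[n0n n1n] fy.
    have [a [k [Ia kI ->]]] := zE n y n0n fy; have [b [l [Ib lI ->]]] := wE n y n1n fy.
    exists (a + b), (k + l); split; [exact: idealD|exact: rpredD|].
    by rewrite scalerDl addrACA.
  - exists n0 => n y n0n fy; have [b [k [Ib kI ->]]] := zE n y n0n fy.
    exists (a * b), (a *: k); split; [exact: idealMl|exact: rpredZ|].
    by rewrite scalerDr scalerA.
  have [c [n0 cE]] := frac_surj (f z); exists n0 => n y n0n fy.
  have [|k kE] := @ker_mk _ _ _ f (z - (c * r ^+ (n - n0)) *: y).
    rewrite linearB linearZ_LR cE fy fracZ mulr1; apply/eqP; rewrite subr_eq0; apply/eqP.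
    by apply: frac_eq; rewrite -mulrA -exprD subnK.
  exists (a * (c * r ^+ (n - n0))), (a *: k); split.
  - exact: idealMr.
  - exact: mem_imul.
  have -> : val (a *: k) = a *: val k by [].
  by rewrite kE scalerBr scalerA addrC subrK.
have [n0 xE] := main _ xI; have [y fy] := fs (frac r 1 n0).
have [a [k [_ kI e]]] := xE n0 y (leqnn _) fy.
suff a0 : a = 0.
  by have -> : x = k; [apply: val_inj; rewrite e a0 scale0r add0r|].
have : f (val x) = 0 by exact: kerE.
rewrite e linearD kerE addr0 linearZ_LR fy fracZ mulr1 => /fracP[j].
rewrite expr0 mul0r mulr0 mulr1 => /eqP.
by rewrite mulf_eq0 expf_eq0 (negPf r0) andbF => /eqP.
Qed.

(** The single element s tests contraadjustedness, since R[1/r] is Tor-free for r <> 0. *)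
Lemma solvable_contraadjusted C : solvable s C -> contraadjusted C.
Proof.
move=> sC r; have [->|r0] := eqVneq r 0; last exact/tor_free_ext1/sC/loc_tor_free.
by apply: ext1_tel; [exact: loc_tel|exact: solvable0].
Qed.

Lemma flat_very_flat M : flat M -> very_flat M.
Proof.
by move=> Mfl C /contraadjustedP CC; apply: tor_free_ext1; [apply: flat_tor_free|].
Qed.

End SemilocalCovers.

(** * Minimality of the special covers, and the contraadjusted envelopes *)

Section CoversAndEnvelopes.
Variables (R : idomainType) (N : nat) (m : 'I_N -> set R) (s : R).
Hypotheses (noethR : noetherian R) (mP : forall i, Spec R (m i)).
Hypotheses (m_inj : injective m) (s_neq0 : s != 0) (ms : forall i, m i s).
Hypothesis mall : forall P, Spec R P -> nonzero P -> exists i, P = m i.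
Hypothesis mmax : forall i a, ~ m i a -> exists b, m i (1 - b * a).
Implicit Types C D E F M V : lmodType R.

Let solvCA C : solvable s C -> contraadjusted C.
Proof. exact: (solvable_contraadjusted noethR mP m_inj s_neq0 ms mall mmax). Qed.

(* A map h into the kernel is topologically nilpotent: h^n = s q with q again
   a map into the kernel, so 1 - h^n is inverted by the series in s q, which
   converges because solutions in the kernel exist and are unique. *)
Lemma covering_very_flat : covering (@very_flat R).
Proof.
move=> M; have [F [f [[fs Fext Fker Fs] [fsolv funiq]]]] :=
  special_cover noethR mP m_inj s_neq0 ms mall mmax M.
have Fvf : very_flat F by move=> C /contraadjustedP/(_ s); apply: Fext.
exists F, f; split.
  by split=> // A f' Avf; have [g gE] := ext1_lift f' fs (Avf _ (solvCA fsolv));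
    exists g => x; rewrite /= gE.
(* h maps F into [ker f], which lies in every m_i F; so a power of h maps F into s F. *)
move=> g gf; pose h : {linear F -> F} := idfun \- g.
have fh x : f (h x) = 0 by rewrite /h /= linearB -[f (g x)]gf subrr.
have iterL n : exists q : {linear F -> F}, forall x, q x = iter n h x.
  elim: n => [|n [q qE]]; first by exists idfun.
  by exists (h \o q) => x; rewrite /= qE.
have [|||k kE] := @iter_imul R F h noethR _ (principal s).
- move=> P Pp Pn; exists 1%N => x; have [i ->] := mall Pp Pn.
  exact/Fker/fh.
- exact: principal_ideal.
- by exists s => //; apply: mem_principal.
have [q qE] := iterL k.+1.
have /choice[t tE] x : exists y, q x = s *: y.
  have [y yE] := imul_principal (kE x); exists (h y).
  by rewrite qE iterS yE linearZ_LR.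
have tl : linear t.
  move=> a x y; apply/subr0_eq/Fs; rewrite scalerBr -tE scalerDr scalerA mulrC -scalerA -!tE.
  by rewrite linearP subrr.
have [t' t'E] := mk_linear tl.
(* s th is h^(2k+2), and th ends with a power of h, hence lands in [ker f]. *)
pose th : {linear F -> F} := q \o t'.
have qq x : q (q x) = s *: th x by rewrite [q x]tE (linearZ_LR q) /th /= t'E.
have fth x : f (th x) = 0 by rewrite /th /= qE iterS fh.
have qqE x : q (q x) = iter (k.+1 + k.+1) h x by rewrite !qE iterD.
have hg x : g x = x - h x by rewrite /h /= subKr.
have tele n x : exists w, x - iter n h x = g w.
  elim: n => [|n [w wE]]; first by exists 0; rewrite linear0 subrr.
  exists (w + iter n h x); rewrite linearD -wE hg iterS.
  by rewrite addrA subrK.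
have ginj : injective g.
  move=> x y /eqP; rewrite -subr_eq0 -linearB => /eqP; set z := x - y => gz.
  apply: subr0_eq; rewrite -/z.
  have hz : h z = z by rewrite /h /= gz subr0.
  have zE : z = s *: th z.
    by rewrite -qq qqE; elim: (k.+1 + k.+1)%N => //= n <-.
  have fz n : f (iter n th z) = 0.
    by case: n => [|n]; [rewrite zE linearZ_LR fth scaler0|rewrite iterS fth].
  apply: (funiq (fun n => iter n th z)) => // n.
  by elim: n => [|n IH]; [exact: zE|rewrite !iterS {1}IH linearZ_LR].
(* x_n is the series of the s^j th^(n+1+j) y, and th x_n = x_(n+1) by uniqueness. So 1 - s th sends
   y + s x_0 to y, and by [tele] its image lies in that of g. *)
have gsurj y : exists w, g w = y.
  have /choice[c cE] n : exists c : ker f, val c = iter n.+1 th y.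
    by apply: ker_mk; rewrite iterS fth.
  have [x xE] := fsolv c.
  have xE' n : val (x n) - s *: val (x n.+1) = iter n.+1 th y by rewrite -cE -xE.
  have thx : th (val (x 0%N)) = val (x 1%N).
    apply/subr0_eq/(funiq (fun n => th (val (x n)) - val (x n.+1))) => n.
      by rewrite linearB fth kerE subrr.
    have e i : val (x i) = s *: val (x i.+1) + iter i.+1 th y by rewrite -xE' addrC subrK.
    have -> : th (val (x n)) = s *: th (val (x n.+1)) + th (iter n.+1 th y).
      by rewrite {1}(e n) (linearD th) (linearZ_LR th).
    rewrite scalerBr -addrA; congr (_ + _); rewrite (e n.+1) [in LHS]iterS.
    by rewrite opprD addrCA subrr addr0.
  have [w wE] := tele (k.+1 + k.+1)%N (y + s *: val (x 0%N)).
  exists w; rewrite -wE -qqE qq (linearD th) (linearZ_LR th) thx scalerDr -addrA.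
  rewrite (_ : th y = iter 1 th y) // -(xE' 0%N) scalerBr.
  by rewrite subrK subrr addr0.
have [gi giE] := choice gsurj.
by exists gi => x //; apply: ginj; rewrite giE.
Qed.

(* Ext^1(Q, M) is M^nat modulo the sequences z_n - s z_(n+1); the envelope
   solves formally the equations x_n - s x_(n+1) = c_n for c in a basis of it. *)
Lemma enveloping_contraadjusted : enveloping (@contraadjusted R).
Proof.
move=> M; pose W : lmodType R := nat -> M.
have dl : linear (fun z : W => (fun n => z n - s *: z n.+1) : W).
  move=> a z w; apply/funext => n.
  suff : a *: z n + w n - s *: (a *: z n.+1 + w n.+1) =
      a *: (z n - s *: z n.+1) + (w n - s *: w n.+1) by [].
  by rewrite scalerDr opprD addrACA scalerBr !scalerA (mulrC s).
have [d dE] := mk_linear dl.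
pose S := range d; have SS : submodule S := range_submodule d.
pose pi : {linear W -> quotmod S} := quotmod_pi S.
have pi0 c : pi c = 0 <-> exists z : nat -> M, forall n, c n = z n - s *: z n.+1.
  apply: iff_trans (quotmod_eq0 _ _) _; apply: iff_trans (spanP _ SS) _.
  split=> [[z _ <-]|[z zE]]; first by exists z => n; rewrite dE.
  by exists z => //; rewrite dE; apply/funext => n.
have [|K [t [ti ts]]] := @max_independent R [set 0] (quotmod S) (zero_prime R).
  by move=> r x ->; rewrite scale0r.
have /choice[c cE] k : exists c, pi c = t k by apply: quotmod_pi_surj.
have [E [i [e [ii eE univ norm]]]] := adjoin_solutions s (fun k : K * nat => c k.1 k.2).
pose ev n : {linear {freeg K / R} -> E} := fglift (fun k => e (k, n)).
pose cv n : {linear {freeg K / R} -> M} := fglift (fun k => c k n).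
pose cc : {linear {freeg K / R} -> W} := fglift c.
have ccE u n : cc u n = cv n u.
  have pl : linear (fun z : W => z n) by [].
  have [p pE] := mk_linear pl; rewrite -[LHS](pE (cc u)).
  apply: (freeg_linear_ext (g := p \o cc) (h := cv n)) => k.
  by rewrite /= [cc _]fglift1 [cv n _]fglift1 pE.
have picc u : pi (cc u) = fglift t u.
  apply: (freeg_linear_ext (g := pi \o cc) (h := fglift t)) => k.
  by rewrite /= [cc _]fglift1 fglift1 cE.
have evE n u : ev n u - s *: ev n.+1 u = i (cv n u).
  apply: (freeg_linear_ext (g := ev n \- (scale_map E s \o ev n.+1)) (h := i \o cv n)) => k.
  by rewrite /= [ev n _]fglift1 [ev n.+1 _]fglift1 [cv n _]fglift1 -eE.
have Ediv y : exists m' y', y = i m' + s *: y'.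
  have [n [v [m0 ->]]] := norm y; exists (m0 + cv n v), (ev n.+1 v).
  by rewrite (linearD i) -evE -addrA subrK.
(* [theta] sends e_(k,n) to s^(-n) in coordinate k and embeds E / M into a torsion free module. *)
have [theta [thi the]] : exists theta : {linear E -> (K -> Qmod R)},
    (forall x, theta (i x) = 0) /\
    forall k n, theta (e (k, n)) = (fun l => if k == l then (tofrac (s ^+ n))^-1 else 0).
  have [|th [th1 th2]] := univ (K -> Qmod R) \0
      (fun k l => if k.1 == l then (tofrac (s ^+ k.2))^-1 else 0 : Qmod R).
    move=> k n /=; apply/funext => l.
    suff : (if k == l then (tofrac (s ^+ n))^-1 else 0) -
      tofrac s * (if k == l then (tofrac (s ^+ n.+1))^-1 else 0) = 0 :> Qmod R by [].
    case: eqP => _; last by rewrite mulr0 subrr.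
    by rewrite exprS tofracM invfM mulrA divff ?tofrac_eq0 // mul1r subrr.
  by exists th; split=> // k n; rewrite th2.
have theta0 y : theta y = 0 -> exists x, i x = y.
  have [n [v [x ->]]] := norm y; rewrite linearD thi add0r => h.
  have thv u l : theta (ev n u) l = tofrac (coeff l u) * (tofrac (s ^+ n))^-1.
    elim/freeg_ind: u => [|u w eu ew|a u eu|k].
    - by rewrite !linear0 coeff0 tofrac0 mul0r.
    - rewrite (linearD (ev n)) (linearD theta) coeffD tofracD mulrDl -eu -ew //.
    - rewrite (linearZ_LR (ev n)) (linearZ_LR theta) coeffZ tofracM -mulrA -eu //.
    rewrite [ev n _]fglift1 the coeffU mul1r; case: eqP => _; first by rewrite tofrac1 mul1r.
    by rewrite tofrac0 mul0r.
  suff -> : v = 0 by exists x; rewrite linear0 addr0.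
  apply: freeg_coeff0 => k; have := thv v k; rewrite [ev n v]/(fglift _ v) h => /esym/eqP.
  rewrite mulf_eq0 invr_eq0 !tofrac_eq0 expf_eq0 (negPf s_neq0) andbF orbF.
  by move/eqP.
have Mtf y x : s *: y = i x -> exists x', i x' = y.
  move=> h; apply: theta0; have : s *: theta y = 0 by rewrite -linearZ_LR h thi.
  move=> h'; apply/funext => k; apply: (Qmod_torsion_free s_neq0).
  have := congr1 (fun f => f k) h'; exact.
have /choice[mm /choice[dv dvE]] := Ediv.
have half (a : nat -> M) : (exists z, forall n, s *: i (a n) = z n - s *: z n.+1) ->
    exists z, forall n, i (a n) = z n - s *: z n.+1.
  move=> [z zE]; exists (fun n => i (a n) + z n.+1) => n.
  by rewrite scalerDr opprD addrACA -zE subrK.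
(* A multiple by some r <> 0 of the class of a is a combination of the t_k, hence solvable in E. As
   r divides a power of s, [half] then removes the factors s one at a time. *)
have solveM (a : nat -> M) : exists z, forall n, i (a n) = z n - s *: z n.+1.
  have [r [u [/eqP r0 ru]]] := ts (pi a); have [j [b sb]] := power_multiple noethR ms mall r0.
  have /pi0[z zE] : pi (r *: (a : W) - cc u) = 0.
    by rewrite (linearB pi) (linearZ_LR pi) ru picc subrr.
  have : exists z, forall n, s ^+ j *: i (a n) = z n - s *: z n.+1.
    exists (fun n => b *: (ev n u + i (z n))) => n.
    rewrite sb -scalerA -(linearZ_LR i) (_ : r *: a n = cv n u + (z n - s *: z n.+1)); last first.
      by rewrite -zE -ccE; apply/esym; rewrite addrC; exact: subrK.
    rewrite scalerA (mulrC s) -scalerA -scalerBr; congr (_ *: _).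
    by rewrite (linearD i) (linearB i) (linearZ_LR i) -evE scalerDr opprD addrACA.
  elim: j {sb} => [[w wE]|j IH [w wE]].
    by exists w => n; rewrite -wE expr0 scale1r.
  apply: IH; have [|w' w'E] := half (fun n => s ^+ j *: a n).
    by exists w => n; rewrite (linearZ_LR i) scalerA -exprS wE.
  by exists w' => n; rewrite -w'E (linearZ_LR i).
have shift n v : exists y, s ^+ n *: ev n v = ev 0%N v - i y.
  elim: n => [|n [y yE]]; first by exists 0; rewrite linear0 subr0 scale1r.
  exists (y + s ^+ n *: cv n v).
  rewrite (linearD i) (linearZ_LR i) -evE scalerBr scalerA -exprSr opprD addrA -yE.
  by rewrite opprB addrCA subrr addr0.
(* If w_0 is ev n v modulo M, the chain makes the class of [cc v] zero; independence of the t_k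
   gives v = 0. *)
have chain (w : nat -> E) : (forall n, w n = s *: w n.+1) -> exists x, i x = w 0%N.
  move=> ws; have [n [v [x0 w0]]] := norm (w 0%N).
  have /choice[z zE] l : exists z, i z = s ^+ n *: w l - ev l v.
    elim: l => [|l [z zE]].
      have [y yE] := shift n v; exists (s ^+ n *: x0 - y).
      rewrite w0 scalerDr -/(ev n v) yE (linearB i) (linearZ_LR i).
      by rewrite -addrA; congr (_ + _); rewrite addrAC subrr add0r.
    apply: (Mtf _ (z + cv l v)); rewrite (linearD i) zE -evE scalerBr addrA subrK.
    by rewrite scalerA mulrC -scalerA -ws.
  have ccv : pi (cc v) = 0.
    apply/pi0; exists (fun l => - z l) => l; apply: ii; rewrite ccE -evE.
    rewrite (linearB i) (linearN i) (linearZ_LR i) (linearN i) !zE.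
    rewrite scalerN opprK !opprB scalerBr scalerA mulrC -scalerA -ws.
    by rewrite addrA subrK.
  have v0 : v = 0 by apply: freeg_coeff0 => k; apply: ti; rewrite -picc.
  by exists x0; rewrite w0 v0 linear0 addr0.
exists E, i; split; [split|].
- apply: solvCA => a.
  (* Dividing by s modulo M solves the equations up to a sequence from M, which [solveM] removes. *)
  pose p := fix p n := if n is l.+1 then dv (p l - a l) else 0.
  have pE n : p n - a n = i (mm (p n - a n)) + s *: p n.+1 by exact: dvE.
  clearbody p.
  have [q qE] := solveM (fun n => mm (p n - a n)).
  exists (fun n => p n - q n) => n.
  have pa : p n - s *: p n.+1 = a n + i (mm (p n - a n)).
    by apply/eqP; rewrite subr_eq -addrA -pE addrC subrK.
  rewrite /= [s *: (_ - _)]scalerBr opprB [_ *: q _ - _]addrC addrACA pa.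
  by rewrite [- q n + _]addrC -(opprB (q n)) -qE addrK.
- move=> C g CC; have sC : solvable s C by move/contraadjustedP: CC.
  have [x xE] := solvable_family (fun k => g (c k.1 k.2)) sC.
  by have [h [hi he]] := univ C g x xE; exists h => y; rewrite /= hi.
move=> g gi.
(* g - 1 kills M, so y = i m + s y' gives (g - 1) y = s (g - 1) y'. By [chain], g - 1 maps E into M;
   its square is therefore 0. *)
have gM y : exists x, i x = g y - y.
  apply: (chain (fun n => g (iter n dv y) - iter n dv y)) => n.
  rewrite iterS; move: (iter n dv y) => z; have e0 := dvE z.
  have hz : z - i (mm z) = s *: dv z by rewrite {1}e0 addrC addKr.
  have hg : g z - i (mm z) = s *: g (dv z).
    by rewrite -(linearZ_LR g) -hz (linearB g) -[g (i _)]gi.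
  by rewrite scalerBr -hz -hg opprB addrA subrK.
have gg y : g (g y) - g y = g y - y.
  have [x xE] := gM y; rewrite -[in X in X - _](subrK y (g y)) -xE (linearD g).
  by rewrite -[g (i x)]gi addrK.
have inv y : g y - (g (g y) - g y) = y by rewrite gg subKr.
by exists (fun y => y - (g y - y)) => y; rewrite ?(linearB g) inv.
Qed.

End CoversAndEnvelopes.

Theorem corollary5p7 (R : idomainType) (hR : noetherian R) :
  [<-> enveloping (@contraadjusted R);
       covering (@very_flat R);
       finite_set (Spec R) /\ krull_dim_le R 1;
       (forall M : lmodType R, flat M -> very_flat M)].
Proof.
have spec_goldman : finite_set (Spec R) /\ krull_dim_le R 1 ->
    exists (N : nat) (m : 'I_N -> set R) (s : R),
    [/\ forall i, Spec R (m i), injective m, s != 0, forall i, m i s &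
        (forall P, Spec R P -> nonzero P -> exists i, P = m i) /\
        forall i a, ~ m i a -> exists b, m i (1 - b * a)].
  move=> [finS dimR]; have [N [m [mP mn m_inj mall]]] := finite_spec_enum finS.
  have /choice[x xE] i : exists x, m i x /\ x != 0 by have [x] := mn i; exists x.
  (* s is a product of nonzero elements, one from each nonzero prime; it is 1 if there are none. *)
  exists N, m, (\prod_(i < N) x i); split=> //.
  - by apply/prodf_neq0 => i _; case: (xE i).
  - move=> i; rewrite (bigD1 i) //=; apply: idealMr; first exact: ideal_prime.
    by case: (xE i).
  by split=> // i a; apply: nonzero_prime_maximal.
tfae.
- move=> /(enveloping_goldman hR) /(goldman_finite_spec hR) /spec_goldman.
  by move=> [N [m [s [mP m_inj s0 ms [mall mmax]]]]]; apply: (@covering_very_flat R N m s).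
- by move=> /covering_goldman /(goldman_finite_spec hR).
- move=> /spec_goldman[N [m [s [mP m_inj s0 ms [mall mmax]]]]].
  exact: (@flat_very_flat R N m s).
move=> /flat_very_flat_goldman /(goldman_finite_spec hR) /spec_goldman.
by move=> [N [m [s [mP m_inj s0 ms [mall mmax]]]]]; apply: (@enveloping_contraadjusted R N m s).
Qed.
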